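(* Let $q\in[0,1]$, and let $\alpha\in(0,1]$ and $\beta\in(0,1)$ be constants. For each $n$ let $m=\alpha n$ and $k=\beta n$ (rounded to integers), and let $A$ be an $m\times n$ random matrix with i.i.d. standard normal entries. Let $h$ be a standard normal random variable, and for $\nu\ge 0,\gamma\ge 0$ define \[ I^{(1)}_{sec}(\nu,\gamma)=\mathbb{E}\max_{w\in\mathbb{R}}\Big(|h||w|+\nu|w|^q-\gamma w^2\Big),\qquad I^{(2)}_{sec}(\nu,\gamma)=\mathbb{E}\max_{w\in\mathbb{R}}\Big(|h||w|-\nu|w|^q-\gamma w^2\Big). \] Suppose \[ \min_{\gamma\ge 0,\ \nu\ge 0}\Big(\beta I^{(1)}_{sec}(\nu,\gamma)+(1-\beta)I^{(2)}_{sec}(\nu,\gamma)+\gamma\Big)<\sqrt{\alpha}. \] Then with overwhelming probability the following holds: for every vector $\tilde x\in\mathbb{R}^n$ with $\tilde x_1=\dots=\tilde x_{n-k}=0$, setting $y=A\tilde x$, the (unique) solution of $\min\{\|x\|_q^q : Ax=y\}$ is $\tilde x$.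
   Context: For $q\in(0,1]$, $\|x\|_q^q=\sum_i|x_i|^q$; for $q=0$ one uses the convention $|t|^0=1$ if $t\neq0$ and $0^0=0$, so that $\|x\|_0$ counts nonzero entries. ''With overwhelming probability'' means with probability at least $1-\epsilon_n$, where $\epsilon_n$ decays exponentially in $n$ as $n\to\infty$. *)

(* Defs.v *)
From HB Require Import structures.
From mathcomp Require Import all_boot all_order all_algebra.
From mathcomp Require Import all_classical all_reals all_analysis.
Set Implicit Arguments. Unset Strict Implicit. Unset Printing Implicit Defensive.
Import Order.TTheory GRing.Theory Num.Theory.
Local Open Scope classical_set_scope.
Local Open Scope ring_scope.

Definition absq {R : realType} (q t : R) : R :=
  if q == 0 then (if t == 0 then 0 else 1) else `|t| `^ q.

Definition lq_qnorm {R : realType} (q : R) (n : nat) (x : 'cV[R]_n) : R :=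
  \sum_(i < n) absq q (x i 0).

(* I^(1)_sec(nu,gamma) = E_h max_w ( |h||w| + nu |w|^q - gamma w^2 ), h ~ N(0,1).
   The max is taken as a supremum in the extended reals (it is +oo when gamma = 0). *)
Definition I1sec {R : realType} (q nu gamma : R) : \bar R :=
  (\int[normal_prob 0 1]_h
     ereal_sup [set (`|h| * `|w| + nu * absq q w - gamma * w ^+ 2)%:E | w in [set: R]])%E.

Definition I2sec {R : realType} (q nu gamma : R) : \bar R :=
  (\int[normal_prob 0 1]_h
     ereal_sup [set (`|h| * `|w| - nu * absq q w - gamma * w ^+ 2)%:E | w in [set: R]])%E.

Definition mutually_independent {d} {T : measurableType d} {R : realType}
    (P : probability T R) (I : finType) (X : I -> T -> R) : Prop :=
  forall (J : {set I}) (B : I -> set R), (forall i, measurable (B i)) ->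
    P (\bigcap_(i in [set` J]) (X i @^-1` B i)) = (\prod_(i in J) P (X i @^-1` B i))%E.

Definition iid_gaussian_matrix {d} {T : measurableType d} {R : realType}
    (P : probability T R) (m n : nat) (M : T -> 'M[R]_(m, n)) : Prop :=
  [/\ forall i j, measurable_fun setT (fun t => M t i j),
      forall i j (B : set R), measurable B ->
        P ((fun t => M t i j) @^-1` B) = normal_prob 0 1 B
    & mutually_independent P (fun ij : 'I_m * 'I_n => fun t => M t ij.1 ij.2)].

Definition recovers {R : realType} (q : R) (m n k : nat) (A : 'M[R]_(m, n)) : Prop :=
  forall xt : 'cV[R]_n, (forall i : 'I_n, (i < n - k)%N -> xt i 0 = 0) ->
    forall x : 'cV[R]_n, A *m x = A *m xt -> x <> xt -> lq_qnorm q xt < lq_qnorm q x.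

(* Main.v *)
(* By subadditivity of |t|^q it is enough that the kernel of A meets no unit vector s with
   sum_(i < n-k) |s_i|^q <= sum_(i >= n-k) |s_i|^q; let C be the set of these vectors.
   Take finite nets of w in C and of y in the unit sphere of R^m.  The Gaussian families
   X(w,y) = <y, A w> + g and Y(w,y) = <y, a> + <w, h> (g, a, h independent and standard)
   satisfy Cov X - Cov Y = (1 - <w,w'>)(1 - <y,y'>), which is nonnegative and vanishes
   for w = w'.  Hence Gordon's inequality: interpolating between the heat semigroups of Y
   and X, the expectation of prod_w (1 - prod_y (1 - p (v (w,y)))), p a smooth step, can
   only increase.  On the side of Y the event is |a| + min_w <w, h> large.  The norm |a|
   concentrates at sqrt m, and Lagrangian relaxation bounds - sqrt n min_w <w, h> by a sum
   of independent terms whose means are the quantities in the hypothesis; so Chernoff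
   bounds make the complement exponentially unlikely.  On the side of X, removing g and
   passing from the net to C gives the absence of kernel vectors in C. *)
Require Import Defs.
From HB Require Import structures.
From mathcomp Require Import all_boot all_order all_algebra.
From mathcomp Require Import all_classical all_reals all_analysis.
From mathcomp Require Import measurable_realfun.
From mathcomp Require Import ring lra.
Set Implicit Arguments. Unset Strict Implicit. Unset Printing Implicit Defensive.
Import Order.TTheory GRing.Theory Num.Theory.
Import numFieldNormedType.Exports.
Local Open Scope classical_set_scope.
Local Open Scope ring_scope.

(** * Gaussian expectations on the line *)

(** No union bound over the nets is taken: Gordon's inequality compares the whole min-max at once,
    so the cardinalities of the nets never enter the estimate and the meshes may shrink with n as
    fast as convenient. The strict inequality in the hypothesis leaves a gap 5 eta below sqrt alpha.
    In units of eta sqrt n it pays for the deviation of |a| (one unit), the net on the sphere (one),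
    the removal of g together with the width of the smooth step (two), and the second-order term and
    the decay rate of the Chernoff bound (half each). The obstacle is analytic. Gordon's inequality
    is usually proved by differentiating an expectation along the interpolation and integrating by
    parts. Here time is cut into N slices; a second-order Taylor bound with error of order N^(-3/2)
    per slice leaves a total error of order N^(-1/2). Only Lipschitz bounds and remainders along
    lines are involved. Since the smoothings commute, the slice being exchanged can be placed
    directly on the test function, so the generators are compared on that single function. *)

Notation gam R := (@normal_prob R 0 1).

Section expectation.
Context d (T : measurableType d) {R : realType} (P : probability T R).
Implicit Types f g : T -> R.

Definition Ex f : R := (\int[P]_x f x)%R.
Definition Ei f := P.-integrable setT (EFin \o f).

Lemma Ex_EFin f : Ei f -> ((Ex f)%:E = \int[P]_x (f x)%:E)%E.
Proof. by move=> fi; rewrite /Ex /Rintegral fineK//; exact: integrable_fin_num. Qed.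

Lemma Ei_le f g : measurable_fun setT f -> (forall x, `|f x| <= g x) -> Ei g -> Ei f.
Proof.
move=> mf fg ig; apply: (le_integrable measurableT _ _ ig); first exact/measurable_EFinP.
by move=> x _; rewrite /= lee_fin (le_trans (fg x))// ler_norm.
Qed.

Lemma Ei_cst c : Ei (cst c).
Proof. exact: finite_measure_integrable_cst. Qed.

Lemma Ei_bounded f (C : R) : measurable_fun setT f -> (forall x, `|f x| <= C) -> Ei f.
Proof. by move=> mf fC; apply: (Ei_le mf fC); exact: Ei_cst. Qed.

Lemma EiD f g : Ei f -> Ei g -> Ei (fun x => f x + g x).
Proof. by move=> fi gi; have := integrableD measurableT fi gi; apply. Qed.

Lemma EiB f g : Ei f -> Ei g -> Ei (fun x => f x - g x).
Proof. by move=> fi gi; have := integrableB measurableT fi gi; apply. Qed.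

Lemma EiZ (c : R) f : Ei f -> Ei (fun x => c * f x).
Proof. by move=> fi; have := integrableZl measurableT c fi; apply. Qed.

Lemma Ei_abs f : Ei f -> Ei (fun x => `|f x|).
Proof. by move=> fi; have := integrable_norm fi; apply. Qed.

Lemma Ex_cst c : Ex (cst c) = c.
Proof.
rewrite /Ex Rintegral_cst//.
rewrite (_ : fine _ = 1) ?mulr1//; exact: (congr1 fine (probability_setT P)).
Qed.

Lemma ExD f g : Ei f -> Ei g -> Ex (fun x => f x + g x) = Ex f + Ex g.
Proof. by move=> ? ?; rewrite /Ex RintegralD. Qed.

Lemma ExB f g : Ei f -> Ei g -> Ex (fun x => f x - g x) = Ex f - Ex g.
Proof. by move=> ? ?; rewrite /Ex RintegralB. Qed.

Lemma ExZ (c : R) f : Ei f -> Ex (fun x => c * f x) = c * Ex f.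
Proof. by move=> ?; rewrite /Ex RintegralZl. Qed.

Lemma Ex_le f g : Ei f -> Ei g -> (forall x, f x <= g x) -> Ex f <= Ex g.
Proof. by move=> ? ? fg; apply: le_Rintegral. Qed.

Lemma Ex_ge0 f : (forall x, 0 <= f x) -> 0 <= Ex f.
Proof. by move=> f0; apply: Rintegral_ge0. Qed.

Lemma Ex_abs f : Ei f -> `|Ex f| <= Ex (fun x => `|f x|).
Proof. by move=> ?; apply: le_normr_Rintegral. Qed.

Lemma Ex_sum (I : Type) (s : seq I) (F : I -> T -> R) : (forall i, Ei (F i)) ->
  Ei (fun x => \sum_(i <- s) F i x) /\
  Ex (fun x => \sum_(i <- s) F i x) = \sum_(i <- s) Ex (F i).
Proof.
move=> iF; elim: s => [|i s [IH1 IH2]].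
  under eq_fun do rewrite big_nil.
  by rewrite big_nil; split; [exact: Ei_cst|rewrite Ex_cst].
under eq_fun do rewrite big_cons.
by rewrite big_cons; split; [exact: EiD|rewrite ExD// IH2].
Qed.

End expectation.

Section gaussian_line.
Context {R : realType}.
Local Notation mu := (@lebesgue_measure R).

(** The change of variables goes through a Radon-Nikodym derivative, which agrees with [normal_pdf]
    only almost everywhere: both have the same integrals over measurable sets. *)
Lemma ge0_integral_normal_prob (f : R -> \bar R) :
  measurable_fun [set: R] f -> (forall x, 0 <= f x)%E ->
  (\int[gam R]_x f x = \int[mu]_x (f x * (normal_pdf 0 1 x)%:E))%E.
Proof.
move=> mf f0; have numu := normal_prob_dominates (0:R) 1.
rewrite -(Radon_Nikodym_SigmaFinite.change_of_variables numu)//=.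
apply: ae_eq_integral => //.
- apply: emeasurable_funM => //; apply: (measurable_int mu).
  exact: Radon_Nikodym_SigmaFinite.f_integrable.
- apply: emeasurable_funM => //=; apply/measurableT_comp => //=.
  exact: measurable_normal_pdf.
- apply: ae_eqe_mul2l => /=; apply: integral_ae_eq => //=.
  + exact: Radon_Nikodym_SigmaFinite.f_integrable.
  + by apply/measurable_funTS/measurableT_comp =>//; exact: measurable_normal_pdf.
  + by move=> E E01 mE; rewrite -Radon_Nikodym_SigmaFinite.f_integral.
Qed.

Lemma normal_pdf01E (x : R) : normal_pdf 0 1 x = normal_peak 1 * expR (- x ^+ 2 / 2).
Proof.
by rewrite /normal_pdf oner_eq0 /normal_fun subr0 expr1n.
Qed.

Lemma ge0_integral_gamN (f : R -> \bar R) :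
  measurable_fun [set: R] f -> (forall x, 0 <= f x)%E ->
  (\int[gam R]_x f (- x)%R = \int[gam R]_x f x)%E.
Proof.
move=> mf f0.
have mN : measurable_fun [set: R] (fun x : R => - x) by exact: measurable_funN.
rewrite ge0_integral_normal_prob//; last exact: measurableT_comp.
rewrite ge0_integral_normal_prob//.
pose g x := (f x * (normal_pdf 0 1 x)%:E)%E.
have mg : measurable_fun [set: R] g.
  apply: emeasurable_funM => //=; apply/measurableT_comp => //=.
  exact: measurable_normal_pdf.
have g0 x : (0 <= g x)%E by rewrite mule_ge0// lee_fin normal_pdf_ge0.
transitivity (\int[mu]_x (g \o -%R) x)%E.
  by apply: eq_integral => x _; rewrite /g/= !normal_pdf01E sqrrN.
rewrite -(ge0_integral_pushforward (mN : measurable_fun (T:=measurableTypeR R) (U:=measurableTypeR R) setT _) mu measurableT mg (fun x _ => g0 x)).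
by apply: eq_measure_integral => A mA _; exact: lebesgue_measureN.
Qed.


Lemma normal_peakV (s : R) : 0 < s -> normal_peak s = s^-1 * normal_peak 1.
Proof.
move=> s0; rewrite /normal_peak expr1n mul1r -mulrnAr sqrtrM ?sqr_ge0// sqrtr_sqr gtr0_norm//.
by rewrite invfM.
Qed.

Lemma integral_gam_expR (t : R) : t < 1 / 2 ->
  (\int[gam R]_x (expR (t * x ^+ 2))%:E = ((Num.sqrt (1 - 2 * t))^-1)%:E)%E.
Proof.
move=> t2; rewrite ge0_integral_normal_prob//; last first.
  apply/measurable_EFinP; apply: measurableT_comp => //=.
  by apply: measurable_funM => //; exact: measurable_funX.
set s := (Num.sqrt (1 - 2 * t))^-1.
have t0 : 0 < 1 - 2 * t by lra.
have s0 : 0 < s by rewrite invr_gt0 sqrtr_gt0.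
have s2 : s ^+ 2 = (1 - 2 * t)^-1 by rewrite exprVn sqr_sqrtr// ltW.
(* Multiplying the standard density by exp(t x^2) gives s times the centred normal density of
   standard deviation s. *)
transitivity (\int[mu]_x (s%:E * (normal_pdf 0 s x)%:E))%E.
  apply: eq_integral => x _; rewrite normal_pdf01E -!EFinM; congr (_%:E); move: x => /= x.
  rewrite /normal_pdf gt_eqF// (normal_peakV s0) /normal_fun subr0 s2.
  rewrite -[s^-1 * _ * _]mulrA mulVKf ?gt_eqF// mulrCA -expRD.
  congr (_ * expR _); field; lra.
rewrite ge0_integralZl//=; last 3 first.
- by apply/measurable_EFinP; exact: measurable_normal_pdf.
- by move=> x _; rewrite lee_fin normal_pdf_ge0.
- by rewrite lee_fin ltW.
by rewrite integral_normal_pdf mule1.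
Qed.


(** The weight exp(x^2/4) is integrable because 1/4 < 1/2; it dominates both the moments and the
    exponential functionals met below. *)
Lemma gam_integrable (f : R -> R) (C : R) : measurable_fun [set: R] f ->
  (forall x, `|f x| <= C * expR (4^-1 * x ^+ 2)) ->
  (gam R).-integrable setT (EFin \o f).
Proof.
move=> mf fC.
have mexp : measurable_fun [set: R] (fun x : R => (expR (4^-1 * x ^+ 2))%:E).
  apply/measurable_EFinP; apply: measurableT_comp => //=.
  by apply: measurable_funM => //; exact: measurable_funX.
have ig : (gam R).-integrable setT (fun x : R => (C * expR (4^-1 * x ^+ 2))%:E).
  rewrite (_ : (fun x => _) = (fun x => C%:E * (expR (4^-1 * x ^+ 2))%:E)%E); last first.
    by apply/funext => x; rewrite EFinM.
  apply: integrableZl => //; apply/integrableP; split => //.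
  under eq_integral do rewrite gee0_abs ?lee_fin ?expR_ge0//.
  rewrite integral_gam_expR ?ltry//; lra.
apply: (le_integrable measurableT _ _ ig); first exact/measurable_EFinP.
by move=> x _; rewrite /= lee_fin (le_trans (fC x))// ler_norm.
Qed.

Lemma gam_integrable_bounded (f : R -> R) (C : R) : measurable_fun [set: R] f ->
  (forall x, `|f x| <= C) -> (gam R).-integrable setT (EFin \o f).
Proof.
move=> mf fC; apply: (@gam_integrable _ C) => // x; rewrite (le_trans (fC x))//.
rewrite ler_peMr ?(le_trans _ (fC 0))//.
by apply: le_trans (expR_ge1Dx _); rewrite lerDl mulr_ge0// sqr_ge0.
Qed.


Definition gE (f : R -> R) : R := Ex (gam R) f.
Definition gint (f : R -> R) := Ei (gam R) f.

Lemma gE_EFin (f : R -> R) : gint f -> ((gE f)%:E = \int[gam R]_x (f x)%:E)%E.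
Proof. exact: Ex_EFin. Qed.

Lemma gint_cst c : gint (cst c). Proof. exact: Ei_cst. Qed.

Lemma gintD (f g : R -> R) : gint f -> gint g -> gint (fun x => f x + g x).
Proof. exact: EiD. Qed.

Lemma gintB (f g : R -> R) : gint f -> gint g -> gint (fun x => f x - g x).
Proof. exact: EiB. Qed.

Lemma gintZ (c : R) (f : R -> R) : gint f -> gint (fun x => c * f x).
Proof. exact: EiZ. Qed.

Lemma gint_le (f g : R -> R) : measurable_fun [set: R] f -> (forall x, `|f x| <= g x) -> gint g -> gint f.
Proof. by move=> mf fg ig; apply: (Ei_le (P := gam R) (f := f) (g := g)). Qed.

Lemma gint_abs (f : R -> R) : gint f -> gint (fun x => `|f x|).
Proof. exact: Ei_abs. Qed.

Lemma gE_cst c : gE (cst c) = c.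
Proof. exact: Ex_cst. Qed.

Lemma gED (f g : R -> R) : gint f -> gint g -> gE (fun x => f x + g x) = gE f + gE g.
Proof. exact: ExD. Qed.

Lemma gEB (f g : R -> R) : gint f -> gint g -> gE (fun x => f x - g x) = gE f - gE g.
Proof. exact: ExB. Qed.

Lemma gEZ (c : R) (f : R -> R) : gint f -> gE (fun x => c * f x) = c * gE f.
Proof. exact: ExZ. Qed.

Lemma gE_le (f g : R -> R) : gint f -> gint g -> (forall x, f x <= g x) -> gE f <= gE g.
Proof. by move=> fi gi fg; rewrite /gE Ex_le. Qed.

Lemma gE_ge0 (f : R -> R) : (forall x, 0 <= f x) -> 0 <= gE f.
Proof. by move=> f0; rewrite /gE Ex_ge0. Qed.

Lemma gE_abs (f : R -> R) : gint f -> `|gE f| <= gE (fun x => `|f x|).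
Proof. by move=> fi; rewrite /gE Ex_abs. Qed.

Lemma gE_sum (I : Type) (s : seq I) (F : I -> R -> R) :
  (forall i, gint (F i)) ->
  gint (fun x => \sum_(i <- s) F i x) /\
  gE (fun x => \sum_(i <- s) F i x) = \sum_(i <- s) gE (F i).
Proof. exact: Ex_sum. Qed.

(** With y = x^2/4, x^4 = 16 y^2 <= 32 exp y because y^2/2 <= exp y; together with 1 <= exp y this
    makes 33. *)
Let pow4_le (x : R) : 1 + x ^+ 4 <= 33 * expR (4^-1 * x ^+ 2).
Proof.
have y0 : 0 <= 4^-1 * x ^+ 2 by rewrite mulr_ge0// sqr_ge0.
have := expR_ge1Dxn 1 y0; have := expR_ge1Dx (4^-1 * x ^+ 2).
have -> : (2`!%:R : R) = 2 by [].
nra.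
Qed.

Lemma gint_id : gint (fun x => x).
Proof.
apply: (@gam_integrable _ 33) => // x; apply: le_trans (pow4_le x).
have := sqr_ge0 (x ^+ 2 - 1); have := sqr_ge0 (x - 1); have := sqr_ge0 (x + 1).
by have [x0|x0] := ger0P x; nra.
Qed.

Lemma gint_sqr : gint (fun x => x ^+ 2).
Proof.
apply: (@gam_integrable _ 33) => [|x]; first exact: measurable_funX.
rewrite ger0_norm ?sqr_ge0//; apply: le_trans (pow4_le x).
have := sqr_ge0 (x ^+ 2 - 1); nra.
Qed.

Lemma gint_cube : gint (fun x => `|x| ^+ 3).
Proof.
apply: (@gam_integrable _ 33) => [|x].
  exact: measurable_funX.
rewrite ger0_norm ?exprn_ge0//; apply: le_trans (pow4_le x).
rewrite -[x ^+ 4]ger0_norm ?exprn_even_ge0// normrX.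
set y := `|x|; have y0 : 0 <= y by exact: normr_ge0.
have := sqr_ge0 (y ^+ 2 - y); have := sqr_ge0 (y - 1); nra.
Qed.

Lemma gE_id : gE (fun x => x) = 0.
Proof.
rewrite /gE /Ex /Rintegral integralE.
pose f : R -> \bar R := EFin; rewrite -/f.
have mf : measurable_fun [set: R] f by exact/measurable_EFinP.
(* The symmetry x -> -x of the Gaussian law exchanges the positive and negative parts. *)
have -> : (\int[gam R]_x f^\- x = \int[gam R]_x f^\+ x)%E.
  rewrite -[RHS]ge0_integral_gamN//; last exact: (measurable_funepos mf).
  apply: eq_integral => x _; rewrite funenegE funeposE. by [].
rewrite subee//.
have ip := integrable_funepos measurableT gint_id.
exact: (integrable_fin_num measurableT ip).
Qed.

(** * Rotation invariance of the Gaussian law *)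

Section convolution.
Variables a b : R.
Hypotheses (a0 : 0 < a) (b0 : 0 < b) (ab1 : a ^+ 2 + b ^+ 2 = 1).

Lemma derive1_affine (c k : R) : (fun u : R => (u - c) / k)^`()%classic = cst k^-1.
Proof.
apply/funext => x; rewrite derive1E deriveM// deriveD// derive_cst scaler0.
by rewrite add0r derive_id derive_cst addr0 scaler1.
Qed.

Let inner (g : R -> R) x : continuous g -> (forall u, 0 <= g u) ->
  (\int[gam R]_y (g (a * x + b * y))%:E =
   \int[mu]_u (g u * (normal_pdf 0 1 ((u - a * x) / b) / b))%:E)%E.
Proof.
move=> cg g0.
have cgx : continuous (fun y => g (a * x + b * y)).
  move=> y; apply: (@continuous_comp _ _ _ (fun y => a * x + b * y) g); last exact: cg.
  by apply: continuousD; [exact: cvg_cst|apply: continuousM; [exact: cvg_cst|exact: cvg_id]].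
rewrite ge0_integral_normal_prob; last 2 first.
- by apply/measurable_EFinP; exact: continuous_measurable_fun.
- by move=> y; rewrite lee_fin.
under eq_integral do rewrite -EFinM.
rewrite (@increasing_ge0_integration_by_substitutionT _ (fun u => (u - a * x) / b)
  (fun y => g (a * x + b * y) * normal_pdf 0 1 y)).
- apply: eq_integral => u _; rewrite derive1_affine !fctE /=; congr _%:E.
  rewrite -[LHS]mulrA; congr (g _ * _).
  by rewrite mulrCA divff ?gt_eqF// mulr1 addrC subrK.
- by move=> u v uv; rewrite ltr_pM2r ?invr_gt0// ltrD2r.
- by rewrite derive1_affine => ?; exact: cvg_cst.
- by rewrite derive1_affine; exact: is_cvg_cst.
- by rewrite derive1_affine; exact: is_cvg_cst.
- by [].
- apply/gt0_cvgMlNy; last exact: cvg_addrr_Ny.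
  by rewrite invr_gt0.
- apply/gt0_cvgMly; last exact: cvg_addrr.
  by rewrite invr_gt0.
- move=> y; apply: continuousM; first exact: cgx.
  by apply: continuous_normal_pdf; rewrite oner_eq0.
- by move=> y; rewrite mulr_ge0// normal_pdf_ge0.
Qed.

(** Bayes' rule for u = a x + b y: the joint density of (x, u) is the law of x times that of u given
    x, and also the law of u times that of x given u, which is normal with mean a u and deviation b
    because a^2 + b^2 = 1. *)
Let swap_pdf u x : normal_pdf 0 1 ((u - a * x) / b) / b * normal_pdf 0 1 x =
  normal_pdf 0 1 u * normal_pdf (a * u) b x.
Proof.
rewrite !normal_pdf01E /normal_pdf gt_eqF// (normal_peakV b0) /normal_fun.
have -> : normal_peak 1 * expR (- ((u - a * x) / b) ^+ 2 / 2) / b * (normal_peak 1 * expR (- x ^+ 2 / 2)) =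
  normal_peak 1 ^+ 2 / b * (expR (- ((u - a * x) / b) ^+ 2 / 2) * expR (- x ^+ 2 / 2)) by field; rewrite gt_eqF.
have -> : normal_peak 1 * expR (- u ^+ 2 / 2) * (b^-1 * normal_peak 1 * expR (- (x - a * u) ^+ 2 / (b ^+ 2 *+ 2))) =
  normal_peak 1 ^+ 2 / b * (expR (- u ^+ 2 / 2) * expR (- (x - a * u) ^+ 2 / (b ^+ 2 *+ 2))) by field; rewrite gt_eqF.
rewrite -!expRD; congr (_ * expR _).
have bn0 : b != 0 by rewrite gt_eqF.
transitivity (- (u ^+ 2 - 2 * a * u * x + (a ^+ 2 + b ^+ 2) * x ^+ 2) / (2 * b ^+ 2)); first by field.
transitivity (- ((a ^+ 2 + b ^+ 2) * u ^+ 2 - 2 * a * u * x + x ^+ 2) / (2 * b ^+ 2)); last by field.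
by rewrite ab1; field.
Qed.

Lemma ge0_integral_gam_conv (g : R -> R) : continuous g -> (forall u, 0 <= g u) ->
  (\int[gam R]_x \int[gam R]_y (g (a * x + b * y))%:E = \int[gam R]_u (g u)%:E)%E.
Proof.
move=> cg g0.
under eq_integral do rewrite inner//.
have mk x : measurable_fun [set: R] (fun u => g u * (normal_pdf 0 1 ((u - a * x) / b) / b)).
  apply: measurable_funM; first exact: continuous_measurable_fun.
  apply: measurable_funM => //.
  apply: (measurableT_comp (measurable_normal_pdf 0 1)).
  by apply: measurable_funM => //; exact: measurable_funB.
have k0 x u : 0 <= g u * (normal_pdf 0 1 ((u - a * x) / b) / b).
  by rewrite mulr_ge0// divr_ge0 ?normal_pdf_ge0// ltW.
pose f (xu : R * R) := (g xu.2 * (normal_pdf 0 1 xu.2 * normal_pdf (a * xu.2) b xu.1))%:E.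
have f0 xu : (0 <= f xu)%E by rewrite lee_fin !mulr_ge0 ?normal_pdf_ge0.
have mf : measurable_fun [set: R * R] f.
  apply/measurable_EFinP; apply: measurable_funM.
    by apply: measurableT_comp => //; exact: continuous_measurable_fun.
  apply: measurable_funM.
    by apply: (measurableT_comp (measurable_normal_pdf 0 1)).
  rewrite /normal_pdf gt_eqF// /normal_fun.
  apply: measurable_funM => //; apply: measurableT_comp => //.
  apply: measurable_funM => //; apply: measurableT_comp => //.
  apply: measurable_funX; apply: measurable_funB => //.
  exact: measurable_funM.
pose h (xu : R * R) := (g xu.2 * (normal_pdf 0 1 ((xu.2 - a * xu.1) / b) / b))%:E.
have h0 xu : (0 <= h xu)%E by rewrite lee_fin.
have mh : measurable_fun [set: R * R] h.
  apply/measurable_EFinP; apply: measurable_funM.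
    by apply: measurableT_comp => //; exact: continuous_measurable_fun.
  apply: measurable_funM => //.
  apply: (measurableT_comp (measurable_normal_pdf 0 1)).
  apply: measurable_funM => //; apply: measurable_funB => //.
  exact: measurable_funM.
transitivity (\int[mu]_x \int[mu]_u f (x, u))%E.
  rewrite ge0_integral_normal_prob; last 2 first.
  - have := measurable_fun_fubini_tonelli_F (m2 := mu) h mh h0.
    by apply.
  - by move=> x; apply: integral_ge0 => u _; rewrite lee_fin.
  apply: eq_integral => x _.
  rewrite -ge0_integralZr//; last 3 first.
  - by apply/measurable_EFinP; exact: (mk x).
  - by move=> u _; rewrite lee_fin.
  - by rewrite lee_fin normal_pdf_ge0.
  by apply: eq_integral => u _; rewrite -EFinM -mulrA swap_pdf.
transitivity (\int[mu]_u \int[mu]_x f (x, u))%E.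
  exact: (fubini_tonelli (m1 := mu) (m2 := mu) f mf f0).
rewrite ge0_integral_normal_prob; last 2 first.
- by apply/measurable_EFinP; exact: continuous_measurable_fun.
- by move=> u; rewrite lee_fin.
apply: eq_integral => u _; rewrite /f /=.
under eq_integral do rewrite mulrA EFinM.
rewrite ge0_integralZl//; last 3 first.
- by apply/measurable_EFinP; exact: measurable_normal_pdf.
- by move=> x _; rewrite lee_fin normal_pdf_ge0.
- by rewrite lee_fin mulr_ge0// normal_pdf_ge0.
by rewrite integral_normal_pdf mule1 EFinM.
Qed.


(** The nonnegative version is applied to g + C, and the constant is cancelled at the end. *)
Lemma gE_conv (g : R -> R) (C : R) : continuous g -> (forall u, `|g u| <= C) ->
  gint (fun x => gE (fun y => g (a * x + b * y))) ->
  gE (fun x => gE (fun y => g (a * x + b * y))) = gE g.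
Proof.
move=> cg gC ii; pose g' u := g u + C.
have g'0 u : 0 <= g' u by have := gC u; rewrite ler_norml /g'; lra.
have cg' : continuous g' by move=> u; apply: continuousD; [exact: cg|exact: cvg_cst].
have cgx x : continuous (fun y => g (a * x + b * y)).
  move=> y; apply: (@continuous_comp _ _ _ (fun y => a * x + b * y) g); last exact: cg.
  by apply: continuousD; [exact: cvg_cst|apply: continuousM; [exact: cvg_cst|exact: cvg_id]].
have ig : gint g.
  by apply: (@gam_integrable_bounded _ C) => //; exact: continuous_measurable_fun.
have igx x : gint (fun y => g (a * x + b * y)).
  by apply: (@gam_integrable_bounded _ C) => //; exact: continuous_measurable_fun.
have e x : gE (fun y => g' (a * x + b * y)) = gE (fun y => g (a * x + b * y)) + C.
  by rewrite gED//; [rewrite gE_cst|exact: gint_cst].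
have := ge0_integral_gam_conv cg' g'0.
have ig' : gint g' by apply: gintD => //; exact: gint_cst.
rewrite -(gE_EFin ig') gED//; last exact: gint_cst.
rewrite gE_cst => /(congr1 fine)/=.
under eq_integral => x _.
  have igx' : gint (fun y => g' (a * x + b * y)) by apply: gintD => //; exact: gint_cst.
  rewrite -(gE_EFin igx') e; over.
move=> /= E; apply: (addIr C); rewrite -E.
rewrite -[in LHS](gE_cst C) -gED//; exact: gint_cst.
Qed.

End convolution.

End gaussian_line.

(** * Gaussian smoothing operators *)

Lemma lipschitz_continuous_R {R : realType} (h : R -> R) (L : R) :
  (forall x y, `|h x - h y| <= L * `|x - y|) -> continuous h.
Proof.
move=> hL x; apply/cvgrPdist_le => e e0 /=.
have L1 : 0 < `|L| + 1 by rewrite ltr_wpDl.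
near=> y.
rewrite (le_trans (hL _ _))//.
apply: (@le_trans _ _ ((`|L| + 1) * `|x - y|)).
  by apply: ler_wpM2r => //; rewrite (le_trans (ler_norm L))// lerDl.
rewrite mulrC -ler_pdivlMr//.
near: y; apply: cvgr_dist_le; first exact: cvg_id.
by rewrite divr_gt0.
Unshelve. all: by end_near. Qed.

(** The second alternative lets the error on the unbounded cells be charged to a multiple of e x^2,
    which integrates to O(e) under the Gaussian law. *)
Lemma gaussian_discretization {R : realType} (e : R) : 0 < e ->
  exists (n : nat) (g : R -> 'I_n) (c : 'I_n -> R),
    (forall j, measurable [set x : R | g x = j]) /\
    forall x, `|x - c (g x)| <= e \/ 1 <= e * x ^+ 2.
Proof.
move=> e0.
(* The window [-N, N], with N > 1/e, is cut into cells of width 1/N; the rescaled variable [y] then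
   runs over [0, 2 N^2]. Outside the window [truncn] and [inord] may return default values, which is
   harmless since there e x^2 > e N^2 >= 1. *)
pose N := (Num.truncn e^-1).+1; pose r : R := N%:R.
have r0 : 0 < r by rewrite ltr0n.
have er : 1 <= e * r.
  rewrite mulrC -ler_pdivrMr// div1r; apply/ltW.
  by rewrite /r /N truncnS_gt.
have r1 : 1 <= r by rewrite ler1n.
pose y x := r * (x + r).
have my (k : nat) : measurable [set x : R | y x < k%:R].
  have -> : [set x : R | y x < k%:R] = `]-oo, k%:R / r - r[%classic.
    by apply/seteqP; split => x /=; rewrite in_itv/= ltrBrDr ltr_pdivlMr// mulrC.
  exact: measurable_itv.
exists (2 * N ^ 2).+1, (fun x => inord (Num.truncn (y x))), (fun j => (j : nat)%:R / r - r); split.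
  move=> j.
  (* [truncn] is 0 on negative numbers, so the level set for k = 0 has no lower bound; hence the
     guard [(0 < k)%N]. *)
  have -> : [set x : R | inord (Num.truncn (y x)) = j] =
      \bigcup_(k in [set k : nat | inord k = j]) ([set x | y x < k.+1%:R] `\` [set x | (0 < k)%N /\ y x < k%:R]).
    apply/seteqP; split => x /=.
      move=> yj; exists (Num.truncn (y x)) => //; split => /=; first exact: truncnS_gt.
      by case E : (Num.truncn (y x)) => [|k] [] // _; rewrite -truncn_le_nat E ltnn.
    move=> [k /= <-]; case; rewrite -truncn_le_nat => yk ny; congr inord.
    apply/eqP; rewrite eqn_leq yk leqNgt; apply/negP => ky; apply: ny.
    by case: k ky {yk} => // k; rewrite ltnS truncn_le_nat.
  apply: bigcup_measurable => k _; apply: measurableD; first exact: my.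
  case: k => [|k]; first by rewrite (_ : [set _ | _] = set0)//; apply/seteqP; split => x //= [].
  by rewrite (_ : [set _ | _] = [set x | y x < k.+1%:R])//; apply/seteqP; split => x //= [].
move=> x; have [xr|xr] := ltP (r ^+ 2) (x ^+ 2).
  right; apply: (le_trans er); rewrite ler_pM2l//; apply: le_trans (ltW xr); nra.
have xr' : - r <= x <= r by rewrite -ler_norml -(@ler_pXn2r _ 2) ?nnegrE// ?real_normK ?num_real// ltW.
left; have y0 : 0 <= y x by rewrite mulr_ge0 ?(ltW r0)//; lra.
have := truncn_itv y0; set k := Num.truncn (y x) => /andP[ky yk].
have kN : (k <= 2 * N ^ 2)%N.
  rewrite -(ler_nat R) (le_trans ky)// /y natrM natrX -/r; nra.
rewrite inordK ?ltnS//.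
have -> : x - (k%:R / r - r) = (y x - k%:R) / r by rewrite /y; field; rewrite gt_eqF.
rewrite ger0_norm ?divr_ge0 ?subr_ge0// ?(ltW r0)// ler_pdivrMr//.
by apply: le_trans er; rewrite lerBlDl -natr1 in yk *; lra.
Qed.

Section heat_operators.
Context {R : realType} {K : finType}.
Local Notation V := {ffun K -> R}.
Implicit Types (a b u v : V) (f : V -> R) (C : R).

Definition norm1 a : R := \sum_k `|a k|.

Lemma norm1_ge0 a : 0 <= norm1 a. Proof. exact: sumr_ge0. Qed.

Lemma norm1Z (x : R) a : norm1 (x *: a) = `|x| * norm1 a.
Proof. by rewrite /norm1 mulr_sumr; apply: eq_bigr => k _; rewrite ffunE normrM. Qed.

(** Boundedness and the Lipschitz property share one constant, and Gaussian smoothing preserves it;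
    thus constants stay fixed however many smoothings are composed. *)
Definition blip C f := (forall v, `|f v| <= C) /\
  (forall u v, `|f u - f v| <= C * norm1 (u - v)).

Lemma blip_ge0 C f : blip C f -> 0 <= C.
Proof. by move=> [+ _] => /(_ 0); exact: le_trans. Qed.

Lemma blip_le C C' f : C <= C' -> blip C f -> blip C' f.
Proof.
move=> CC [fC fL]; split => [v|u v]; first exact: le_trans (fC v) CC.
by apply: (le_trans (fL u v)); rewrite ler_wpM2r// norm1_ge0.
Qed.

Lemma blip_line C f v a : blip C f -> forall x y : R,
  `|f (v + x *: a) - f (v + y *: a)| <= C * norm1 a * `|x - y|.
Proof.
move=> [_ fL] x y; apply: (le_trans (fL _ _)).
by rewrite (addrC v) addrKA -scalerBl norm1Z [`|_| * _]mulrC mulrA.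
Qed.

Lemma blip_continuous C f v a : blip C f -> continuous ((fun x => f (v + x *: a)) : R -> R).
Proof. by move=> fC; apply: lipschitz_continuous_R; exact: (blip_line v a fC). Qed.

Lemma blip_gint C f v a : blip C f -> gint (fun x : R => f (v + x *: a)).
Proof.
move=> fC; apply: (@gam_integrable_bounded _ _ C); last by move=> x; exact: fC.1.
by exact: (continuous_measurable_fun (@blip_continuous C f v a fC)).
Qed.

(* Expectations under Gaussian vectors are iterates of this one-dimensional smoothing, so
   that no Gaussian measure on a product space is needed. *)
Definition gs a f v : R := gE (fun x => f (v + x *: a)).

Lemma gs_blip C a f : blip C f -> blip C (gs a f).
Proof.
move=> fC; split => [v|u v].
  rewrite (le_trans (gE_abs (blip_gint v a fC)))// -[leRHS](gE_cst C).
  apply: gE_le => [||x]; [exact: gint_abs (blip_gint v a fC)|exact: gint_cst|exact: fC.1].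
rewrite /gs -gEB; [|exact: blip_gint fC..].
have ig := gintB (blip_gint u a fC) (blip_gint v a fC).
rewrite (le_trans (gE_abs ig))// -[leRHS](gE_cst (C * norm1 (u - v))).
apply: gE_le => [||x]; [exact: gint_abs|exact: gint_cst|].
by apply: (le_trans (fC.2 _ _)); rewrite opprD addrACA subrr addr0.
Qed.

Lemma gs_le C D a f g : blip C f -> blip D g -> (forall v, f v <= g v) ->
  forall v, gs a f v <= gs a g v.
Proof. by move=> fC gD fg v; apply: gE_le => [||x //]; [exact: (blip_gint v a fC)|exact: (blip_gint v a gD)]. Qed.

Lemma gs_cst (c : R) a v : gs a (fun=> c) v = c.
Proof. exact: gE_cst. Qed.

Lemma blip_cst (c : R) : blip `|c| (fun=> c).
Proof. by split => // u v; rewrite subrr normr0 mulr_ge0// norm1_ge0. Qed.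

Lemma blipD C D f g : blip C f -> blip D g -> blip (C + D) (fun v => f v + g v).
Proof.
move=> [f1 f2] [g1 g2]; split => [v|u v]; first by rewrite (le_trans (ler_normD _ _))// lerD.
by rewrite opprD addrACA (le_trans (ler_normD _ _))// mulrDl lerD.
Qed.

Lemma blipZ C (c : R) f : blip C f -> blip (`|c| * C) (fun v => c * f v).
Proof.
move=> [f1 f2]; split => [v|u v]; first by rewrite normrM ler_wpM2l.
by rewrite -mulrBr normrM -mulrA ler_wpM2l.
Qed.

Lemma gsD C D a f g v : blip C f -> blip D g ->
  gs a (fun v => f v + g v) v = gs a f v + gs a g v.
Proof. by move=> fC gD; rewrite /gs gED//; [exact: (blip_gint v a fC)|exact: (blip_gint v a gD)]. Qed.

Lemma gsZ C (c : R) a f v : blip C f -> gs a (fun v => c * f v) v = c * gs a f v.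
Proof. by move=> fC; rewrite /gs gEZ//; exact: (blip_gint v a fC). Qed.

Lemma gs_dist C D (e : R) a f g : blip C f -> blip D g -> (forall v, `|f v - g v| <= e) ->
  forall v, `|gs a f v - gs a g v| <= e.
Proof.
move=> fC gD fg v; rewrite /gs -gEB; [|exact: (blip_gint v a fC)|exact: (blip_gint v a gD)].
have ig := gintB (blip_gint v a fC) (blip_gint v a gD).
rewrite (le_trans (gE_abs ig))// -[leRHS](gE_cst e).
by apply: gE_le => [||x]; [exact: gint_abs|exact: gint_cst|exact: fg].
Qed.

Definition disc n (p c : 'I_n -> R) a f v : R := \sum_j p j * f (v + c j *: a).

Section discretized_line.
Variables (n : nat) (g : R -> 'I_n) (c : 'I_n -> R) (e : R).
Hypotheses (e0 : 0 < e) (mg : forall j, measurable [set x : R | g x = j]).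
Hypothesis gc : forall x, `|x - c (g x)| <= e \/ 1 <= e * x ^+ 2.

Definition cell_mass j : R := gE (fun x => (g x == j)%:R).

Lemma cell_indic d (T : measurableType d) (X : T -> R) j :
  (fun t => (g (X t) == j)%:R : R) = \1_(X @^-1` [set x | g x = j]).
Proof.
apply/funext => t; rewrite indicE.
suff -> : (t \in X @^-1` [set x | g x = j]) = (g (X t) == j) by [].
by apply/idP/idP; rewrite inE => /eqP.
Qed.

(** Close to the cell centre the Lipschitz bound applies; far out the trivial bound 2 C is at most 2
    C e x^2. *)
Lemma blip_line_disc C f v a x : blip C f ->
  `|f (v + x *: a) - f (v + c (g x) *: a)| <= C * norm1 a * e + 2 * C * e * x ^+ 2.
Proof.
move=> fC; have C0 := blip_ge0 fC; have [xc|xd] := gc x.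
  rewrite (le_trans (blip_line v a fC _ _))//.
  rewrite -[leLHS]addr0 lerD//; first by rewrite ler_wpM2l// mulr_ge0// norm1_ge0.
  by rewrite mulr_ge0 ?sqr_ge0// mulr_ge0 ?(ltW e0)// mulr_ge0.
rewrite (le_trans (ler_normB _ _))//.
apply: (@le_trans _ _ (2 * C)).
  by have := fC.1 (v + x *: a); have := fC.1 (v + c (g x) *: a); lra.
rewrite -[leLHS]add0r lerD//; first by rewrite mulr_ge0 ?(ltW e0)// mulr_ge0// norm1_ge0.
by rewrite -[leRHS]mulrA ler_peMr// mulr_ge0.
Qed.

Lemma gs_disc_err C a f v : blip C f ->
  `|gs a f v - disc cell_mass c a f v| <= (C * norm1 a + 2 * C * gE (fun x => x ^+ 2)) * e.
Proof.
move=> fC.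
have mi j : gint (fun x : R => (g x == j)%:R).
  apply: (@gam_integrable_bounded _ _ 1) => [|x]; last by case: eqP; rewrite ?normr1 ?normr0.
  by rewrite (cell_indic id j); apply: measurable_indic; exact: (mg j).
have [i1 <-] : gint (fun x : R => f (v + c (g x) *: a)) /\
    gE (fun x : R => f (v + c (g x) *: a)) = disc cell_mass c a f v.
  have -> : (fun x : R => f (v + c (g x) *: a)) =
      (fun x : R => \sum_j f (v + c j *: a) * (g x == j)%:R).
    apply/funext => x; rewrite (bigD1 (g x))//= eqxx mulr1 big1 ?addr0// => j gj.
    by rewrite eq_sym (negbTE gj) mulr0.
  have [i1 i2] := gE_sum (index_enum _) (fun j => gintZ (f (v + c j *: a)) (mi j)).
  split => //; rewrite i2; apply: eq_bigr => j _.
  by rewrite gEZ// mulrC.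
rewrite /gs -gEB//; last exact: (blip_gint v a fC).
have ig := gintB (blip_gint v a fC) i1.
rewrite (le_trans (gE_abs ig))//.
have i3 : gint (fun x : R => C * norm1 a * e + 2 * C * e * x ^+ 2).
  by apply: gintD; [exact: gint_cst|apply: gintZ; exact: gint_sqr].
apply: (@le_trans _ _ (gE (fun x => C * norm1 a * e + 2 * C * e * x ^+ 2))).
  apply: gE_le => //; first exact: gint_abs.
  by move=> x; exact: blip_line_disc.
rewrite gED ?gE_cst ?gEZ//; [|exact: gint_sqr|exact: gint_cst|exact: gintZ gint_sqr].
by rewrite le_eqVlt; apply/orP; left; apply/eqP; ring.
Qed.

End discretized_line.

(** The order of quantifiers matters: one quadrature rule serves every f with constant C, in
    particular both f and [gs b f] in the proof of commutation. *)
Lemma gs_disc C a : 0 <= C -> forall e : R, 0 < e -> exists n (p c : 'I_n -> R),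
  forall f, blip C f -> forall v, `|gs a f v - disc p c a f v| <= e.
Proof.
move=> C0 e e0.
pose M := C * norm1 a + 2 * C * gE (fun x => x ^+ 2) + 1.
have m20 : 0 <= gE (fun x : R => x ^+ 2) by apply: gE_ge0 => x; rewrite sqr_ge0.
have M0 : 0 < M by rewrite ltr_wpDl// addr_ge0// !mulr_ge0// norm1_ge0.
have eM := divr_gt0 e0 M0.
have [n [g [c [mg gc]]]] := gaussian_discretization eM.
exists n, (cell_mass g), c => f fC v.
apply: (le_trans (gs_disc_err eM mg gc a v fC)).
by rewrite mulrCA ler_piMr ?(ltW e0)// ler_pdivrMr// mul1r lerDl.
Qed.

Lemma gs_sum C a n (F : 'I_n -> V -> R) v : (forall j, blip C (F j)) ->
  gs a (fun v => \sum_j F j v) v = \sum_j gs a (F j) v.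
Proof. by move=> FC; have [] := gE_sum (index_enum _) (fun j => blip_gint v a (FC j)). Qed.

Lemma disc_blip C n (p c : 'I_n -> R) a f : blip C f -> exists D, blip D (disc p c a f).
Proof.
move=> fC; rewrite /disc.
have : exists D, blip D (fun v => \sum_(j <- index_enum 'I_n) p j * f (v + c j *: a)).
  elim: (index_enum _) => [|j s [D IH]].
    exists `|0 : R|; under eq_fun do rewrite big_nil; exact: blip_cst.
  exists (`|p j| * C + D); under eq_fun do rewrite big_cons.
  apply: blipD => //; apply: blipZ; split => [v|u v]; first exact: fC.1.
  by apply: (le_trans (fC.2 _ _)); rewrite opprD addrACA subrr addr0.
by [].
Qed.

(** A finite quadrature rule for [gs a] commutes with [gs b] by linearity; letting its error tend to
    zero gives the claim, in place of an appeal to Fubini. *)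
Lemma gsC C a b f : blip C f -> gs a (gs b f) =1 gs b (gs a f).
Proof.
move=> fC v; apply/eqP; rewrite -subr_eq0 -normr_le0; apply/ler_addgt0Pr => e e0.
rewrite add0r; have e2 : 0 < e / 2 by lra.
have [n [p [c pc]]] := gs_disc a (blip_ge0 fC) e2.
have [D dD] := disc_blip p c a fC.
have E : gs b (disc p c a f) v = disc p c a (gs b f) v.
  have sh j : blip (`|p j| * C) (fun v => p j * f (v + c j *: a)).
    apply: blipZ; split => [u|u w]; first exact: fC.1.
    by apply: (le_trans (fC.2 _ _)); rewrite opprD addrACA subrr addr0.
  have sh' j : blip (\sum_j `|p j| * C) (fun v => p j * f (v + c j *: a)).
    apply: blip_le (sh j); rewrite (bigD1 j)//= lerDl sumr_ge0// => i _.
    by rewrite mulr_ge0// (blip_ge0 fC).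
  rewrite /disc (gs_sum _ _ sh'); apply: eq_bigr => j _.
  rewrite /gs -gEZ; last exact: (blip_gint _ b fC).
  by congr gE; apply/funext => x; rewrite addrAC.
have h1 := pc _ (gs_blip b fC) v.
have h2 := gs_dist b (gs_blip a fC) dD (pc _ fC) v.
rewrite E in h2.
move: h1 h2; move: (gs a _ v) (gs b _ v) (disc _ _ _ _ v) => x y z h1 h2.
by have := ler_distD z x y; rewrite (distrC z y); lra.
Qed.

Lemma gs_semigroup C a f (s t : R) : 0 <= s -> 0 <= t -> blip C f ->
  gs (Num.sqrt s *: a) (gs (Num.sqrt t *: a) f) =1 gs (Num.sqrt (s + t) *: a) f.
Proof.
have g0 h v : gs 0 h v = h v.
  by rewrite /gs -[RHS]gE_cst; congr gE; apply/funext => x; rewrite scaler0 addr0.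
move=> s0 t0 fC v.
have [->|sn] := eqVneq s 0; first by rewrite sqrtr0 scale0r add0r g0.
have [->|tn] := eqVneq t 0.
  rewrite sqrtr0 scale0r addr0; congr gE; apply/funext => x; exact: g0.
have s1 : 0 < s by rewrite lt_neqAle eq_sym sn.
have t1 : 0 < t by rewrite lt_neqAle eq_sym tn.
have st : 0 < s + t by rewrite addr_gt0.
pose r := Num.sqrt (s + t).
have r0 : 0 < r by rewrite sqrtr_gt0.
have e (x y : R) : v + x *: (Num.sqrt s *: a) + y *: (Num.sqrt t *: a) =
    v + (Num.sqrt s / r * x + Num.sqrt t / r * y) *: (r *: a).
  rewrite -addrA !scalerA -scalerDl; congr (_ + _ *: _); field; exact: lt0r_neq0.
(* Up to the factor r, the two independent steps form a rotated standard pair, so [gE_conv]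
   applies. *)
have abE : (Num.sqrt s / r) ^+ 2 + (Num.sqrt t / r) ^+ 2 = 1.
  by rewrite !expr_div_n !sqr_sqrtr// -?mulrDl ?divff ?gt_eqF// ltW.
pose g (z : R) := f (v + z *: (r *: a)).
have h x : (fun y => f (v + x *: (Num.sqrt s *: a) + y *: (Num.sqrt t *: a))) =
   (fun y => g (Num.sqrt s / r * x + Num.sqrt t / r * y)).
  by apply/funext => y; rewrite e.
have ii := blip_gint v (Num.sqrt s *: a) (gs_blip (Num.sqrt t *: a) fC).
have e2 : (fun x => gs (Num.sqrt t *: a) f (v + x *: (Num.sqrt s *: a))) =
    (fun x => gE (fun y => g (Num.sqrt s / r * x + Num.sqrt t / r * y))).
  by apply/funext => x; rewrite /gs h.
have -> : gs (Num.sqrt s *: a) (gs (Num.sqrt t *: a) f) v =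
  gE (fun x => gE (fun y => g (Num.sqrt s / r * x + Num.sqrt t / r * y))) := congr1 gE e2.
have b0 : 0 < Num.sqrt t / r by rewrite divr_gt0 ?sqrtr_gt0.
apply: (gE_conv b0 abE (g := g) (C := C)).
- exact: (@blip_continuous C f v (r *: a) fC).
- by move=> u; exact: fC.1.
- exact: (eq_ind _ (@gint R) ii _ e2).
Qed.

Definition gsl (l : seq V) f : V -> R := foldr gs f l.

Lemma gsl_blip C l f : blip C f -> blip C (gsl l f).
Proof. by move=> fC; elim: l => //= a l IH; exact: gs_blip. Qed.

Lemma gsl_cat l1 l2 f : gsl (l1 ++ l2) f = gsl l1 (gsl l2 f).
Proof. exact: foldr_cat. Qed.

Lemma gsl_le C D l f g : blip C f -> blip D g -> (forall v, f v <= g v) ->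
  forall v, gsl l f v <= gsl l g v.
Proof.
move=> fC gD fg; elim: l => //= a l IH v.
by apply: (gs_le a _ _ IH); [exact: gsl_blip fC|exact: gsl_blip gD].
Qed.

Lemma gs_ext a f g : f =1 g -> gs a f =1 gs a g.
Proof. by move=> /funext ->. Qed.

Lemma gsl_ext l f g : f =1 g -> gsl l f =1 gsl l g.
Proof. by move=> /funext ->. Qed.

Lemma gsl_gsC C a l f : blip C f -> gs a (gsl l f) =1 gsl l (gs a f).
Proof.
move=> fC; elim: l => //= b l IH v.
by rewrite (gsC a b (gsl_blip l fC)); exact: (gs_ext b IH).
Qed.

Lemma gslC C l1 l2 f : blip C f -> gsl l1 (gsl l2 f) =1 gsl l2 (gsl l1 f).
Proof.
move=> fC; elim: l1 => //= a l1 IH v.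
rewrite -(gsl_gsC a l2 (gsl_blip l1 fC)); exact: (gs_ext a IH).
Qed.

(* Expectation of [f] at a Gaussian vector with covariance [t * \sum_(a <- l) a a^T] *)
Definition heat (t : R) (l : seq V) f := gsl [seq Num.sqrt t *: a | a <- l] f.

(** Commutation brings the two smoothings along each direction next to each other, where the
    one-dimensional semigroup law merges them. *)
Lemma heat_semigroup C l f (s t : R) : 0 <= s -> 0 <= t -> blip C f ->
  heat s l (heat t l f) =1 heat (s + t) l f.
Proof.
move=> s0 t0 fC; rewrite /heat; elim: l => [|a l IH] v; first by [].
rewrite /=.
have fl := gsl_blip [seq Num.sqrt t *: a | a <- l] fC.
have e := gsl_gsC (Num.sqrt t *: a) [seq Num.sqrt s *: a | a <- l] fl.
rewrite (gs_ext (Num.sqrt s *: a) (fun u => esym (e u))).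
have fl2 := gsl_blip [seq Num.sqrt s *: a | a <- l] fl.
rewrite (gs_semigroup a s0 t0 fl2).
exact: (gs_ext _ IH).
Qed.

Lemma heat0 l f : heat 0 l f =1 f.
Proof.
rewrite /heat; elim: l => [|a l IH] v; first by [].
rewrite /= /gs -[RHS]gE_cst.
by apply: (congr1 gE); apply/funext => x; rewrite IH sqrtr0 scale0r scaler0 addr0.
Qed.

End heat_operators.

(** * Smooth step and jets *)

Section spline.
Context {R : realType}.
Implicit Types x h : R.

Definition pospart x : R := Num.max x 0.

(* [spline0] is the distribution function of the quadratic B-spline on [0, 3]: a C^2 step,
   with exact values 0 and 1 outside [0, 3] *)
Definition spline0 x : R := (pospart x ^+ 3 - 3 * pospart (x - 1) ^+ 3
  + 3 * pospart (x - 2) ^+ 3 - pospart (x - 3) ^+ 3) / 6.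
Definition spline1 x : R := (pospart x ^+ 2 - 3 * pospart (x - 1) ^+ 2
  + 3 * pospart (x - 2) ^+ 2 - pospart (x - 3) ^+ 2) / 2.
Definition spline2 x : R := pospart x - 3 * pospart (x - 1)
  + 3 * pospart (x - 2) - pospart (x - 3).

Lemma pospartP x : (0 <= x /\ pospart x = x) \/ (x <= 0 /\ pospart x = 0).
Proof. by rewrite /pospart; have [] := leP x 0; [right|left; split => //; exact: ltW]. Qed.

Ltac spline_cases x :=
  case: (pospartP x) => -[? ->]; case: (pospartP (x - 1)) => -[? ->];
  case: (pospartP (x - 2)) => -[? ->]; case: (pospartP (x - 3)) => -[? ->];
  try (exfalso; lra).

Lemma spline0_le0 x : x <= 0 -> spline0 x = 0.
Proof. by move=> x0; rewrite /spline0; spline_cases x; (try nra); have -> : x = 0 by lra. Qed.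

Lemma spline0_ge3 x : 3 <= x -> spline0 x = 1.
Proof. by move=> x0; rewrite /spline0; spline_cases x; nra. Qed.

Let cube_itv (t : R) : 0 <= t <= 1 ->
  0 <= t ^+ 3 <= 1 /\ 3 * t - 2 <= t ^+ 3 <= t /\ 0 <= t ^+ 2 <= t /\ 0 <= t <= 1.
Proof.
move=> /andP[t0 t1]; have t2 : 0 <= t ^+ 2 <= t by rewrite sqr_ge0 expr2 ler_piMr.
have t3 : 0 <= t ^+ 3 <= t ^+ 2 by rewrite exprn_ge0//= exprSr ler_piMr ?sqr_ge0.
have t4 : 3 * t - 2 <= t ^+ 3.
  have e : t ^+ 3 - (3 * t - 2) = (t - 1) ^+ 2 * (t + 2) by ring.
  by rewrite -subr_ge0 e; apply: mulr_ge0; [exact: sqr_ge0|lra].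
by split; [|split; [|split]]; rewrite ?t2 ?t0 ?t1 ?t4//; lra.
Qed.

Lemma spline0_itv x : 0 <= spline0 x <= 1.
Proof.
have [x0|x0] := leP x 0; first by rewrite spline0_le0// lexx ler01.
have [x3|x3] := leP 3 x; first by rewrite spline0_ge3// lexx ler01.
rewrite /spline0; spline_cases x.
- have /cube_itv : 0 <= 3 - x <= 1 by lra.
  move=> [/andP[? ?] [/andP[? ?] [/andP[? ?] /andP[? ?]]]]; have -> : (x ^+ 3 - 3 * (x - 1) ^+ 3 + 3 * (x - 2) ^+ 3 - 0 ^+ 3) / 6 = 1 - (3 - x) ^+ 3 / 6 by field.
  by apply/andP; split; lra.
- have /cube_itv : 0 <= x - 1 <= 1 by lra.
  move=> [/andP[? ?] [/andP[? ?] [/andP[? ?] /andP[? ?]]]]; have -> : (x ^+ 3 - 3 * (x - 1) ^+ 3 + 3 * 0 ^+ 3 - 0 ^+ 3) / 6 =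
    (1 + 3 * (x - 1) + 3 * (x - 1) ^+ 2 - 2 * (x - 1) ^+ 3) / 6 by field.
  by apply/andP; split; lra.
- have /cube_itv : 0 <= x <= 1 by lra.
  move=> [/andP[? ?] [/andP[? ?] [/andP[? ?] /andP[? ?]]]]; have -> : (x ^+ 3 - 3 * 0 ^+ 3 + 3 * 0 ^+ 3 - 0 ^+ 3) / 6 = x ^+ 3 / 6 by field.
  by apply/andP; split; lra.
Qed.

Lemma spline1_itv x : 0 <= spline1 x <= 2.
Proof. by rewrite /spline1; spline_cases x; apply/andP; split; nra. Qed.

Lemma spline2_itv x : - 2 <= spline2 x <= 2.
Proof. by rewrite /spline2; spline_cases x; apply/andP; split; nra. Qed.


(** Regularity of class C^2 with Lipschitz second derivative, expressed by Taylor remainders, so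
    that no derivative has to be formed. *)
Definition smooth3 (p p1 p2 : R -> R) := exists C : R,
  [/\ forall x, [/\ `|p x| <= C, `|p1 x| <= C & `|p2 x| <= C],
      forall x h, `|p (x + h) - (p x + h * p1 x + h ^+ 2 / 2 * p2 x)| <= C * `|h| ^+ 3,
      forall x h, `|p1 (x + h) - (p1 x + h * p2 x)| <= C * h ^+ 2
    & forall x h, `|p2 (x + h) - p2 x| <= C * `|h|].

(** The j-th power of the positive part differs from its Taylor polynomial of degree j - 1 by at
    most |h|^j. When x and x + h lie on the same side of 0 the remainder is h^j or 0; otherwise |x|
    and |x + h| are both at most |h|. *)
Let pos_taylor x h : [/\ `|pospart (x + h) - pospart x| <= `|h|,
  `|pospart (x + h) ^+ 2 - (pospart x ^+ 2 + h * (2 * pospart x))| <= h ^+ 2 &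
  `|pospart (x + h) ^+ 3 - (pospart x ^+ 3 + h * (3 * pospart x ^+ 2) + h ^+ 2 / 2 * (6 * pospart x))| <= `|h| ^+ 3].
Proof.
have [[x0 ->]|[x0 ->]] := pospartP x; have [[y0 ->]|[y0 ->]] := pospartP (x + h).
- rewrite addrAC subrr add0r lexx.
  have -> : (x + h) ^+ 2 - (x ^+ 2 + h * (2 * x)) = h ^+ 2 by ring.
  have -> : (x + h) ^+ 3 - (x ^+ 3 + h * (3 * x ^+ 2) + h ^+ 2 / 2 * (6 * x)) = h ^+ 3 by field.
  by rewrite !normrX real_normK ?num_real.
- have h0 : h <= 0 by lra.
  rewrite (ler0_norm h0) sub0r normrN ger0_norm//.
  have -> : 0 ^+ 2 - (x ^+ 2 + h * (2 * x)) = h ^+ 2 - (x + h) ^+ 2 by ring.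
  have -> : 0 ^+ 3 - (x ^+ 3 + h * (3 * x ^+ 2) + h ^+ 2 / 2 * (6 * x)) = - (- (x + h)) ^+ 3 - (- h) ^+ 3 + 2 * (- (x + h)) ^+ 3 by field.
  set z := - h; set w := - (x + h).
  have xz : x <= z by rewrite /z; lra.
  have zw : 0 <= w <= z by rewrite /w /z; lra.
  have : 0 <= w ^+ 2 <= z ^+ 2 by apply/andP; split; nra.
  have -> : (x + h) ^+ 2 = w ^+ 2 by rewrite /w sqrrN.
  have -> : h ^+ 2 = z ^+ 2 by rewrite /z sqrrN.
  move=> /andP[w2 wz2]; have : 0 <= w ^+ 3 <= z ^+ 3.
    by rewrite !(exprSr _ 2) ler_pM// ?mulr_ge0//; lra.
  move=> /andP[w3 wz3]; split; rewrite ?ler_norml; try (apply/andP; split);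
    move: (w ^+ 2) (z ^+ 2) (w ^+ 3) (z ^+ 3) w2 wz2 w3 wz3 => W2 Z2 W3 Z3; lra.
- have h0 : 0 <= h by lra.
  rewrite (ger0_norm h0) subr0 !(mulr0, expr0n, addr0, subr0)/= !ger0_norm ?exprn_ge0//.
  have xh : x + h <= h by lra.
  by split=> //; rewrite lerXn2r.
- by rewrite !(mulr0, expr0n, addr0, subr0, normr0)/=; split=> //; rewrite ?sqr_ge0 ?exprn_ge0.
Qed.

Lemma smooth3_spline : smooth3 spline0 spline1 spline2.
Proof.
have tri4 (a b c d A : R) : `|a| <= A -> `|b| <= A -> `|c| <= A -> `|d| <= A ->
    `|a - 3 * b + 3 * c - d| <= 8 * A.
  by rewrite !ler_norml => /andP[? ?] /andP[? ?] /andP[? ?] /andP[? ?]; apply/andP; split; lra.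
(* 8 = 1 + 3 + 3 + 1, the sum of the absolute values of the coefficients of the third difference. *)
exists 8; split.
- move=> x; have := spline0_itv x; have := spline1_itv x; have := spline2_itv x.
  by rewrite !ler_norml => /andP[? ?] /andP[? ?] /andP[? ?]; split; apply/andP; split; lra.
- move=> x h; rewrite /spline0 /spline1 /spline2.
  rewrite !(addrAC x h).
  have [_ _ t0] := pos_taylor x h; have [_ _ t1] := pos_taylor (x - 1) h.
  have [_ _ t2] := pos_taylor (x - 2) h; have [_ _ t3] := pos_taylor (x - 3) h.
  have := tri4 _ _ _ _ _ t0 t1 t2 t3.
  have h3 : 0 <= `|h| ^+ 3 by rewrite exprn_ge0.
  move: (pospart (x + h)) (pospart (x - 1 + h)) (pospart (x - 2 + h)) (pospart (x - 3 + h)).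
  move: (pospart x) (pospart (x - 1)) (pospart (x - 2)) (pospart (x - 3)).
  move: (`|h| ^+ 3) h3 => H h3 a b c d a' b' c' d'.
  by rewrite !ler_norml => /andP[? ?]; apply/andP; split; lra.
- move=> x h; rewrite /spline1 /spline2.
  rewrite !(addrAC x h).
  have [_ t0 _] := pos_taylor x h; have [_ t1 _] := pos_taylor (x - 1) h.
  have [_ t2 _] := pos_taylor (x - 2) h; have [_ t3 _] := pos_taylor (x - 3) h.
  have := tri4 _ _ _ _ _ t0 t1 t2 t3.
  have h3 : 0 <= h ^+ 2 by rewrite sqr_ge0.
  move: (pospart (x + h)) (pospart (x - 1 + h)) (pospart (x - 2 + h)) (pospart (x - 3 + h)).
  move: (pospart x) (pospart (x - 1)) (pospart (x - 2)) (pospart (x - 3)).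
  move: (h ^+ 2) h3 => H h3 a b c d a' b' c' d'.
  by rewrite !ler_norml => /andP[? ?]; apply/andP; split; lra.
- move=> x h; rewrite /spline2.
  rewrite !(addrAC x h).
  have [t0 _ _] := pos_taylor x h; have [t1 _ _] := pos_taylor (x - 1) h.
  have [t2 _ _] := pos_taylor (x - 2) h; have [t3 _ _] := pos_taylor (x - 3) h.
  have := tri4 _ _ _ _ _ t0 t1 t2 t3.
  congr (_ <= _); congr (`|_|); ring.
Qed.

End spline.

Section jets.
Context {R : realType} {K : finType}.
Local Notation V := {ffun K -> R}.
Implicit Types (a b u v : V) (C : R).

(* [j1 F a v] and [j2 F a v] stand for the first two derivatives of [jf F] at [v] along [a] *)
Record jet := Jet { jf : V -> R ; j1 : V -> V -> R ; j2 : V -> V -> R }.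

Definition nice (F : jet) := forall a, exists C,
  [/\ blip C (jf F), blip C (j1 F a), blip C (j2 F a) &
  forall v (x : R), `|jf F (v + x *: a) - (jf F v + x * j1 F a v + x ^+ 2 / 2 * j2 F a v)|
    <= C * `|x| ^+ 3].

Lemma blipM C D (f g : V -> R) : blip C f -> blip D g -> blip (2 * (C * D)) (fun v => f v * g v).
Proof.
move=> fC gD; have C0 := blip_ge0 fC; have D0 := blip_ge0 gD; split => [v|u v].
  rewrite normrM; apply: le_trans (_ : C * D <= _).
    by rewrite ler_pM//; [exact: fC.1|exact: gD.1].
  by have := mulr_ge0 C0 D0; lra.
have -> : f u * g u - f v * g v = f u * (g u - g v) + (f u - f v) * g v by ring.
rewrite (le_trans (ler_normD _ _))// !normrM.
have -> : 2 * (C * D) * norm1 (u - v) = C * (D * norm1 (u - v)) + (C * norm1 (u - v)) * D by ring.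
by rewrite lerD// ler_pM//; [exact: fC.1|exact: gD.2|exact: fC.2|exact: gD.1].
Qed.

Definition jcst (c : R) := Jet (fun=> c) (fun _ _ => 0) (fun _ _ => 0).
Definition jcompl (F : jet) :=
  Jet (fun v => 1 - jf F v) (fun a v => - j1 F a v) (fun a v => - j2 F a v).
Definition jmul (F G : jet) := Jet (fun v => jf F v * jf G v)
  (fun a v => jf F v * j1 G a v + j1 F a v * jf G v)
  (fun a v => jf F v * j2 G a v + 2 * (j1 F a v * j1 G a v) + j2 F a v * jf G v).
Definition jprod (s : seq jet) := foldr jmul (jcst 1) s.
Definition jcoord (p p1 p2 : R -> R) (k : K) :=
  Jet (fun v => p (v k)) (fun a v => a k * p1 (v k)) (fun a v => a k ^+ 2 * p2 (v k)).

Lemma nice_cst c : nice (jcst c).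
Proof.
move=> a; exists `|c|; have b0 : blip `|c| (fun=> 0 : R).
  by split => [v|u v]; rewrite ?subrr normr0// mulr_ge0// norm1_ge0.
split => //=; first exact: blip_cst.
by move=> v x; rewrite !mulr0 !addr0 subrr normr0 mulr_ge0// exprn_ge0.
Qed.

Lemma blipN C (f : V -> R) : blip C f -> blip C (fun v => - f v).
Proof. by move=> [f1 f2]; split => [v|u v]; rewrite -?opprD normrN. Qed.

Lemma nice_compl F : nice F -> nice (jcompl F).
Proof.
move=> nF a; have [C [F0 F1 F2 FT]] := nF a; have C0 := blip_ge0 F0.
exists (1 + C); split => /=.
- by have := blipD (blip_cst (1 : R)) (blipN F0); rewrite normr1.
- by apply: blip_le (blipN F1); lra.
- by apply: blip_le (blipN F2); lra.
- move=> v x; have := FT v x.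
  have -> : 1 - jf F (v + x *: a) - (1 - jf F v + x * - j1 F a v + x ^+ 2 / 2 * - j2 F a v) =
    - (jf F (v + x *: a) - (jf F v + x * j1 F a v + x ^+ 2 / 2 * j2 F a v)) by ring.
  by rewrite normrN => /le_trans; apply; rewrite ler_wpM2r ?exprn_ge0//; lra.
Qed.

(* For |x| <= 1 the Taylor remainders multiply; for |x| > 1 boundedness alone suffices *)
Let taylor_mul C (f g a0 a1 a2 b0 b1 b2 x : R) :
  `|f| <= C -> `|g| <= C -> `|a0| <= C -> `|a1| <= C -> `|a2| <= C ->
  `|b0| <= C -> `|b1| <= C -> `|b2| <= C ->
  `|f - (a0 + x * a1 + x ^+ 2 / 2 * a2)| <= C * `|x| ^+ 3 ->
  `|g - (b0 + x * b1 + x ^+ 2 / 2 * b2)| <= C * `|x| ^+ 3 ->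
  `|f * g - (a0 * b0 + x * (a0 * b1 + a1 * b0) +
     x ^+ 2 / 2 * (a0 * b2 + 2 * (a1 * b1) + a2 * b0))| <= 10 * C ^+ 2 * `|x| ^+ 3.
Proof.
move=> fC gC a0C a1C a2C b0C b1C b2C.
have C0 : 0 <= C by exact: le_trans fC.
have M (s t : R) : `|s| <= C -> `|t| <= C -> `|s * t| <= C ^+ 2.
  by move=> sC tC; rewrite normrM expr2 ler_pM.
set z := `|x|; have z0 : 0 <= z by exact: normr_ge0.
have x2 : x ^+ 2 = z ^+ 2 by rewrite real_normK ?num_real.
set r := (X in `|X| <= _ -> _); set r' := (X in _ -> `|X| <= _ -> _) => rC r'C.
have [z1|z1] := leP z 1.
  (* If f and g are polynomials P and Q plus remainders r and r', then f g - P Q = r g + f r' - r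
     r'; the last two terms are the parts of P Q of degree 3 and 4. *)
  have -> : f * g - (a0 * b0 + x * (a0 * b1 + a1 * b0) + x ^+ 2 / 2 * (a0 * b2 + 2 * (a1 * b1) + a2 * b0)) =
    r * g + f * r' - r * r' + x ^+ 3 / 2 * (a1 * b2 + a2 * b1) + x ^+ 4 / 4 * (a2 * b2).
    by rewrite /r /r'; field.
  have n3 : `|x ^+ 3| = z ^+ 3 by rewrite normrX.
  have n4 : `|x ^+ 4| = z ^+ 4 by rewrite normrX.
  have z3 : 0 <= z ^+ 3 by rewrite exprn_ge0.
  have z31 : z ^+ 3 <= 1 by rewrite exprn_ile1.
  have z4 : z ^+ 4 <= z ^+ 3 by rewrite (exprSr _ 3) ler_piMr.
  have e1 : `|r * g| <= C ^+ 2 * z ^+ 3.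
    by rewrite normrM expr2 mulrAC ler_pM.
  have e2 : `|f * r'| <= C ^+ 2 * z ^+ 3.
    by rewrite normrM expr2 -mulrA ler_pM.
  have e3 : `|r * r'| <= C ^+ 2 * z ^+ 3.
    rewrite normrM expr2 mulrAC ler_pM// (le_trans r'C)// ler_piMr//.
  have e4 : `|x ^+ 3 / 2 * (a1 * b2 + a2 * b1)| <= C ^+ 2 * z ^+ 3.
    rewrite normrM normrM n3 [`|2^-1|]ger0_norm//.
    have : `|a1 * b2 + a2 * b1| <= 2 * C ^+ 2.
      by rewrite (le_trans (ler_normD _ _))//; have := M _ _ a1C b2C; have := M _ _ a2C b1C; lra.
    move: (`|_ + _|) => w wC; rewrite [leRHS]mulrC -mulrA ler_wpM2l//; lra.
  have e5 : `|x ^+ 4 / 4 * (a2 * b2)| <= C ^+ 2 * z ^+ 3.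
    rewrite normrM normrM n4 [`|4^-1|]ger0_norm// [leRHS]mulrC.
    rewrite ler_pM// ?mulr_ge0 ?exprn_ge0//; last exact: M.
    by have := exprn_ge0 4 z0; lra.
  have tri (s1 s2 s3 s4 s5 w : R) : `|s1| <= w -> `|s2| <= w -> `|s3| <= w -> `|s4| <= w ->
      `|s5| <= w -> `|s1 + s2 - s3 + s4 + s5| <= 5 * w.
    rewrite !ler_norml => /andP[? ?] /andP[? ?] /andP[? ?] /andP[? ?] /andP[? ?].
    by apply/andP; split; lra.
  apply: le_trans (tri _ _ _ _ _ _ e1 e2 e3 e4 e5) _.
  have : 0 <= C ^+ 2 * z ^+ 3 by rewrite mulr_ge0// sqr_ge0.
  by rewrite -mulrA; move: (C ^+ 2 * z ^+ 3) => w; lra.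
have z3 : z <= z ^+ 3 by rewrite -[leLHS]expr1 ler_weXn2l// ltW.
have z2 : z ^+ 2 <= z ^+ 3 by rewrite ler_weXn2l// ltW.
have CC : 0 <= C ^+ 2 by rewrite sqr_ge0.
have e1 : `|f * g| <= C ^+ 2 * z ^+ 3 by rewrite (le_trans (M _ _ fC gC))// ler_peMr//; lra.
have e2 : `|a0 * b0| <= C ^+ 2 * z ^+ 3 by rewrite (le_trans (M _ _ a0C b0C))// ler_peMr//; lra.
have e3 : `|x * (a0 * b1 + a1 * b0)| <= 2 * (C ^+ 2 * z ^+ 3).
  have : `|a0 * b1 + a1 * b0| <= 2 * C ^+ 2.
    by rewrite (le_trans (ler_normD _ _))//; have := M _ _ a0C b1C; have := M _ _ a1C b0C; lra.
  rewrite normrM -/z mulrA (mulrC z) => wC; rewrite ler_pM//.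
have e4 : `|x ^+ 2 / 2 * (a0 * b2 + 2 * (a1 * b1) + a2 * b0)| <= 2 * (C ^+ 2 * z ^+ 3).
  have : `|a0 * b2 + 2 * (a1 * b1) + a2 * b0| <= 4 * C ^+ 2.
    have := M _ _ a0C b2C; have := M _ _ a1C b1C; have := M _ _ a2C b0C.
    rewrite !ler_norml => /andP[? ?] /andP[? ?] /andP[? ?]; apply/andP; split; lra.
  rewrite normrM ger0_norm ?divr_ge0 ?sqr_ge0// x2 => wC.
  have -> : 2 * (C ^+ 2 * z ^+ 3) = z ^+ 3 / 2 * (4 * C ^+ 2) by field.
  by rewrite ler_pM// ?divr_ge0 ?exprn_ge0//; lra.
have w0 : 0 <= C ^+ 2 * z ^+ 3 by rewrite mulr_ge0//; lra.
rewrite -[leRHS]mulrA; move: (C ^+ 2 * z ^+ 3) w0 (f * g) (a0 * b0) (x * _) (x ^+ 2 / 2 * _) e1 e2 e3 e4.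
move=> w w0 t1 t2 t3 t4; rewrite !ler_norml => /andP[? ?] /andP[? ?] /andP[? ?] /andP[? ?].
by apply/andP; split; lra.
Qed.

Lemma nice_mul F G : nice F -> nice G -> nice (jmul F G).
Proof.
move=> nF nG a; have [C [F0 F1 F2 FT]] := nF a; have [D [G0 G1 G2 GT]] := nG a.
have C0 := blip_ge0 F0; have D0 := blip_ge0 G0.
pose E := C + D; have CE : C <= E by rewrite /E; lra. have DE : D <= E by rewrite /E; lra.
have E0 : 0 <= E by lra.
have {F0}F0 := blip_le CE F0; have {F1}F1 := blip_le CE F1; have {F2}F2 := blip_le CE F2.
have {G0}G0 := blip_le DE G0; have {G1}G1 := blip_le DE G1; have {G2}G2 := blip_le DE G2.
have EE : 0 <= E * E by rewrite mulr_ge0.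
clearbody E.
exists (10 * (E * E)); split => /=.
- by apply: blip_le (blipM F0 G0); lra.
- by apply: blip_le (blipD (blipM F0 G1) (blipM F1 G0)); lra.
- apply: blip_le (blipD (blipD (blipM F0 G2) (blipZ 2 (blipM F1 G1))) (blipM F2 G0)).
  by rewrite ger0_norm//; lra.
- move=> v x; rewrite -expr2; apply: taylor_mul; try (by [exact: F0.1|exact: F1.1|exact: F2.1|exact: G0.1|exact: G1.1|exact: G2.1]).
  + by apply: (le_trans (FT v x)); rewrite ler_wpM2r// exprn_ge0.
  + by apply: (le_trans (GT v x)); rewrite ler_wpM2r// exprn_ge0.
Qed.

Lemma nice_prod (I : Type) (s : seq I) (F : I -> jet) : (forall i, nice (F i)) ->
  nice (jprod [seq F i | i <- s]).
Proof. by move=> nF; elim: s => /= [|i s IH]; [exact: nice_cst|exact: nice_mul]. Qed.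

Lemma jprodE (I : Type) (s : seq I) (F : I -> jet) v :
  jf (jprod [seq F i | i <- s]) v = \prod_(i <- s) jf (F i) v.
Proof. by elim: s => /= [|i s IH]; rewrite ?big_nil ?big_cons// IH. Qed.

Lemma norm1_coord (u : V) k : `|u k| <= norm1 u.
Proof. by rewrite /norm1 (bigD1 k)//= lerDl sumr_ge0. Qed.

Lemma nice_coord p p1 p2 k : smooth3 p p1 p2 -> nice (jcoord p p1 p2 k).
Proof.
move=> [C [B T0 T1 T2]] a.
have C0 : 0 <= C by have [h _ _] := B 0; exact: le_trans h.
have lip2 : forall x y, `|p2 x - p2 y| <= C * `|x - y|.
  by move=> x y; have := T2 y (x - y); rewrite (addrC y) subrK.
(* The Lipschitz bounds for [p1] and [p] come from the Taylor bounds when |x - y| <= 1 and from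
   boundedness otherwise. *)
have lip1 : forall x y, `|p1 x - p1 y| <= 2 * C * `|x - y|.
  move=> x y; have := T1 y (x - y); rewrite (addrC y) subrK.
  have [_ x1 _] := B x; have [_ y1 y2] := B y.
  rewrite -(real_normK (num_real (x - y))).
  have : `|(x - y) * p2 y| <= `|x - y| * C by rewrite normrM ler_wpM2l.
  move: (`|x - y|) (normr_ge0 (x - y)) => z z0.
  have [z1|z1] := leP z 1.
    have zz : C * z ^+ 2 <= C * z by rewrite ler_wpM2l// expr2 ler_piMr.
    by rewrite !ler_norml => /andP[? ?] /andP[? ?]; apply/andP; split; lra.
  move=> _ _; have : C <= C * z by rewrite ler_peMr// ltW.
  move: x1 y1; rewrite !ler_norml => /andP[? ?] /andP[? ?] ?; apply/andP; split; lra.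
have lip0 : forall x y, `|p x - p y| <= 3 * C * `|x - y|.
  move=> x y; have := T0 y (x - y); rewrite (addrC y) subrK.
  have [x1 _ _] := B x; have [y1 y2 y3] := B y.
  have : `|(x - y) ^+ 2 / 2 * p2 y| <= `|x - y| ^+ 2 / 2 * C.
    by rewrite normrM ger0_norm ?divr_ge0 ?sqr_ge0// real_normK ?num_real// ler_wpM2l// divr_ge0// sqr_ge0.
  have : `|(x - y) * p1 y| <= `|x - y| * C by rewrite normrM ler_wpM2l.
  move: (`|x - y|) (normr_ge0 (x - y)) => z z0.
  have [z1|z1] := leP z 1.
    have zz : C * z ^+ 2 <= C * z by rewrite ler_wpM2l// expr2 ler_piMr.
    have zzz : C * z ^+ 3 <= C * z.
      by rewrite ler_wpM2l// exprS ler_piMr// exprn_ile1.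
    by rewrite !ler_norml => /andP[? ?] /andP[? ?] /andP[? ?]; apply/andP; split; lra.
  move=> _ _; have : C <= C * z by rewrite ler_peMr// ltW.
  move: x1 y1; rewrite !ler_norml => /andP[? ?] /andP[? ?] ? _; apply/andP; split; lra.
(* Since A >= 1, the single factor A^3 majorizes all powers of |a k| that arise from the chain
   rule. *)
pose A := 1 + `|a k|; have A1 : 1 <= A by rewrite lerDl.
have A0 : 0 <= A by lra. have aA : `|a k| <= A by rewrite lerDr.
have A3 : 1 <= A ^+ 3 by rewrite exprn_ege1.
have A13 : A <= A ^+ 3 by rewrite -[leLHS]expr1 ler_weXn2l.
have A23 : A ^+ 2 <= A ^+ 3 by rewrite ler_weXn2l.
have CA : 3 * C <= 3 * C * A ^+ 3 by rewrite ler_peMr ?mulr_ge0.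
have cmp (c c' : R) (h : R -> R) : 0 <= c' -> `|c| <= A ^+ 3 -> c' <= 3 * C -> (forall x, `|h x| <= C) ->
    (forall x y, `|h x - h y| <= c' * `|x - y|) -> blip (3 * C * A ^+ 3) (fun v : V => c * h (v k)).
  move=> c'0 cA cC hC hL; split => [v|u v].
    rewrite normrM mulrC ler_pM// (le_trans (hC _))//; lra.
  rewrite -mulrBr normrM; apply: (@le_trans _ _ (A ^+ 3 * (c' * norm1 (u - v)))).
    rewrite ler_pM// (le_trans (hL _ _))// ler_wpM2l//.
    by have := norm1_coord (u - v) k; rewrite !ffunE.
  by rewrite [3 * C * _]mulrC -[leRHS]mulrA ler_wpM2l ?exprn_ge0// ler_wpM2r ?norm1_ge0.
exists (3 * C * A ^+ 3); split => /=.
- have := @cmp 1 (3 * C) p; rewrite normr1 => H.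
  have -> : (fun v : V => p (v k)) = (fun v : V => 1 * p (v k)) by apply/funext => v; rewrite mul1r.
  by apply: H => //; [lra|move=> x; have [] := B x].
- by apply: (@cmp (a k) (2 * C) p1); [lra|exact: le_trans aA A13|lra|move=> x; have [] := B x|].
- apply: (@cmp (a k ^+ 2) C p2) => //; [|lra|by move=> x; have [] := B x].
  by rewrite normrX; apply: le_trans A23; rewrite lerXn2r// nnegrE.
- move=> v x; have := T0 (v k) (x * a k); rewrite !ffunE.
  have -> : p (v k) + x * (a k * p1 (v k)) + x ^+ 2 / 2 * (a k ^+ 2 * p2 (v k)) =
    p (v k) + x * a k * p1 (v k) + (x * a k) ^+ 2 / 2 * p2 (v k) by ring.
  move=> /le_trans; apply; rewrite normrM exprMn mulrCA mulrC ler_wpM2r ?exprn_ge0//.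
  apply: (@le_trans _ _ (C * A ^+ 3)); first by rewrite ler_wpM2l// lerXn2r// nnegrE.
  by rewrite ler_wpM2r ?exprn_ge0//; lra.
Qed.

End jets.

(** * Gordon's comparison inequality *)

Section comparison.
Context {R : realType} {K : finType}.
Local Notation V := {ffun K -> R}.
Implicit Types (a b u v : V) (C : R) (F G : @jet R K).

Let m1 : R := gE (fun x : R => `|x|).
Let m2 : R := gE (fun x : R => x ^+ 2).
Let m3 : R := gE (fun x : R => `|x| ^+ 3).
Let m1_ge0 : 0 <= m1. Proof. exact: gE_ge0. Qed.
Let m2_ge0 : 0 <= m2. Proof. by apply: gE_ge0 => x; exact: sqr_ge0. Qed.
Let m3_ge0 : 0 <= m3. Proof. by apply: gE_ge0 => x; exact: exprn_ge0. Qed.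

Lemma gs_lip C f a (d : R) v : 0 <= d -> blip C f ->
  `|gs (Num.sqrt d *: a) f v - f v| <= C * norm1 a * m1 * Num.sqrt d.
Proof.
move=> d0 fC; set s := Num.sqrt d; have s0 : 0 <= s by exact: sqrtr_ge0.
rewrite -[X in _ - X](gE_cst (f v)) /gs -gEB; [|exact: (blip_gint v _ fC)|exact: gint_cst].
have ig := gintB (blip_gint v (s *: a) fC) (gint_cst (f v)).
apply: (le_trans (gE_abs ig)).
have i1 : gint (fun x : R => `|x|) by apply: gint_abs; exact: gint_id.
have -> : C * norm1 a * m1 * s = gE (fun x => (C * norm1 a * s) * `|x|).
  by rewrite gEZ// -/m1; ring.
apply: gE_le => [||x]; [exact: gint_abs|exact: gintZ|].
have := fC.2 (v + x *: (s *: a)) v.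
rewrite addrAC subrr add0r !norm1Z (ger0_norm s0) => /le_trans; apply.
by rewrite le_eqVlt; apply/orP; left; apply/eqP; ring.
Qed.

(** The linear term integrates to zero, which leaves the second derivative and an error of order
    d^(3/2). The second moment [m2] is kept symbolic: it multiplies the Laplacians of both families
    alike. *)
Lemma gs_taylor F a : nice F -> exists2 C, 0 <= C & forall (d : R) v, 0 <= d ->
  `|gs (Num.sqrt d *: a) (jf F) v - (jf F v + d * m2 / 2 * j2 F a v)| <= C * (d * Num.sqrt d).
Proof.
move=> nF; have [C [F0 F1 F2 FT]] := nF a; have C0 := blip_ge0 F0.
exists (C * m3); first by rewrite mulr_ge0.
move=> d v d0; set s := Num.sqrt d; have s0 : 0 <= s by exact: sqrtr_ge0.
have s2 : s ^+ 2 = d by rewrite sqr_sqrtr.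
pose q (x : R) : R := jf F v + (s * j1 F a v * x + (d / 2 * j2 F a v) * x ^+ 2).
have iq1 : gint (fun x : R => s * j1 F a v * x) by exact: (gintZ (s * j1 F a v) gint_id).
have iq2 : gint (fun x : R => d / 2 * j2 F a v * x ^+ 2) by exact: (gintZ (d / 2 * j2 F a v) gint_sqr).
have iq12 := gintD iq1 iq2.
have iq : gint q by apply: gintD => //; exact: gint_cst.
have Eq : gE q = jf F v + d * m2 / 2 * j2 F a v.
  rewrite /q gED//; last exact: gint_cst.
  rewrite gE_cst gED// (gEZ _ gint_id).
  rewrite gE_id mulr0 add0r (gEZ _ gint_sqr).
  by rewrite -/m2; congr (_ + _); ring.
rewrite -Eq /gs -gEB//; last exact: (blip_gint v _ F0).
have ig := gintB (blip_gint v (s *: a) F0) iq.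
apply: (le_trans (gE_abs ig)).
have -> : C * m3 * (d * s) = gE (fun x => C * (d * s) * `|x| ^+ 3).
  by rewrite (gEZ _ gint_cube) -/m3; ring.
apply: gE_le => [||x]; [exact: gint_abs|exact: (gintZ _ gint_cube)|].
have := FT v (x * s); rewrite -scalerA => h.
have -> : q x = jf F v + x * s * j1 F a v + (x * s) ^+ 2 / 2 * j2 F a v.
  by rewrite /q exprMn s2; ring.
apply: (le_trans h); rewrite normrM (ger0_norm s0) exprMn (exprSr s) s2.
by rewrite le_eqVlt; apply/orP; left; apply/eqP; ring.
Qed.

Definition lap (l : seq V) F v := \sum_(a <- l) j2 F a v.

Lemma lap_blip F l : nice F -> exists C, blip C (lap l F).
Proof.
move=> nF; elim: l => [|a l [C IH]].
  exists `|0 : R|; rewrite /lap; under eq_fun do rewrite big_nil; exact: blip_cst.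
have [D [_ _ D2 _]] := nF a.
exists (D + C); rewrite /lap; under eq_fun do rewrite big_cons.
exact: blipD.
Qed.

(** Induction on the directions: smoothing the Laplacian already collected changes it by O(sqrt d),
    and it carries a factor d, so the extra error is again of order d^(3/2). *)
Lemma heat_taylor F l : nice F -> exists2 C, 0 <= C & forall (d : R) v, 0 <= d ->
  `|heat d l (jf F) v - (jf F v + d * m2 / 2 * lap l F v)| <= C * (d * Num.sqrt d).
Proof.
move=> nF; elim: l => [|a l [C C0 IH]].
  exists 0 => // d v d0; rewrite /heat /lap big_nil mulr0 addr0 subrr normr0.
  by rewrite mul0r.
have [B [F0 _ F2 _]] := nF a.
have [D D0 HD] := gs_taylor a nF.
have [E HE] := lap_blip l nF; have E0 := blip_ge0 HE.
exists (C + D + m2 / 2 * (E * norm1 a * m1)).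
  by rewrite !addr_ge0// !mulr_ge0// norm1_ge0.
move=> d v d0; set s := Num.sqrt d; have s0 : 0 <= s by exact: sqrtr_ge0.
set c := d * m2 / 2; have c0 : 0 <= c by rewrite /c divr_ge0// mulr_ge0.
have hb : blip B (heat d l (jf F)) by exact: gsl_blip.
have lb : blip (B + `|c| * E) (fun v => jf F v + c * lap l F v).
  by apply: blipD => //; exact: blipZ.
have h1 := gs_dist (s *: a) hb lb (fun v => IH d v d0) v.
rewrite -/s in h1.
have h2 := gsD (s *: a) v F0 (blipZ c HE).
have h3 := gsZ c (s *: a) v HE.
rewrite h3 in h2.
have h4 := HD d v d0; rewrite -/s -/c in h4.
have h5 := gs_lip a v d0 HE; rewrite -/s in h5.
have -> : heat d (a :: l) (jf F) v = gs (s *: a) (heat d l (jf F)) v by [].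
rewrite /lap big_cons -/(lap l F v).
rewrite h2 in h1.
have h6 : `|c * gs (s *: a) (lap l F) v - c * lap l F v| <= m2 / 2 * (E * norm1 a * m1) * (d * s).
  rewrite -mulrBr normrM (ger0_norm c0); apply: (le_trans (ler_wpM2l c0 h5)).
  by rewrite le_eqVlt; apply/orP; left; apply/eqP; rewrite /c; field.
move: h1 h4 h6.
move: (gs (s *: a) (heat d l (jf F)) v) (gs (s *: a) (jf F) v) (c * gs (s *: a) (lap l F) v).
rewrite mulrDr.
move: (c * lap l F v) (c * j2 F a v) (jf F v).
clear; move: (m2 / 2 * (E * norm1 a * m1)) (d * s) => M ds x1 x2 x3 x4 x5 x6.
rewrite !mulrDl; move: (C * ds) (D * ds) (M * ds) => Cs Ds Ms.
by rewrite !ler_norml => /andP[? ?] /andP[? ?] /andP[? ?]; apply/andP; split; lra.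
Qed.


Section interpolation.
Variables (lX lY : seq V) (F : @jet R K).
Hypotheses (nF : nice F) (lapXY : forall v, lap lY F v <= lap lX F v).

Let bF : exists C, blip C (jf F).
Proof. by have [C [F0 _ _ _]] := nF 0; exists C. Qed.

Lemma gsl_addr C (f : V -> R) l (c : R) v : blip C f -> gsl l (fun v => f v + c) v = gsl l f v + c.
Proof.
move=> fC; elim: l v => [|a l IH] v; first by [].
rewrite /= (gs_ext a IH) (gsD a v (gsl_blip l fC) (blip_cst c)); congr (_ + _).
exact: gs_cst.
Qed.

Let interp (t : R) v := heat t lX (heat (1 - t) lY (jf F)) v.

(** The slice of length d that passes from Y to X is commuted to the innermost place, where [lapXY]
    compares the two Taylor expansions of [jf F]; the outer smoothings preserve the order. *)
Let step : exists2 C, 0 <= C & forall t d v, 0 <= t -> 0 <= d -> t + d <= 1 ->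
  interp t v - C * (d * Num.sqrt d) <= interp (t + d) v.
Proof.
have [B fB] := bF.
have [C C0 HC] := heat_taylor lX nF; have [D D0 HD] := heat_taylor lY nF.
exists (C + D); first exact: addr_ge0.
move=> t d v t0 d0 td.
have r0 : 0 <= 1 - (t + d) by lra.
have hXb l : blip B (heat d l (jf F)) by exact: gsl_blip.
pose c := (C + D) * (d * Num.sqrt d).
have E1 : interp (t + d) v = heat t lX (heat (1 - (t + d)) lY (heat d lX (jf F))) v.
  rewrite /interp -(heat_semigroup lX t0 d0 (gsl_blip _ fB)).
  by apply: gsl_ext => u; exact: (gslC _ _ fB).
have E2 : interp t v = heat t lX (heat (1 - (t + d)) lY (heat d lY (jf F))) v.
  rewrite /interp; apply: gsl_ext => u.
  by rewrite (heat_semigroup lY r0 d0 fB); congr (heat _ _ _ _); ring.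
have pw u : heat d lY (jf F) u <= heat d lX (jf F) u + c.
  have := HC d u d0; have := HD d u d0; rewrite /c mulrDl.
  have : d * m2 / 2 * lap lY F u <= d * m2 / 2 * lap lX F u.
    by rewrite ler_wpM2l// divr_ge0// mulr_ge0.
  move: (d * m2 / 2 * _) (d * m2 / 2 * _) (C * _) (D * _) (heat d lX _ u) (heat d lY _ u).
  move=> x1 x2 x3 x4 x5 x6 ?; rewrite !ler_norml => /andP[? ?] /andP[? ?]; lra.
have pw2 u : heat (1 - (t + d)) lY (heat d lY (jf F)) u <= heat (1 - (t + d)) lY (heat d lX (jf F)) u + c.
  rewrite -(gsl_addr _ _ _ (hXb lX)).
  exact: (gsl_le _ (hXb lY) (blipD (hXb lX) (blip_cst c)) pw).
have hb l (u : R) : blip B (heat u l (heat d lX (jf F))) by exact: gsl_blip.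
have hb' l (u : R) : blip B (heat u l (heat d lY (jf F))) by exact: gsl_blip.
rewrite E1 E2 lerBlDr -/c -(gsl_addr _ _ _ (hb lY (1 - (t + d)))).
exact: (gsl_le _ (hb' lY (1 - (t + d))) (blipD (hb lY (1 - (t + d))) (blip_cst c)) pw2).
Qed.

Lemma heat_compare v : gsl lY (jf F) v <= gsl lX (jf F) v.
Proof.
have [C C0 HC] := step.
have one l (f : V -> R) : heat 1 l f = gsl l f.
  rewrite /heat sqrtr1; congr gsl; rewrite -[RHS]map_id; apply: eq_map => a.
  exact: scale1r.
have -> : gsl lX (jf F) v = interp 1 v.
  by rewrite /interp subrr -(one lX); apply: gsl_ext => u; rewrite heat0.
have -> : gsl lY (jf F) v = interp 0 v by rewrite /interp subr0 heat0 one.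
apply/ler_addgt0Pr => e e0.
(* N slices of length 1/N lose C N (1/N)^(3/2) = C / sqrt N in all, which is at most e once N >
   (C/e)^2. *)
pose N := (Num.truncn ((C / e) ^+ 2)).+1.
have N0 : 0 < N%:R :> R by rewrite ltr0n.
pose d : R := N%:R^-1; have d0 : 0 < d by rewrite invr_gt0.
have ind (k : nat) : (k <= N)%N -> interp 0 v - k%:R * (C * (d * Num.sqrt d)) <= interp (k%:R * d) v.
  elim: k => [_|k IH kN]; first by rewrite !mul0r subr0.
  have kd : k%:R * d + d <= 1.
    by rewrite -{2}[d]mul1r -mulrDl natr1 /d ler_pdivrMr// mul1r ler_nat.
  have := HC (k%:R * d) d v (mulr_ge0 (ler0n _ k) (ltW d0)) (ltW d0) kd.
  have -> : k.+1%:R * d = k%:R * d + d by rewrite -natr1 mulrDl mul1r.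
  have := IH (ltnW kN); rewrite -natr1 mulrDl mul1r; lra.
have := ind N (leqnn N); rewrite /d mulfV ?gt_eqF// -/d mulrCA.
have -> : N%:R * (d * Num.sqrt d) = Num.sqrt d by rewrite mulrA /d mulfV ?gt_eqF// mul1r.
have : C * Num.sqrt d <= e.
  rewrite -(@ler_pXn2r _ 2) ?nnegrE ?mulr_ge0 ?sqrtr_ge0// ?(ltW e0)//.
  rewrite exprMn sqr_sqrtr ?(ltW d0)// /d ler_pdivrMr//.
  have := truncnS_gt ((C / e) ^+ 2); rewrite -/N expr_div_n ltr_pdivrMr ?exprn_gt0// mulrC.
  exact: ltW.
by lra.
Qed.

End interpolation.

End comparison.

(** * Product calculus for the difference of the generators *)

Section gordon.
Context {R : realType} {K : finType}.
Local Notation V := {ffun K -> R}.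
Variables (lX lY : seq V).
Implicit Types (F G H : @jet R K) (v : V).

(* [gen] is the difference of the generators of the two heat semigroups, [carre] its
   carre du champ: a derivation in each argument. *)
Definition gen F v : R := lap lX F v - lap lY F v.
Definition carre F G v : R :=
  \sum_(a <- lX) j1 F a v * j1 G a v - \sum_(a <- lY) j1 F a v * j1 G a v.

Lemma carreC F G v : carre F G v = carre G F v.
Proof. by congr (_ - _); apply: eq_bigr => a _; rewrite mulrC. Qed.

Lemma gen_mul F G v :
  gen (jmul F G) v = jf F v * gen G v + 2 * carre F G v + gen F v * jf G v.
Proof.
have E l : lap l (jmul F G) v = jf F v * lap l G v
    + 2 * (\sum_(a <- l) j1 F a v * j1 G a v) + lap l F v * jf G v.
  by rewrite /lap !(mulr_sumr, mulr_suml) -!big_split.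
rewrite /gen /carre !E; ring.
Qed.

Lemma carre_mul F G H v :
  carre (jmul F G) H v = jf F v * carre G H v + carre F H v * jf G v.
Proof.
have E l : \sum_(a <- l) j1 (jmul F G) a v * j1 H a v =
    jf F v * (\sum_(a <- l) j1 G a v * j1 H a v)
    + (\sum_(a <- l) j1 F a v * j1 H a v) * jf G v.
  rewrite !(mulr_sumr, mulr_suml) -big_split; apply: eq_bigr => a _ /=; ring.
rewrite /carre !E; ring.
Qed.

Lemma gen_compl F v : gen (jcompl F) v = - gen F v.
Proof. by rewrite /gen /lap /= !sumrN opprB opprK addrC. Qed.

Lemma gen_cst (c : R) v : gen (jcst c) v = 0.
Proof. by rewrite /gen /lap /= !big1 ?subrr. Qed.

Lemma carre_cst (c : R) G v : carre (jcst c) G v = 0.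
Proof. by rewrite /carre /= !big1 ?subrr// => a _; rewrite mul0r. Qed.

Lemma carre_compl F G v : carre (jcompl F) G v = - carre F G v.
Proof.
have E l : \sum_(a <- l) j1 (jcompl F) a v * j1 G a v = - \sum_(a <- l) j1 F a v * j1 G a v.
  by rewrite -sumrN; apply: eq_bigr => a _; rewrite mulNr.
rewrite /carre !E; ring.
Qed.

Section prod.
Context {I : eqType}.
Implicit Types (s : seq I) (Fs : I -> @jet R K).

Lemma jprod_ge0 s Fs v : (forall i, 0 <= jf (Fs i) v) -> 0 <= jf (jprod [seq Fs i | i <- s]) v.
Proof. by move=> F0; rewrite jprodE prodr_ge0. Qed.

Lemma carre_prod_ge0 s Fs G v : (forall i, 0 <= jf (Fs i) v) ->
  (forall i, 0 <= carre (Fs i) G v) -> 0 <= carre (jprod [seq Fs i | i <- s]) G v.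
Proof.
move=> F0 FG; elim: s => [|i s IH]; first by rewrite carre_cst.
by rewrite [jprod _]/= carre_mul addr_ge0// mulr_ge0// jprod_ge0.
Qed.

Lemma carre_prod_eq0 s Fs G v :
  (forall i, carre (Fs i) G v = 0) -> carre (jprod [seq Fs i | i <- s]) G v = 0.
Proof.
move=> FG; elim: s => [|i s IH]; first by rewrite carre_cst.
by rewrite [jprod _]/= carre_mul IH FG mulr0 mul0r addr0.
Qed.

(** By the product rule the generator of a product collects generators of the factors and pairwise
    [carre] terms, each multiplied by the remaining nonnegative factors. *)
Lemma gen_prod_ge0 s Fs v : (forall i, 0 <= jf (Fs i) v) ->
  (forall i, 0 <= gen (Fs i) v) -> (forall i j, 0 <= carre (Fs i) (Fs j) v) ->
  0 <= gen (jprod [seq Fs i | i <- s]) v.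
Proof.
move=> F0 LF FG; elim: s => [|i s IH]; first by rewrite gen_cst.
rewrite [jprod _]/= gen_mul; apply: addr_ge0; last by rewrite mulr_ge0// jprod_ge0.
apply: addr_ge0; first by rewrite mulr_ge0.
by rewrite mulr_ge0// carreC carre_prod_ge0.
Qed.

Lemma gen_prod_eq0 s Fs v :
  (forall i, gen (Fs i) v = 0) -> (forall i j, carre (Fs i) (Fs j) v = 0) ->
  gen (jprod [seq Fs i | i <- s]) v = 0.
Proof.
move=> LF FG; elim: s => [|i s IH]; first by rewrite gen_cst.
by rewrite [jprod _]/= gen_mul IH LF carreC carre_prod_eq0// !mulr0 mul0r !addr0.
Qed.

End prod.

(** Covariance of coordinates k and l in the X family minus that in the Y family, each family being
    a sum of its directions with independent standard normal coefficients. *)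
Definition covdiff (k l : K) : R := \sum_(a <- lX) a k * a l - \sum_(a <- lY) a k * a l.

Lemma carre_coord p p1 p2 k l v :
  carre (jcoord p p1 p2 k) (jcoord p p1 p2 l) v = p1 (v k) * p1 (v l) * covdiff k l.
Proof.
rewrite /carre /covdiff mulrBr !mulr_sumr /=.
by congr (_ - _); apply: eq_bigr => a _; ring.
Qed.

Lemma gen_coord p p1 p2 k v : gen (jcoord p p1 p2 k) v = p2 (v k) * covdiff k k.
Proof.
rewrite /gen /lap /covdiff mulrBr !mulr_sumr /=.
by congr (_ - _); apply: eq_bigr => a _; ring.
Qed.

End gordon.

(** * Gordon's comparison for the smoothed min-max *)

Section gordon_minmax.
Context {R : realType} {I J : finType}.
Local Notation V := {ffun I * J -> R}.
Variables (lX lY : seq V) (p p1 p2 : R -> R).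
Hypotheses (sm : smooth3 p p1 p2) (p01 : forall x, 0 <= p x <= 1) (p1_ge0 : forall x, 0 <= p1 x).
Hypothesis cov_same : forall i j j', covdiff lX lY (i, j) (i, j') = 0.
Hypothesis cov_diff : forall i i' j j', 0 <= covdiff lX lY (i, j) (i', j').

(* A smooth version of the indicator of [min_i max_j v(i,j) > 0] *)
Definition minmax (v : V) : R := \prod_i (1 - \prod_j (1 - p (v (i, j)))).

Let c ij := jcompl (jcoord p p1 p2 ij) : @jet R (I * J)%type.
Let rowjet i := jprod [seq c (i, j) | j <- index_enum J].
Let minmax_jet := jprod [seq jcompl (rowjet i) | i <- index_enum I].

Let nice_minmax : nice minmax_jet.
Proof.
apply: nice_prod => i; apply: nice_compl; apply: nice_prod => j.
exact/nice_compl/nice_coord.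
Qed.

Let rowjetE i u : jf (rowjet i) u = \prod_j (1 - p (u (i, j))).
Proof. by rewrite /rowjet jprodE. Qed.

Let minmax_jetE : jf minmax_jet = minmax.
Proof. by apply/funext => u; rewrite jprodE; apply: eq_bigr => i _; rewrite /= rowjetE. Qed.

Lemma minmax_blip : exists C, blip C minmax.
Proof. by have [C [F0 _ _ _]] := nice_minmax 0; exists C; rewrite -minmax_jetE. Qed.

(** Inside a row the covariances agree, so the row product has generator 0. Between rows [carre] is
    nonnegative because [p1] and the covariance differences are, and the signs introduced by the
    complements cancel in pairs. Hence the generator of the whole product is nonnegative. *)
Lemma minmax_compare v : gsl lY minmax v <= gsl lX minmax v.
Proof.
have c0 ij u : 0 <= jf (c ij) u <= 1 by rewrite /=; have := p01 (u ij); lra.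
have P01 i u : 0 <= jf (rowjet i) u <= 1.
  rewrite rowjetE; apply/andP; split.
    by apply: prodr_ge0 => j _; have /andP[] := c0 (i, j) u.
  by apply: prodr_ile1 => j _; exact: c0 (i, j) u.
have cc k l u : carre lX lY (c k) (c l) u = p1 (u k) * p1 (u l) * covdiff lX lY k l.
  by rewrite /c carre_compl carreC carre_compl opprK carre_coord [p1 _ * p1 _]mulrC {1}/covdiff; congr (_ * (_ - _)); apply: eq_bigr => a _; rewrite mulrC.
have Pc i k u : 0 <= carre lX lY (rowjet i) (c k) u.
  apply: carre_prod_ge0 => j; first by have /andP[] := c0 (i, j) u.
  by rewrite cc; case: k => i' j'; rewrite !mulr_ge0.
have PP i i' u : 0 <= carre lX lY (rowjet i) (rowjet i') u.
  by rewrite carreC; apply: carre_prod_ge0 => j; [have /andP[] := c0 (i', j) u|rewrite carreC].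
have LP i u : gen lX lY (rowjet i) u = 0.
  apply: gen_prod_eq0 => [j|j j']; last by rewrite cc cov_same mulr0.
  by rewrite /c gen_compl gen_coord cov_same mulr0 oppr0.
rewrite -minmax_jetE; apply: heat_compare => // u; rewrite -subr_ge0 -/(gen lX lY minmax_jet u).
apply: gen_prod_ge0 => [i|i|i i'].
- by rewrite /= subr_ge0; have /andP[] := P01 i u.
- by rewrite gen_compl LP oppr0.
- by rewrite carre_compl carreC carre_compl opprK.
Qed.

End gordon_minmax.

(** * Gaussian vectors *)

Section integrated_lower_bound.
Context {R : realType} {K : finType} {U : eqType}.
Local Notation V := {ffun K -> R}.
Variables (a : U -> V) (psi chi : U -> R -> R).
Hypotheses (ipsi : forall u, gint (psi u)) (ichi : forall u, gint (chi u)).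

(** A pointwise bound by products of one-variable functions is integrated one coordinate at a time.
    The two products will be the Chernoff factors of the two failure events on the side of Y. *)
Lemma gsl_ge C f (s : seq U) : blip C f -> uniq s -> forall (c0 c1 c2 : R) v,
  (forall x : U -> R, c0 - c1 * (\prod_(u <- s) psi u (x u)) - c2 * (\prod_(u <- s) chi u (x u))
    <= f (v + \sum_(u <- s) x u *: a u)) ->
  c0 - c1 * (\prod_(u <- s) gE (psi u)) - c2 * (\prod_(u <- s) gE (chi u))
    <= gsl [seq a u | u <- s] f v.
Proof.
move=> fC; elim: s => [_|u s IH /= /andP[us s_uniq]] c0 c1 c2 v H.
  by have := H (fun=> 0); rewrite !big_nil addr0.
set A := \prod_(u <- s) gE (psi u); set B := \prod_(u <- s) gE (chi u).
have step x : c0 - c1 * psi u x * A - c2 * chi u x * B <= gsl [seq a u | u <- s] f (v + x *: a u).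
  apply: IH => // y.
  (* The point y with its coordinate u overwritten by x; as u is not in s, the other factors do not
     see the change. *)
  pose z w := if w == u then x else y w.
  have zs w : w \in s -> z w = y w by rewrite /z; case: eqP => // -> us'; rewrite us' in us.
  have := H z; rewrite !big_cons {1 3 5}/z eqxx addrA !mulrA.
  rewrite (eq_big_seq (fun w => psi w (y w))); last by move=> w /zs ->.
  rewrite [X in _ - _ * X](eq_big_seq (fun w => chi w (y w))); last by move=> w /zs ->.
  by rewrite [X in _ <= f (_ + X)](eq_big_seq (fun w => y w *: a w)); last by move=> w /zs ->.
rewrite !big_cons -/A -/B /gs.
have i1 := gintZ (c1 * A) (ipsi u); have i2 := gintZ (c2 * B) (ichi u).
have i0 := gintB (gint_cst c0) i1.
have -> : c0 - c1 * (gE (psi u) * A) - c2 * (gE (chi u) * B) =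
    gE (fun x => c0 - c1 * A * psi u x - c2 * B * chi u x).
  by rewrite (gEB i0 i2) (gEB (gint_cst c0) i1) gE_cst !gEZ//; ring.
apply: gE_le => [||x]; [exact: gintB|exact: (blip_gint _ _ (gsl_blip _ fC))|].
by have := step x; rewrite -!mulrA (mulrC (psi u x)) (mulrC (chi u x)).
Qed.

End integrated_lower_bound.

Section gaussian_vector.
Context d (T : measurableType d) {R : realType} (P : probability T R).
Context {K U : finType}.
Local Notation V := {ffun K -> R}.
Variables (X : U -> T -> R) (a : U -> V).
Hypotheses (mX : forall u, measurable_fun setT (X u))
  (lawX : forall u (B : set R), measurable B -> P (X u @^-1` B) = gam R B)
  (indX : mutually_independent P X).

Lemma ge0_integral_lawX u (h : R -> \bar R) : measurable_fun [set: R] h ->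
  (forall x, 0 <= h x)%E -> (\int[P]_t h (X u t) = \int[gam R]_x h x)%E.
Proof.
move=> mh h0.
pose Y : {RV P >-> measurableTypeR R} :=
  HB.pack (X u : T -> measurableTypeR R) (isMeasurableFun.Build _ _ T (measurableTypeR R) (X u) (mX u)).
rewrite -[LHS](ge0_integral_distribution Y mh h0).
by apply: eq_measure_integral => B mB _; exact: lawX.
Qed.

Lemma Ex_sqr_lawX u : Ei P (fun t => X u t ^+ 2) /\ Ex P (fun t => X u t ^+ 2) = gE (fun x => x ^+ 2).
Proof.
have m2 : measurable_fun [set: R] (fun x : R => (x ^+ 2)%:E).
  by apply/measurable_EFinP; exact: measurable_funX.
have := ge0_integral_lawX u m2 (fun x => sqr_ge0 x : (0 <= (x ^+ 2)%:E)%E).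
have i2 := gint_sqr (R := R).
move=> E; split; last by rewrite /Ex /gE /Rintegral E.
apply/integrableP; split.
  by apply/measurable_EFinP; apply: measurable_funX.
under eq_integral do rewrite /= ger0_norm ?sqr_ge0//.
rewrite E -(gE_EFin i2); exact: ltry.
Qed.

(** The error may be unbounded in t through M, since pointwise convergence suffices. *)
Lemma measurable_approx (h : T -> R) (M : T -> R) :
  (forall e : R, 0 < e -> exists2 h' : T -> R, measurable_fun setT h' & forall t, `|h t - h' t| <= e * M t) ->
  measurable_fun setT h.
Proof.
move=> H.
have /choice[hn hnP] : forall n : nat, exists h' : T -> R, measurable_fun setT h' /\
    forall t, `|h t - h' t| <= n.+1%:R^-1 * M t.
  by move=> n; have [|h' m1 m2] := H (n.+1%:R^-1); [rewrite invr_gt0|exists h'].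
apply: (measurable_fun_cvg (h := hn)) => [n|t _]; first by have [] := hnP n.
apply/cvgrPdist_le => e e0; near=> n.
have [_ /(_ t) /le_trans] := hnP n; apply.
rewrite mulrC ler_pdivrMr// mulrC -ler_pdivrMr//.
apply: ltW; apply: (@lt_trans _ _ n%:R); last by rewrite ltr_nat.
near: n; exact: nbhs_infty_gtr.
Unshelve. all: by end_near. Qed.

Let expand_cells n (g : R -> 'I_n) c (f : V -> R) v w x :
  f (v + c (g x) *: w) = \sum_j (g x == j)%:R * f (v + c j *: w).
Proof.
rewrite (bigD1 (g x))//= eqxx mul1r big1 ?addr0// => j gj.
by rewrite eq_sym (negbTE gj) mul0r.
Qed.

(** No sigma-algebra on V is used: one scalar coordinate is discretized at a time, and on each cell
    the induction hypothesis applies at a shifted base point. *)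
Lemma measurable_blip_sum C f (s : seq U) v : blip C f ->
  measurable_fun setT (fun t => f (v + \sum_(u <- s) X u t *: a u)).
Proof.
move=> fC; elim: s v => [|u s IH] v.
  by under eq_fun do rewrite big_nil; exact: measurable_cst.
under eq_fun do rewrite big_cons addrCA addrC.
pose S t := \sum_(u <- s) X u t *: a u.
apply: (@measurable_approx _ (fun t => C * norm1 (a u) + 2 * C * X u t ^+ 2)) => e e0.
have [n [g [c [mg gc]]]] := gaussian_discretization e0.
exists (fun t => f (v + S t + c (g (X u t)) *: a u)).
  rewrite (_ : (fun t => _) = (fun t => \sum_j (g (X u t) == j)%:R * f (v + S t + c j *: a u))); last first.
    by apply/funext => t; exact: expand_cells.
  apply: measurable_sum => j; apply: measurable_funM.
    rewrite (cell_indic g (X u) j); apply: measurable_indic.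
    by rewrite -[X in measurable X]setTI; exact: (mX u).
  by under eq_fun do rewrite addrAC; exact: IH.
move=> t; apply: (le_trans (blip_line_disc e0 gc (v + S t) (a u) (X u t) fC)).
by rewrite le_eqVlt; apply/orP; left; apply/eqP; ring.
Qed.

Definition cylinder (J : {set U}) (B : U -> set R) : set T :=
  \bigcap_(u in [set` J]) (X u @^-1` B u).

Let measurable_preX u (B : set R) : measurable B -> measurable (X u @^-1` B).
Proof. by move=> mB; rewrite -[X in measurable X]setTI; exact: mX. Qed.

Lemma measurable_cylinder J B : (forall u, measurable (B u)) -> measurable (cylinder J B).
Proof.
move=> mB; apply: fin_bigcap_measurable; first exact: finite_finset.
by move=> u _; rewrite -[X in measurable X]setTI; exact: mX.
Qed.

(* Induction on [s]: the coordinate being integrated is replaced by a finitely valued one,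
   whose level sets are absorbed in the cylinder set. *)
Lemma Ex_cylinder C f (s : seq U) : blip C f -> uniq s ->
  forall (J : {set U}) (B : U -> set R) v, (forall u, measurable (B u)) ->
    (forall u, u \in s -> u \notin J) ->
  Ex P (fun t => \1_(cylinder J B) t * f (v + \sum_(u <- s) X u t *: a u)) =
  fine (P (cylinder J B)) * gsl [seq a u | u <- s] f v.
Proof.
move=> fC; have C0 := blip_ge0 fC.
elim: s => [_|u s IH /= /andP[us s_uniq]] J B v mB sJ.
  have mE := measurable_cylinder J mB.
  have -> : (fun t => \1_(cylinder J B) t * f (v + \sum_(u <- [::]) X u t *: a u)) =
      (fun t => f v * \1_(cylinder J B) t).
    by apply/funext => t; rewrite big_nil addr0 mulrC.
  rewrite ExZ; last first.
    apply: (@Ei_bounded _ _ _ _ _ 1) => [|t]; first exact: measurable_indic.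
    by rewrite indicE; case: (_ \in _); rewrite ?normr1 ?normr0.
  rewrite mulrC; congr (_ * _).
  by rewrite /Ex /Rintegral integral_indic// setIT.
have mE := measurable_cylinder J mB.
pose S t := \sum_(w <- s) X w t *: a w.
pose h t := \1_(cylinder J B) t * f (v + S t + X u t *: a u).
have -> : (fun t => \1_(cylinder J B) t * f (v + \sum_(w <- u :: s) X w t *: a w)) = h.
  by apply/funext => t; rewrite /h big_cons addrCA addrC.
have ind1 A t : `|\1_A t : R| <= 1.
  by rewrite indicE; case: (_ \in _); rewrite ?normr1 ?normr0.
have mh : Ei P h.
  apply: (@Ei_bounded _ _ _ _ _ C) => [|t].
    apply: measurable_funM; first exact: measurable_indic.
    rewrite (_ : (fun t => _) = (fun t => f (v + \sum_(w <- u :: s) X w t *: a w))).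
      exact: measurable_blip_sum fC.
    by apply/funext => t; rewrite big_cons [in RHS]addrCA [in RHS]addrC.
  by rewrite normrM -[leRHS]mul1r ler_pM//; exact: fC.1.
apply/eqP; rewrite -subr_eq0 -normr_le0; apply/ler_addgt0Pr => e' e'0; rewrite add0r.
pose M := C * norm1 (a u) + 2 * C * gE (fun x => x ^+ 2).
have m20 : 0 <= gE (fun x : R => x ^+ 2) by apply: gE_ge0 => x; rewrite sqr_ge0.
have M0 : 0 <= M by rewrite addr_ge0// !mulr_ge0// norm1_ge0.
(* Discretizing costs M e twice, once under P and once in [gs]; the + 1 keeps the denominator
   positive. *)
pose e := e' / (2 * M + 1).
have e0 : 0 < e by rewrite divr_gt0//; lra.
have [n [g [c [mg gc]]]] := gaussian_discretization e0.
pose hj j t := \1_(cylinder J B) t * ((g (X u t) == j)%:R * f (v + c j *: a u + S t)).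
pose Bj j w := if w == u then [set x : R | g x = j] else B w.
have mBj j w : measurable (Bj j w) by rewrite /Bj; case: ifP.
have uJ : u \notin J by apply: sJ; rewrite mem_head.
have cylE j : cylinder (u |: J) (Bj j) = cylinder J B `&` X u @^-1` [set x | g x = j].
  apply/seteqP; split => t /=.
    move=> H; split.
      move=> w /= wJ; have := H w; rewrite /= !inE wJ orbT => /(_ isT).
      by rewrite /Bj; case: eqP => // wu; rewrite wu (negbTE uJ) in wJ.
    by have := H u; rewrite /= !inE eqxx => /(_ isT); rewrite /Bj eqxx.
  move=> [H1 H2] w /=; rewrite !inE => /orP[/eqP ->|wJ]; first by rewrite /Bj eqxx.
  by rewrite /Bj; case: eqP => [->//|_]; exact: H1.
have hjE j : hj j = (fun t => \1_(cylinder (u |: J) (Bj j)) t * f (v + c j *: a u + S t)).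
  apply/funext => t; rewrite cylE indicI /= /hj mulrA; congr (_ * _ * _).
  by rewrite -(cell_indic g (X u) j).
(* Mutual independence enters here: it splits off the cell of coordinate u, whose probability is its
   Gaussian mass. *)
have Pj j : fine (P (cylinder (u |: J) (Bj j))) = cell_mass g j * fine (P (cylinder J B)).
  rewrite /cylinder !indX// big_setU1//= fineM; last 2 first.
  - exact/fin_num_measure/measurable_preX.
  - by apply: prode_fin_num => w _; exact/fin_num_measure/measurable_preX.
  congr (_ * _).
    rewrite /Bj eqxx lawX// /cell_mass /gE /Ex /Rintegral; congr fine.
    transitivity (\int[gam R]_x (\1_[set x | g x = j] x)%:E)%E.
      by rewrite integral_indic//; [rewrite setIT|exact: mg].
    apply: eq_integral => x _.
    exact: (congr1 (fun h => (h x)%:E) (esym (cell_indic g (id : R -> R) j))).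
  by congr fine; apply: eq_bigr => w wJ; rewrite /Bj; case: eqP => // wu; rewrite wu (negbTE uJ) in wJ.
have ihj j : Ei P (hj j).
  rewrite hjE; apply: (@Ei_bounded _ _ _ _ _ C) => [|t].
    apply: measurable_funM; last exact: measurable_blip_sum fC.
    by apply: measurable_indic; exact: measurable_cylinder.
  by rewrite normrM -[leRHS]mul1r ler_pM//; exact: fC.1.
have [i1 i2] := Ex_sum (index_enum _) ihj.
have E1 : Ex P (fun t => \sum_j hj j t) =
    fine (P (cylinder J B)) * disc (cell_mass g) c (a u) (gsl [seq a u | u <- s] f) v.
  rewrite i2 /disc mulr_sumr; apply: eq_bigr => j _.
  rewrite hjE IH//; first by rewrite Pj; ring.
  move=> w ws; rewrite !inE negb_or sJ ?inE ?ws ?orbT// andbT.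
  by apply: contraNneq us => <-.
have hd t : `|h t - \sum_j hj j t| <= C * norm1 (a u) * e + 2 * C * e * X u t ^+ 2.
  have -> : \sum_j hj j t = \1_(cylinder J B) t * f (v + S t + c (g (X u t)) *: a u).
    have -> := @expand_cells n g c f (v + S t) (a u) (X u t).
    rewrite /hj -mulr_sumr; congr (_ * _); apply: eq_bigr => j _.
    by rewrite (addrAC v).
  rewrite -mulrBr normrM -[leRHS]mul1r ler_pM//.
  exact: (blip_line_disc e0 gc (v + S t) (a u) (X u t) fC).
have D1 : `|Ex P h - Ex P (fun t => \sum_j hj j t)| <= M * e.
  rewrite -ExB//; apply: (le_trans (Ex_abs (EiB mh i1))).
  have [s1 s2] := Ex_sqr_lawX u.
  have -> : M * e = Ex P (fun t => C * norm1 (a u) * e + 2 * C * e * X u t ^+ 2).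
    rewrite (ExD (Ei_cst P (C * norm1 (a u) * e)) (EiZ (2 * C * e) s1)).
    by rewrite Ex_cst ExZ// s2 /M; ring.
  apply: Ex_le => //; first exact/Ei_abs/EiB.
  by apply: EiD; [exact: Ei_cst|exact: EiZ].
have D2 := gs_disc_err e0 mg gc (a u) v (gsl_blip [seq a u | u <- s] fC).
have p1 : 0 <= fine (P (cylinder J B)) <= 1.
  rewrite fine_ge0//= -lee_fin fineK; first exact: probability_le1.
  exact: fin_num_measure.
rewrite E1 in D1; rewrite -/M in D2.
move: D1 D2 p1.
move: (fine _) (Ex P h) (disc _ _ _ _ _) (gs _ _ _) => q E D G D1 D2 q1.
have D3 : `|q * G - q * D| <= M * e.
  by rewrite -mulrBr normrM ger0_norm; [rewrite -[leRHS]mul1r ler_pM//|]; lra.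
have Me : 2 * (M * e) <= e'.
  rewrite /e mulrA mulrCA ler_piMr ?(ltW e'0)//.
  by rewrite ler_pdivrMr//; lra.
have := ler_distD (q * D) E (q * G); rewrite (distrC (q * D)); lra.
Qed.

Lemma Ex_gaussian_vector C f (s : seq U) v : blip C f -> uniq s ->
  Ex P (fun t => f (v + \sum_(u <- s) X u t *: a u)) = gsl [seq a u | u <- s] f v.
Proof.
move=> fC us.
have := Ex_cylinder fC us (J := finset.set0) (B := fun=> setT) v (fun=> measurableT).
have -> : cylinder finset.set0 (fun=> setT) = setT by apply/seteqP; split => // t _ u /=; rewrite inE.
rewrite probability_setT mul1r => <-; last by move=> u _; rewrite inE.
by congr Ex; apply/funext => t; rewrite indicT mul1r.
Qed.

End gaussian_vector.

(** * Nets and recovery *)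

(** Each cell of a grid of mesh e that meets S contributes one point of S itself, so net points
    inherit the constraints defining S. If S is empty, so is the net. *)
Lemma net_exists {R : realType} (n : nat) (S : set ('I_n -> R)) (e : R) : 0 < e ->
  (forall s, S s -> forall l, `|s l| <= 1) ->
  exists (I : finType) (w : I -> 'I_n -> R), (forall i, S (w i)) /\
    forall s, S s -> exists i, forall l, `|s l - w i l| <= e.
Proof.
move=> e0 S1; pose M := Num.truncn (2 / e).
pose cell (s : 'I_n -> R) : {ffun 'I_n -> 'I_M.+1} := [ffun l => inord (Num.truncn ((s l + 1) / e))].
pose I : finType := {c : {ffun 'I_n -> 'I_M.+1} | `[< exists2 s, S s & cell s = c >]}.
have /choice[w wP] : forall i : I, exists s, S s /\ cell s = val i.
  by move=> [c /= /asboolP[s Ss cs]]; exists s.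
exists I, w; split; first by move=> i; have [] := wP i.
move=> s Ss; have cP : `[< exists2 s', S s' & cell s' = cell s >] by apply/asboolP; exists s.
exists (exist _ (cell s) cP) => l; have [Sw /= cw] := wP (exist _ (cell s) cP).
move: (w _) Sw cw => z Sz /ffunP /(_ l); rewrite !ffunE => /(congr1 val) /=.
have b (x : R) : `|x| <= 1 -> 0 <= (x + 1) / e /\ (Num.truncn ((x + 1) / e) < M.+1)%N.
  rewrite ler_norml => /andP[x1 x2]; have x0 : 0 <= (x + 1) / e by rewrite divr_ge0 ?(ltW e0)//; lra.
  by split => //; rewrite ltnS; apply: le_truncn; rewrite ler_wpM2r ?invr_ge0 ?(ltW e0)//; lra.
have [s0 s1] := b _ (S1 _ Ss l); have [z0 z1] := b _ (S1 _ Sz l).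
rewrite !inordK// => E.
have := truncn_itv s0; have := truncn_itv z0; rewrite E.
move: (Num.truncn _) => k /andP[k1 k2] /andP[k3 k4].
have -> : s l - z l = e * ((s l + 1) / e - (z l + 1) / e) by field; rewrite gt_eqF.
rewrite normrM gtr0_norm// -[leRHS]mulr1 ler_pM2l// ler_norml.
by move: k2 k4; rewrite -natr1 => k2 k4; apply/andP; split; lra.
Qed.

Section recovery.
Context {R : realType} (q : R).
Hypothesis q01 : 0 <= q <= 1.

Lemma absq0 : absq q 0 = 0.
Proof. by rewrite /absq eqxx; case: eqP => // /eqP q0; rewrite normr0 powR0. Qed.

Lemma absq_ge0 (t : R) : 0 <= absq q t.
Proof. by rewrite /absq; case: ifP => _; [case: ifP|exact: powR_ge0]. Qed.

Lemma absqN (t : R) : absq q (- t) = absq q t.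
Proof. by rewrite /absq oppr_eq0 normrN. Qed.

Lemma absq_le (t : R) : absq q t <= 1 + `|t|.
Proof.
move/andP: q01 => [q0 q1]; rewrite /absq; case: ifP => _.
  by case: ifP => _; rewrite ?addr_ge0// lerDl.
have [t1|t1] := leP `|t| 1.
  apply: (@le_trans _ _ 1); last by rewrite lerDl.
  by rewrite -[leRHS](congr1 (fun f => f q) (powR1 R)) ge0_ler_powR// ?nnegrE.
apply: (@le_trans _ _ `|t|); last by rewrite lerDr.
by rewrite -[leRHS]powRr1// ler_powR// ltW.
Qed.

Lemma absqM (c t : R) : 0 < c -> absq q (c * t) = c `^ q * absq q t.
Proof.
move=> c0; rewrite /absq; case: ifPn => [/eqP ->|q0].
  by rewrite powRr0 mul1r mulf_eq0 gt_eqF.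
by rewrite normrM (gtr0_norm c0) powRM// ltW.
Qed.

Lemma absqD (s t : R) : absq q (s + t) <= absq q s + absq q t.
Proof.
move/andP: q01 => [q0 q1]; rewrite /absq; case: ifPn => [_|qn0].
  have [->|s0] := eqVneq s 0; first by rewrite add0r add0r.
  have [->|t0] := eqVneq t 0; first by rewrite addr0 addr0 (negbTE s0).
  by case: ifP => _; lra.
have qp : 0 < q by rewrite lt_neqAle eq_sym qn0.
have [->|s0] := eqVneq s 0; first by rewrite add0r lerDr powR_ge0.
have S0 : 0 < `|s| + `|t| by rewrite ltr_pwDl// normr_gt0.
apply: (@le_trans _ _ ((`|s| + `|t|) `^ q)).
  by rewrite ge0_ler_powR// ?nnegrE// ?addr_ge0// ler_normD.
(* A ratio u in [0, 1] satisfies u <= u^q since q <= 1; applied to the shares of |s| and |t| in |s|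
   + |t|, which add up to 1. *)
have part (x : R) : 0 <= x -> x <= `|s| + `|t| ->
    x / (`|s| + `|t|) * (`|s| + `|t|) `^ q <= x `^ q.
  move=> x0 xS; have [->|xn0] := eqVneq x 0; first by rewrite mul0r mul0r powR_ge0.
  have xp : 0 < x by rewrite lt_neqAle eq_sym xn0.
  have u01 : 0 < x / (`|s| + `|t|) <= 1 by rewrite divr_gt0//= ler_pdivrMr// mul1r.
  rewrite -[in leRHS](divfK (lt0r_neq0 S0) x) powRM ?(ltW S0)//; last by rewrite divr_ge0// ltW.
  by rewrite ler_wpM2r ?powR_ge0// ger1_powR.
have := lerD (part `|s| (normr_ge0 _) _) (part `|t| (normr_ge0 _) _).
rewrite -mulrDl -mulrDl divff ?(lt0r_neq0 S0)// mul1r; apply.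
  by rewrite lerDl.
by rewrite lerDr.
Qed.

Lemma recovers_of_kernel m n k (M : 'M[R]_(m, n)) :
  (forall w : 'cV[R]_n, M *m w = 0 -> w != 0 ->
    \sum_(i < n | (n - k <= i)%N) absq q (w i 0) < \sum_(i < n | (i < n - k)%N) absq q (w i 0)) ->
  recovers q k M.
Proof.
move=> H xt xt0 x Mx xxt; pose w := x - xt.
have Mw : M *m w = 0 by rewrite mulmxBr Mx subrr.
have w0 : w != 0 by rewrite subr_eq0; apply/eqP.
have split (z : 'cV[R]_n) : lq_qnorm q z =
    \sum_(i < n | (i < n - k)%N) absq q (z i 0) + \sum_(i < n | (n - k <= i)%N) absq q (z i 0).
  rewrite /lq_qnorm (bigID (fun i : 'I_n => (i < n - k)%N)) /=; congr (_ + _).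
  by apply: eq_bigl => i; rewrite -leqNgt.
rewrite !split [X in X + _ < _]big1 ?add0r; last by move=> i ik; rewrite xt0// absq0.
have -> : \sum_(i < n | (i < n - k)%N) absq q (x i 0) = \sum_(i < n | (i < n - k)%N) absq q (w i 0).
  by apply: eq_bigr => i ik; rewrite !mxE xt0// oppr0 addr0.
rewrite -ltrBlDr -sumrB; apply: le_lt_trans (H w Mw w0).
apply: ler_sum => i _; rewrite lerBlDr.
have -> : xt i 0 = - w i 0 + x i 0 by rewrite !mxE opprB subrK.
by rewrite (le_trans (absqD _ _))// absqN.
Qed.

End recovery.

(** * Escape through the net *)

Lemma smooth3_shift {R : realType} (p p1 p2 : R -> R) (c : R) : smooth3 p p1 p2 ->
  smooth3 (fun x => p (x - c)) (fun x => p1 (x - c)) (fun x => p2 (x - c)).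
Proof.
move=> [C [B T0 T1 T2]]; exists C; split => [x|x h|x h|x h]; rewrite ?(addrAC x h).
- exact: B.
- exact: T0.
- exact: T1.
- exact: T2.
Qed.

Lemma cauchy_unit {R : realType} (U : finType) (x y : U -> R) :
  \sum_u x u ^+ 2 = 1 -> \sum_u y u ^+ 2 = 1 -> \sum_u x u * y u <= 1.
Proof.
move=> x1 y1; have -> : 1 = \sum_u (x u ^+ 2 + y u ^+ 2) / 2 :> R.
  by rewrite -mulr_suml big_split /= x1 y1; field.
apply: ler_sum => u _; have := sqr_ge0 (x u - y u); lra.
Qed.

Section escape.
Context d (T : measurableType d) {R : realType} (P : probability T R).
Context {I J : finType} {m n : nat}.
Variables (w : I -> 'I_n -> R) (y : J -> 'I_m -> R) (A : T -> 'M[R]_(m, n)).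
Hypotheses (w1 : forall i, \sum_l w i l ^+ 2 = 1) (y1 : forall j, \sum_k y j k ^+ 2 = 1).
Hypothesis iidA : iid_gaussian_matrix P A.
Variables (lam : R).
Local Notation V := {ffun I * J -> R}.

(* Directions of the two families X(i,j) = <y_j, A w_i> + g (coordinates of A: [dA], of g: [dg])
   and Y(i,j) = <y_j, a> + <w_i, h> *)
Let dA (kl : 'I_m * 'I_n) : V := [ffun ij => y ij.2 kl.1 * w ij.1 kl.2].
Let dg : V := [ffun=> 1].
Let dY (u : 'I_m + 'I_n) : V :=
  match u with inl k => [ffun ij => y ij.2 k] | inr l => [ffun ij => w ij.1 l] end.

(** [dg] stands last so that the integration over g is innermost and can be estimated for a fixed
    matrix. *)
Let lX := [seq dA kl | kl <- index_enum ('I_m * 'I_n)%type] ++ [:: dg].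
Let lY := [seq dY u | u <- index_enum ('I_m + 'I_n)%type].

Let covE i i' j j' : covdiff lX lY (i, j) (i', j') =
  (1 - \sum_l w i l * w i' l) * (1 - \sum_k y j k * y j' k).
Proof.
rewrite /covdiff /lX big_cat big_map big_seq1 !ffunE mulr1.
have -> : \sum_(kl : 'I_m * 'I_n) dA kl (i, j) * dA kl (i', j') =
    (\sum_k y j k * y j' k) * (\sum_l w i l * w i' l).
  rewrite -(pair_bigA _ (fun k l => dA (k, l) (i, j) * dA (k, l) (i', j'))) /=.
  rewrite mulr_suml; apply: eq_bigr => k _; rewrite mulr_sumr; apply: eq_bigr => l _.
  by rewrite !ffunE /=; ring.
have -> : \sum_(a <- lY) a (i, j) * a (i', j') = \sum_k y j k * y j' k + \sum_l w i l * w i' l.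
  rewrite /lY big_map big_sumType /=; congr (_ + _); apply: eq_bigr => u _;
    by rewrite !ffunE.
rewrite /=; ring.
Qed.

(** The step climbs from 0 at lam to 1 at lam + 3; this is the origin of every + 3 below. *)
Let p (x : R) := spline0 (x - lam).
Let Psi : V -> R := minmax p.

Let p01 x : 0 <= p x <= 1. Proof. exact: spline0_itv. Qed.

Let compare v : gsl lY Psi v <= gsl lX Psi v.
Proof.
apply: (minmax_compare (p1 := fun x => spline1 (x - lam)) (p2 := fun x => spline2 (x - lam))).
- exact/smooth3_shift/smooth3_spline.
- exact: p01.
- by move=> x; have /andP[] := spline1_itv (x - lam).
- move=> i j j'; rewrite covE (_ : \sum_l _ = 1) ?subrr ?mul0r// -[RHS](w1 i).
  by apply: eq_bigr => l _; rewrite expr2.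
- by move=> i i' j j'; rewrite covE mulr_ge0// subr_ge0; exact: cauchy_unit.
Qed.

Let Psi01 v : 0 <= Psi v <= 1.
Proof.
have c01 i : 0 <= \prod_j (1 - p (v (i, j))) <= 1.
  by apply/andP; split; [apply: prodr_ge0|apply: prodr_ile1] => j _; have := p01 (v (i, j)); lra.
apply/andP; split; [apply: prodr_ge0 => i _|apply: prodr_ile1 => i _]; have := c01 i; lra.
Qed.

Let Psi_eq0 (v : V) i : (forall j, v (i, j) <= lam) -> Psi v = 0.
Proof.
move=> vi; rewrite /Psi /minmax (bigD1 i)//= big1 ?subrr ?mul0r// => j _.
by rewrite /p spline0_le0 ?subr0// subr_le0.
Qed.

Let Psi_eq1 (v : V) : (forall i, exists j, lam + 3 <= v (i, j)) -> Psi v = 1.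
Proof.
move=> vi; rewrite /Psi /minmax big1// => i _; have [j vj] := vi i.
by rewrite (bigD1 j)//= /p spline0_ge3 ?subrr ?mul0r ?subr0// lerBrDl.
Qed.

Let Psi_blip : exists C, blip C Psi.
Proof. exact: (minmax_blip (smooth3_shift lam (@smooth3_spline R))). Qed.

(** Markov bound for a standard normal variable exceeding lam / 2, taken with the weight
    exp(x^2/4). *)
Let tail : R := gE (fun x => expR (4^-1 * x ^+ 2)) * expR (- (lam ^+ 2 / 16)).

Let iexp4 : gint (fun x : R => expR (4^-1 * x ^+ 2)).
Proof.
apply: (@gam_integrable _ _ 1) => [|x]; last by rewrite mul1r ger0_norm// expR_ge0.
by apply: measurableT_comp => //; apply: measurable_funM => //; exact: measurable_funX.
Qed.

Let gs_Psi_tail (v : V) i : 0 < lam -> (forall j, v (i, j) <= lam / 2) -> gs dg Psi v <= tail.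
Proof.
move=> lam0 vi; have [C bC] := Psi_blip.
have -> : tail = gE (fun x => expR (- (lam ^+ 2 / 16)) * expR (4^-1 * x ^+ 2)).
  by rewrite gEZ// mulrC.
apply: gE_le => [||x]; [exact: (blip_gint _ _ bC)|exact: gintZ|].
have [xl|xl] := leP x (lam / 2).
  rewrite (Psi_eq0 (i := i)) ?mulr_ge0 ?expR_ge0// => j.
  by rewrite !ffunE /= [x *: _]mulr1; have := vi j; lra.
apply: (@le_trans _ _ 1); first by have /andP[] := Psi01 (v + x *: dg).
rewrite -expRD -[leLHS]expR0 ler_expR; nra.
Qed.

(** [s] and [s2] are the Chernoff parameters for |a|^2 and for the width of the net [w]. When |a|^2
    > rho some y_j has <y_j, a> >= tau1, and tau2 is the level that - <w_i, h> should not reach. *)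
Variables (rho s tau1 tau2 s2 Kb : R) (zeta : 'I_n -> R -> R).
Hypotheses (lam0 : 0 < lam) (s0 : 0 <= s) (s20 : 0 <= s2) (Kb0 : 0 < Kb) (tau12 : lam + 3 <= tau1 - tau2).
Hypothesis ynet : forall g : 'I_m -> R, (forall j, \sum_k y j k * g k < tau1) -> \sum_k g k ^+ 2 <= rho.
Hypothesis izeta : forall l, gint (fun x => expR (zeta l x)).
Hypothesis zetaP : forall i (h : 'I_n -> R), s2 * - (\sum_l w i l * h l) <= \sum_l zeta l (h l).

(** Psi equals 1 unless |a|^2 <= rho or some <w_i, h> <= - tau2. On each of these events an
    exponential that factors over the coordinates is at least 1, so [gsl_ge] applies. *)
Let lower : 1 - expR (s * rho) * gE (fun x => expR (- s * x ^+ 2)) ^+ m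
   - expR (- (s2 * tau2)) * \prod_l gE (fun x => expR (zeta l x)) <= gsl lY Psi 0.
Proof.
have [C bC] := Psi_blip.
pose psi (u : 'I_m + 'I_n) : R -> R := if u is inl _ then fun x => expR (- s * x ^+ 2) else fun=> 1.
pose chi (u : 'I_m + 'I_n) : R -> R := if u is inr l then fun x => expR (zeta l x) else fun=> 1.
have ipsi u : gint (psi u).
  case: u => [k|l]; last exact: gint_cst.
  apply: (@gam_integrable_bounded _ _ 1) => [|x].
    by apply: measurableT_comp => //; apply: measurable_funM => //; exact: measurable_funX.
  by rewrite ger0_norm ?expR_ge0// -[leRHS]expR0 ler_expR mulNr oppr_le0 mulr_ge0// sqr_ge0.
have ichi u : gint (chi u).
  by case: u => k'; [exact: gint_cst|exact: izeta].
have := @gsl_ge _ _ _ dY psi chi ipsi ichi C Psi (index_enum _) bC (index_enum_uniq _) 1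
  (expR (s * rho)) (expR (- (s2 * tau2))) 0.
have one (N : nat) : \prod_(i < N) gE (fun=> 1 : R) = 1.
  by rewrite big1// => *; exact: (gE_cst 1).
rewrite !big_sumType /= !one mulr1 mul1r big_const_ord iter_mulr_1; apply => x.
rewrite !big_sumType /= add0r.
have := Psi01 (\sum_k x (inl k) *: dY (inl k) + \sum_l x (inr l) *: dY (inr l)).
set v := _ + _; move=> /andP[Psi0 _].
rewrite !prodr_const !expr1n mulr1 mul1r.
rewrite -!expR_sum -!expRD.
have E1 := expR_ge0 (s * rho + \sum_(k < m) - s * x (inl k) ^+ 2).
have E2 := expR_ge0 (- (s2 * tau2) + \sum_(l < n) zeta l (x (inr l))).
have big_le (r : R) : 0 <= r -> 1 <= expR r by move=> r0; rewrite -[leLHS]expR0 ler_expR.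
have [xr|xr] := leP (\sum_k x (inl k) ^+ 2) rho.
  have : 1 <= expR (s * rho + \sum_(k < m) - s * x (inl k) ^+ 2).
    by apply: big_le; rewrite -mulr_sumr mulNr subr_ge0 ler_wpM2l.
  lra.
have [[i hi]|/forallNP hi] := pselect (exists i, \sum_l w i l * x (inr l) <= - tau2).
  have : 1 <= expR (- (s2 * tau2) + \sum_(l < n) zeta l (x (inr l))).
    apply: big_le; rewrite addrC subr_ge0; apply: le_trans (zetaP i (fun l => x (inr l))).
    by rewrite ler_wpM2l// lerNr.
  lra.
rewrite Psi_eq1; first by lra.
have [j hj] : exists j, tau1 <= \sum_k y j k * x (inl k).
  apply: contrapT => /forallNP H; move: xr; rewrite ltNge => /negP; apply.
  by apply: (ynet (g := fun k => x (inl k))) => j; rewrite ltNge; apply/negP/H.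
move=> i; exists j; have /negP := hi i; rewrite -ltNge => wi.
rewrite /v !(ffunE, sum_ffunE).
have -> : \sum_k (x (inl k) *: dY (inl k)) (i, j) = \sum_k y j k * x (inl k).
  by apply: eq_bigr => k _; rewrite !ffunE /= mulrC.
have -> : \sum_l (x (inr l) *: dY (inr l)) (i, j) = \sum_l w i l * x (inr l).
  by apply: eq_bigr => l _; rewrite !ffunE /= mulrC.
exact: le_trans tau12 (lerD hj (ltW wi)).
Qed.

Let bounded_entries : set T := \bigcap_(kl in [set: 'I_m * 'I_n]) [set t | `|A t kl.1 kl.2| <= Kb].
Let good : set T := \bigcap_(i in [set: I]) \bigcup_(j in [set: J])
  [set t | lam / 2 < \sum_k \sum_l y j k * A t k l * w i l].

(** The four losses are, in order: |a| too small, some <w_i, h> too negative, g above lam / 2, and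
    an entry of A above Kb, controlled by its second moment. The event F lives on the given space,
    while a, h and g exist only through smoothing operators. *)
Lemma escape_prob : exists F : set T, [/\ measurable F,
  forall t, F t -> (forall k l, `|A t k l| <= Kb) /\
    (forall i, exists j, lam / 2 < \sum_k \sum_l y j k * A t k l * w i l) &
  1 - expR (s * rho) * gE (fun x => expR (- s * x ^+ 2)) ^+ m
    - expR (- (s2 * tau2)) * \prod_l gE (fun x => expR (zeta l x))
    - gE (fun x => expR (4^-1 * x ^+ 2)) * expR (- (lam ^+ 2 / 16))
    - (m * n)%:R * gE (fun x => x ^+ 2) / Kb ^+ 2 <= fine (P F)].
Proof.
have [mA lawA indA] := iidA.
exists (bounded_entries `&` good).
have mF : measurable (bounded_entries `&` good).
  apply: measurableI.
    apply: fin_bigcap_measurable; first exact: finite_finset.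
    move=> [k l] _ /=; rewrite (_ : [set t | _] = (fun t => A t k l) @^-1` `[- Kb, Kb]).
      by rewrite -[X in measurable X]setTI; apply: mA => //; exact: measurable_itv.
    by apply/seteqP; split => t /=; rewrite in_itv/= ler_norml.
  apply: fin_bigcap_measurable; first exact: finite_finset.
  move=> i _; apply: fin_bigcup_measurable; first exact: finite_finset.
  move=> j _; pose h t := \sum_k \sum_l y j k * A t k l * w i l.
  rewrite (_ : [set t | _] = h @^-1` `]lam / 2, +oo[).
    rewrite -[X in measurable X]setTI.
    have : measurable_fun setT h.
      apply: measurable_sum => k; apply: measurable_sum => l.
      by apply: measurable_funM => //; apply: measurable_funM => //; exact: mA.
    by apply => //; exact: measurable_itv.
  by apply/seteqP; split => t /=; rewrite in_itv/= andbT.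
split => // [t [bt gt]|].
  split => [k l|i]; first exact: (bt (k, l)).
  by have [j _ jt] := gt i Logic.I; exists j.
have [C bC] := Psi_blip.
apply: (le_trans (lerB (lerB lower (lexx _)) (lexx _))).
rewrite !lerBlDr; apply: (le_trans (compare 0)).
pose X kl t := A t kl.1 kl.2.
have bg : blip C (gs dg Psi) by exact: gs_blip.
have mX kl : measurable_fun setT (X kl) by exact: mA.
have lawX kl (B : set R) : measurable B -> P (X kl @^-1` B) = gam R B by exact: lawA.
have -> : gsl lX Psi 0 = gsl [seq dA kl | kl <- index_enum ('I_m * 'I_n)%type] (gs dg Psi) 0.
  by rewrite /lX gsl_cat.
rewrite -(Ex_gaussian_vector dA mX lawX indA 0 bg (index_enum_uniq _)).
set S := fun t => _; set F := bounded_entries `&` good.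
have iS : Ei P S.
  by apply: (@Ei_bounded _ _ _ _ _ C) => [|t]; [by apply: (measurable_blip_sum _ _ _ _ bg)|exact: bg.1].
have i1 : Ei P (\1_F : T -> R).
  apply: (@Ei_bounded _ _ _ _ _ 1) => [|t]; first exact: measurable_indic.
  by rewrite indicE; case: (_ \in _); rewrite ?normr1 ?normr0.
have E1 : Ex P (\1_F : T -> R) = fine (P F).
  by rewrite /Ex /Rintegral integral_indic// setIT.
have [i2 E2] := Ex_sum (index_enum ('I_m * 'I_n)%type)
  (fun kl => EiZ (Kb ^- 2) (Ex_sqr_lawX mX lawX kl).1).
have Kb2 : 0 < Kb ^+ 2 by rewrite exprn_gt0.
have tail0 : 0 <= tail by rewrite mulr_ge0 ?expR_ge0//; apply: gE_ge0 => x; exact: expR_ge0.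
(* Outside F either an entry exceeds Kb, and its summand is then at least 1, or some row stays at
   most lam / 2, and only a large g can lift it above lam. *)
have bound t : S t <= \1_F t + (tail + \sum_kl Kb ^- 2 * X kl t ^+ 2).
  have sum0 : 0 <= \sum_kl Kb ^- 2 * X kl t ^+ 2.
    by apply: sumr_ge0 => kl _; rewrite mulr_ge0 ?sqr_ge0// invr_ge0 ltW.
  have S1 : S t <= 1.
    rewrite /S -[leRHS](gE_cst 1); apply: gE_le => [||x]; [exact: (blip_gint _ _ bC)|exact: gint_cst|].
    by have /andP[] := Psi01 (0 + \sum_(u <- index_enum ('I_m * 'I_n)%type) X u t *: dA u + x *: dg).
  rewrite indicE; have [tF|tF] := boolP (t \in F); first by rewrite (le_trans S1)// lerDl addr_ge0.
  rewrite add0r; have {tF} : ~ (bounded_entries t /\ good t) by move/negP: tF => tF H; apply: tF; rewrite inE.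
  move=> /not_andP[|] /existsNP[].
    move=> [k l] /not_implyP[_ /= /negP]; rewrite -ltNge => Kt.
    apply: (le_trans S1); apply: (@le_trans _ _ (\sum_kl Kb ^- 2 * X kl t ^+ 2)); last by rewrite lerDr.
    rewrite (bigD1 (k, l))//= -[leLHS]addr0 lerD//.
      rewrite mulrC ler_pdivlMr// mul1r -[X in _ <= X]real_normK ?num_real//.
      by rewrite lerXn2r ?nnegrE// ltW.
    by apply: sumr_ge0 => kl _; rewrite mulr_ge0 ?sqr_ge0// invr_ge0 ltW.
  move=> i /not_implyP[_ H]; apply: (@le_trans _ _ tail); last by rewrite lerDl.
  apply: (gs_Psi_tail (i := i)) => // j; rewrite leNgt; apply/negP => jt; apply: H; exists j => //=.
  apply: (lt_le_trans jt); rewrite add0r sum_ffunE.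
  rewrite -(pair_bigA _ (fun k l => (X (k, l) t *: dA (k, l)) (i, j))) /=.
  apply: ler_sum => k _; apply: ler_sum => l _; rewrite !ffunE /=.
  by rewrite le_eqVlt; apply/orP; left; apply/eqP; rewrite /X /GRing.scale /=; ring.
have iR := EiD (Ei_cst P tail) i2.
apply: (le_trans (Ex_le iS (EiD i1 iR) bound)).
rewrite (ExD i1 iR) (ExD (Ei_cst P tail) i2) E1 E2 Ex_cst -/tail.
rewrite -[leRHS]addrA lerD// [leLHS]addrC lerD//.
rewrite (eq_bigr (fun=> Kb ^- 2 * gE (fun x => x ^+ 2))); last first.
  by move=> kl _; rewrite (ExZ _ (Ex_sqr_lawX mX lawX kl).1) (Ex_sqr_lawX mX lawX kl).2.
rewrite sumr_const card_prod !card_ord -mulr_natl.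
rewrite le_eqVlt; apply/orP; left; apply/eqP; move: (gE _) => g2; field.
by rewrite gt_eqF.
Qed.

End escape.

(** * The sectional functionals *)

(** For y < 1, multiply (1 - y) exp y <= 1 by 1 + y. *)
Lemma expR_le_quad {R : realType} (y : R) : 0 <= y -> expR y <= 1 + y + y ^+ 2 * expR y.
Proof.
move=> y0; have e0 : 0 < expR y by exact: expR_gt0.
have [y1|y1] := leP 1 y.
  have : expR y <= y ^+ 2 * expR y by rewrite ler_peMl ?(ltW e0)// exprn_ege1.
  lra.
have : (1 - y) * expR y <= 1.
  have := expR_ge1Dx (- y); rewrite expRN => h.
  by rewrite -ler_pdivlMr// div1r.
nra.
Qed.

Section section_functional.
Context {R : realType} (q c nu gamma : R).
Hypotheses (q01 : 0 <= q <= 1) (cnu : `|c| <= nu) (gamma0 : 0 < gamma).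

(** With c = nu or c = - nu this covers the integrands of both sectional functionals. *)
Definition zval (h w : R) : R := `|h| * `|w| + c * absq q w - gamma * w ^+ 2.
Definition zsup (h : R) : \bar R := ereal_sup [set (zval h w)%:E | w in [set: R]].
Definition zfun (h : R) : R := fine (zsup h).

Let nu0 : 0 <= nu. Proof. exact: le_trans cnu. Qed.

(** From c |w|^q <= nu (1 + |w|), completing the square in |w| and (|h| + nu)^2 <= 2 (h^2 +
    nu^2). *)
Let zbound (h : R) : R := nu + (h ^+ 2 + nu ^+ 2) / (2 * gamma).

Let zval_ub h w : zval h w <= zbound h.
Proof.
rewrite /zval /zbound -(real_normK (num_real w)) -(real_normK (num_real h)).
have /andP[_ cn] : - nu <= c <= nu by rewrite -ler_norml.
have : c * absq q w <= nu * (1 + `|w|).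
  apply: (@le_trans _ _ (nu * absq q w)); first by rewrite ler_wpM2r ?absq_ge0.
  by rewrite ler_wpM2l// absq_le.
move: (c * _) => a; move: (`|h|) (`|w|) => x y ay.
have g0 := gamma0; have g2 : 0 < 2 * gamma by rewrite mulr_gt0.
have -> : nu + (x ^+ 2 + nu ^+ 2) / (2 * gamma) =
    nu + (x + nu) * y - gamma * y ^+ 2 + ((x - nu) ^+ 2 + (x + nu - 2 * gamma * y) ^+ 2) / (4 * gamma).
  by field; rewrite gt_eqF.
have : 0 <= ((x - nu) ^+ 2 + (x + nu - 2 * gamma * y) ^+ 2) / (4 * gamma).
  by rewrite divr_ge0 ?addr_ge0 ?sqr_ge0// mulr_ge0// ltW.
move: (_ / (4 * gamma)) => b; lra.
Qed.

Lemma zsupE h : zsup h = (zfun h)%:E.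
Proof.
rewrite /zfun fineK// fin_real//; apply/andP; split.
  apply: (@lt_le_trans _ _ (zval h 0)%:E); first exact: ltNyr.
  by apply: ereal_sup_ubound; exists 0.
apply: (@le_lt_trans _ _ (zbound h)%:E); last exact: ltry.
by apply: ge_ereal_sup => _ [w _ <-]; rewrite lee_fin.
Qed.

Lemma zval_le h w : zval h w <= zfun h.
Proof. by rewrite -lee_fin -zsupE; apply: ereal_sup_ubound; exists w. Qed.

Lemma zfun_ge0 h : 0 <= zfun h.
Proof.
apply: le_trans (zval_le h 0).
by rewrite /zval normr0 absq0 expr0n !mulr0 addr0 subr0.
Qed.

Let zfun_ub h : zfun h <= zbound h.
Proof.
by rewrite -lee_fin -zsupE; apply: ge_ereal_sup => _ [w _ <-]; rewrite lee_fin.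
Qed.

(** A supremum over uncountably many w; it is measurable because it is monotone in |h|. Truncating
    at 0 makes it monotone on the whole line. *)
Lemma measurable_zfun : measurable_fun [set: R] zfun.
Proof.
have mz : measurable_fun [set: R] (fun x => zfun (Num.max x 0)).
  apply: nondecreasing_measurable => // x y xy.
  rewrite -lee_fin -!zsupE; apply: ge_ereal_sup => _ [w _ <-].
  rewrite zsupE lee_fin; apply: le_trans (zval_le _ w).
  rewrite /zval lerD2r lerD2r ler_wpM2r//.
  have m0 (z : R) : 0 <= Num.max z 0 by rewrite le_max lexx orbT.
  have mm : Num.max x 0 <= Num.max y 0 by rewrite ge_max m0 andbT le_max xy.
  by rewrite !ger0_norm.
have -> : zfun = (fun x => zfun (Num.max x 0)) \o (fun x => `|x|).
  apply/funext => x /=; rewrite max_l//.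
  by rewrite /zfun /zsup /zval normr_id.
by apply: (measurableT_comp mz).
Qed.

(** Chosen so that 2 s0 [zbound] has quadratic part exactly h^2/4. The factor 2 leaves a spare
    exp(s0 zfun) to absorb the square in [zsq]. *)
Let s0 : R := gamma / 4.
Let s0_gt0 : 0 < s0. Proof. by rewrite divr_gt0. Qed.
Let K0 : R := expR (gamma / 2 * nu + nu ^+ 2 / 4).

Let exp_bound h : expR (2 * s0 * zfun h) <= K0 * expR (4^-1 * h ^+ 2).
Proof.
rewrite -expRD ler_expR /s0.
apply: (@le_trans _ _ (2 * (gamma / 4) * zbound h)).
  by rewrite ler_wpM2l// mulr_ge0// divr_ge0// ltW.
by rewrite le_eqVlt; apply/orP; left; apply/eqP; rewrite /zbound; field; rewrite gt_eqF.
Qed.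

Lemma gint_exp_zfun s : 0 <= s <= s0 -> gint (fun x => expR (s * zfun x)).
Proof.
move=> /andP[sp ss]; apply: (@gam_integrable _ _ K0) => [|x].
  by apply: measurableT_comp => //; apply: measurable_funM => //; exact: measurable_zfun.
rewrite ger0_norm ?expR_ge0//; apply: le_trans (exp_bound x).
have g0 := s0_gt0; by rewrite ler_expR ler_wpM2r ?zfun_ge0//; lra.
Qed.

Let sq_exp (y : R) : 0 <= y -> y ^+ 2 / 2 <= expR y.
Proof.
move=> y0; have := expR_ge1Dxn 1 y0; have -> : (2`!%:R : R) = 2 by [].
lra.
Qed.

Let zsq (h : R) : R := zfun h ^+ 2 * expR (s0 * zfun h).

Let gint_zsq : gint zsq.
Proof.
apply: (@gam_integrable _ _ (2 / s0 ^+ 2 * K0)) => [|x].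
  apply: measurable_funM; first exact: measurable_funX measurable_zfun.
  by apply: measurableT_comp => //; apply: measurable_funM => //; exact: measurable_zfun.
rewrite ger0_norm ?mulr_ge0 ?sqr_ge0 ?expR_ge0 ?zfun_ge0//.
rewrite -[leRHS]mulrA; apply: (@le_trans _ _ (2 / s0 ^+ 2 * expR (2 * s0 * zfun x))); last first.
  by rewrite ler_wpM2l// divr_ge0 ?sqr_ge0.
have -> : 2 * s0 * zfun x = s0 * zfun x + s0 * zfun x by ring.
rewrite expRD mulrA ler_wpM2r ?expR_ge0//.
have h := sq_exp (mulr_ge0 (ltW s0_gt0) (zfun_ge0 x)).
have c0 : 0 <= 2 / s0 ^+ 2 by rewrite divr_ge0 ?sqr_ge0.
apply: le_trans (ler_wpM2l c0 h).
by rewrite le_eqVlt; apply/orP; left; apply/eqP; field; rewrite gt_eqF.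
Qed.

Lemma gint_zfun : gint zfun.
Proof.
have i1 := gint_exp_zfun (s := s0); rewrite lexx (ltW s0_gt0) in i1.
apply: (gint_le measurable_zfun _ (gintZ s0^-1 (i1 isT))) => x.
rewrite ger0_norm ?zfun_ge0// ler_pdivlMl//.
by have := expR_ge1Dx (s0 * zfun x); lra.
Qed.

Lemma integral_zsup : (\int[gam R]_h zsup h = (gE zfun)%:E)%E.
Proof.
rewrite (gE_EFin gint_zfun); apply: eq_integral => h _; exact: zsupE.
Qed.

(** Integrate [expR_le_quad] at y = s zfun. As M is independent of s, a small s makes the mean
    dominate the exponent. *)
Lemma mgf_zfun : exists2 M, 0 <= M & forall s, 0 <= s <= gamma / 4 ->
  gE (fun x => expR (s * zfun x)) <= expR (s * gE zfun + s ^+ 2 * M).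
Proof.
exists (gE zsq).
  by apply: gE_ge0 => x; rewrite mulr_ge0 ?sqr_ge0 ?expR_ge0.
move=> s s01; have /andP[sp ss] := s01.
have i1 := gintZ s gint_zfun; have i2 := gintZ (s ^+ 2) gint_zsq.
have i3 := gintD (gint_cst 1) (gintD i1 i2).
apply: le_trans (expR_ge1Dx _).
rewrite -(gE_cst 1) -(gEZ s gint_zfun) -(gEZ (s ^+ 2) gint_zsq) -gED// -gED//; last 2 first.
- exact: gint_cst.
- exact: gintD.
apply: gE_le => [||x] //; first exact: gint_exp_zfun.
rewrite addrA; apply: (le_trans (expR_le_quad (mulr_ge0 sp (zfun_ge0 x)))).
rewrite lerD2l exprMn -[leLHS]mulrA ler_wpM2l ?sqr_ge0// ler_wpM2l ?sqr_ge0//.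
by rewrite ler_expR ler_wpM2r// zfun_ge0.
Qed.

End section_functional.

(** * The unit cone *)

Section unit_cone.
Context {R : realType} (q : R) (n k : nat).
Hypothesis q01 : 0 <= q <= 1.

Definition unit_cone : set ('I_n -> R) := [set s | \sum_l s l ^+ 2 = 1 /\
  \sum_(l < n | (l < n - k)%N) absq q (s l) <= \sum_(l < n | (n - k <= l)%N) absq q (s l)].

(* After rescaling to norm sqrt n, the Lagrangian bound with multipliers nu and gamma
   separates the coordinates. *)
Lemma unit_cone_width (nu gamma : R) (s h : 'I_n -> R) : 0 <= nu -> 0 < gamma -> (0 < n)%N ->
  unit_cone s ->
  Num.sqrt n%:R * - (\sum_l s l * h l) <=
  \sum_(l < n) ((if (n - k <= l)%N then zfun q nu gamma (h l) else zfun q (- nu) gamma (h l)) + gamma).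
Proof.
move=> nu0 g0 n0 [s1 sc]; set c := Num.sqrt n%:R.
have n0' : 0 < n%:R :> R by rewrite ltr0n.
have c0 : 0 < c by rewrite sqrtr_gt0.
have cn : c ^+ 2 = n%:R by rewrite sqr_sqrtr// ltW.
pose sg (l : 'I_n) : R := if (n - k <= l)%N then nu else - nu.
have zl (l : 'I_n) : (if (n - k <= l)%N then zfun q nu gamma (h l) else zfun q (- nu) gamma (h l)) =
    zfun q (sg l) gamma (h l) by rewrite /sg; case: ifP.
apply: (@le_trans _ _ (\sum_l (zval q (sg l) gamma (h l) (c * s l) + gamma))); last first.
  apply: ler_sum => l _; rewrite zl lerD2r; apply: (zval_le (nu := nu)) => //.
  by rewrite /sg; case: ifP => _; rewrite ?normrN ger0_norm.
(* The quadratic penalty totals gamma n because c s has squared norm n, and cancels the gamma added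
   to each coordinate. The remaining nu-term is nonnegative by the cone condition. *)
have e1 : \sum_l (zval q (sg l) gamma (h l) (c * s l) + gamma) =
    \sum_l `|h l| * `|c * s l| + c `^ q * (\sum_l sg l * absq q (s l)).
  have E0 : \sum_l zval q (sg l) gamma (h l) (c * s l) = \sum_l `|h l| * `|c * s l|
      + \sum_l sg l * absq q (c * s l) - \sum_l gamma * (c * s l) ^+ 2.
    by rewrite -big_split -sumrB.
  have E1 : \sum_l sg l * absq q (c * s l) = c `^ q * (\sum_l sg l * absq q (s l)).
    by rewrite mulr_sumr; apply: eq_bigr => l _; rewrite absqM// mulrCA.
  have E2 : \sum_l gamma * (c * s l) ^+ 2 = gamma * n%:R.
    rewrite (eq_bigr (fun l => gamma * n%:R * s l ^+ 2)); last first.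
      by move=> l _; rewrite exprMn cn mulrA.
    by rewrite -mulr_sumr s1 mulr1.
  by rewrite big_split /= E0 E1 E2 sumr_const card_ord -mulr_natr; ring.
rewrite e1 -[leLHS]addr0 lerD//; last first.
  rewrite mulr_ge0 ?powR_ge0// (bigID (fun l : 'I_n => (n - k <= l)%N)) /=.
  rewrite (eq_bigr (fun l => nu * absq q (s l))); last by move=> l lk; rewrite /sg lk.
  rewrite [X in _ + X](eq_bigr (fun l => - nu * absq q (s l))); last by move=> l lk; rewrite /sg (negbTE lk).
  rewrite -!mulr_sumr mulNr subr_ge0 ler_wpM2l//.
  by under eq_bigl do rewrite -ltnNge.
rewrite mulrN mulr_sumr -sumrN; apply: ler_sum => l _.
rewrite -normrM; apply: le_trans (ler_norm _) _; rewrite normrN.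
by have -> : c * (s l * h l) = h l * (c * s l) by ring.
Qed.

Lemma unit_cone_coord s : unit_cone s -> forall l, `|s l| <= 1.
Proof.
move=> [s1 _] l; rewrite -(@ler_pXn2r _ 2) ?nnegrE// expr1n real_normK ?num_real//.
by rewrite -s1 (bigD1 l)//= lerDl sumr_ge0// => i _; exact: sqr_ge0.
Qed.

Lemma recovers_of_unit_cone m (M : 'M[R]_(m, n)) :
  (forall s, unit_cone s -> exists j, \sum_l M j l * s l != 0) -> recovers q k M.
Proof.
move=> H; apply: recovers_of_kernel => // w Mw w0; rewrite ltNge; apply/negP => wc.
pose N := Num.sqrt (\sum_l w l 0 ^+ 2).
have N2 : 0 < \sum_l w l 0 ^+ 2.
  rewrite lt_neqAle sumr_ge0 ?andbT; last by move=> l _; exact: sqr_ge0.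
  apply: contraNN w0 => /eqP/esym/eqP; rewrite psumr_eq0; last by move=> l _; exact: sqr_ge0.
  move=> /allP w0; apply/eqP/matrixP => i j; rewrite ord1 mxE; apply/eqP.
  by have := w0 i (mem_index_enum i); rewrite /= sqrf_eq0.
have N0 : 0 < N by rewrite sqrtr_gt0.
have Ni : 0 < N^-1 by rewrite invr_gt0.
have [|j /eqP] := H (fun l => N^-1 * w l 0).
- split.
    under eq_bigr do rewrite exprMn.
    by rewrite -mulr_sumr exprVn sqr_sqrtr ?(ltW N2)// mulVf// gt_eqF.
  under eq_bigr do rewrite absqM//.
  under [leRHS]eq_bigr do rewrite absqM//.
  by rewrite -!mulr_sumr ler_wpM2l// powR_ge0.
- apply; have /matrixP /(_ j 0) := Mw; rewrite !mxE => Mj.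
  by under eq_bigr do rewrite mulrCA; rewrite -mulr_sumr Mj mulr0.
Qed.

End unit_cone.

Lemma sphere_net {R : realType} (m : nat) (tau rho : R) : 0 < tau -> tau ^+ 2 < rho ->
  exists (J : finType) (y : J -> 'I_m -> R), (forall j, \sum_k y j k ^+ 2 = 1) /\
   forall g : 'I_m -> R, (forall j, \sum_k y j k * g k < tau) -> \sum_k g k ^+ 2 <= rho.
Proof.
move=> t0 tr; have r0 : 0 < rho by apply: le_lt_trans tr; exact: sqr_ge0.
have sr0 : 0 < Num.sqrt rho by rewrite sqrtr_gt0.
have tsr : tau < Num.sqrt rho by rewrite -(@ltr_pXn2r _ 2) ?nnegrE ?ltW// sqr_sqrtr// ltW.
(* The relative loss allowed when g / |g| is replaced by a net point: (1 - kap) sqrt rho = tau. A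
   coordinatewise mesh of kap / (m + 1) achieves it, the + 1 covering m = 0. *)
pose kap := 1 - tau / Num.sqrt rho.
have kap0 : 0 < kap by rewrite subr_gt0 ltr_pdivrMr// mul1r.
pose S : set ('I_m -> R) := [set s | \sum_k s k ^+ 2 = 1].
have m1 : 0 < m%:R + 1 :> R by rewrite ltr_wpDl.
have S1 s : S s -> forall k, `|s k| <= 1.
  move=> s1 l; rewrite -(@ler_pXn2r _ 2) ?nnegrE// expr1n real_normK ?num_real//.
  by rewrite -s1 (bigD1 l)//= lerDl sumr_ge0// => i _; exact: sqr_ge0.
have [J [y [yS ynear]]] := net_exists (divr_gt0 kap0 m1) S1.
exists J, y; split => // g gy; rewrite leNgt; apply/negP => gr.
set N2 := \sum_k g k ^+ 2 in gr.
have N20 : 0 < N2 by exact: lt_trans gr.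
pose N := Num.sqrt N2; have N0 : 0 < N by rewrite sqrtr_gt0.
have NN : N ^+ 2 = N2 by rewrite sqr_sqrtr// ltW.
have Nr : Num.sqrt rho < N by rewrite ltr_sqrt.
pose s k := g k / N.
have sS : S s.
  rewrite /S/= /s; under eq_bigr do rewrite exprMn exprVn.
  by rewrite -mulr_suml -/N2 NN divff// gt_eqF.
have gs1 k : `|g k| <= N.
  have := S1 _ sS k; rewrite /s normrM normfV (gtr0_norm N0) ler_pdivrMr// mul1r//.
have [j yj] := ynear _ sS.
have := gy j; apply/negP; rewrite -leNgt.
have -> : \sum_k y j k * g k = N - \sum_k (s k - y j k) * g k.
  rewrite -[in RHS](mulfK (lt0r_neq0 N0) N) -expr2 NN /N2 mulr_suml -sumrB.
  by apply: eq_bigr => k _; rewrite /s; field; rewrite gt_eqF.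
have : \sum_k (s k - y j k) * g k <= kap * N.
  apply: (@le_trans _ _ (\sum_(k < m) kap / (m%:R + 1) * N)).
    apply: ler_sum => k _; apply: (le_trans (ler_norm _)); rewrite normrM ler_pM//.
  rewrite sumr_const card_ord -[leLHS]mulr_natr.
  have -> : kap / (m%:R + 1) * N * m%:R = m%:R / (m%:R + 1) * (kap * N) by field; rewrite gt_eqF.
  by rewrite ler_piMl ?mulr_ge0 ?(ltW kap0) ?(ltW N0)// ler_pdivrMr// mul1r lerDl.
have : tau <= (1 - kap) * N.
  rewrite /kap opprB addrC subrK mulrAC ler_pdivlMr//.
  by rewrite ler_pM2l// ltW.
lra.
Qed.

(** The square of the expectation is 1 / (1 + 2 s) = 1 - 2 s / (1 + 2 s), at most exp(- 2 s / (1 + 2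
    s)). *)
Lemma gE_gauss_le {R : realType} (s : R) : 0 <= s ->
  gE (fun x => expR (- s * x ^+ 2)) <= expR (- (s / (1 + 2 * s))).
Proof.
move=> s0; have sp : 0 < 1 + 2 * s by lra.
have i0 : gint (fun x : R => expR (- s * x ^+ 2)).
  apply: (@gam_integrable_bounded _ _ 1) => [|x].
    by apply: measurableT_comp => //; apply: measurable_funM => //; exact: measurable_funX.
  by rewrite ger0_norm ?expR_ge0// -[leRHS]expR0 ler_expR mulNr oppr_le0 mulr_ge0// sqr_ge0.
have -> : gE (fun x : R => expR (- s * x ^+ 2)) = (Num.sqrt (1 + 2 * s))^-1.
  apply: EFin_inj; rewrite (gE_EFin i0) integral_gam_expR; last by lra.
  by congr (_ ^-1)%:E; congr Num.sqrt; ring.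
rewrite -(@ler_pXn2r _ 2) ?nnegrE ?invr_ge0 ?sqrtr_ge0 ?expR_ge0// exprVn sqr_sqrtr ?(ltW sp)//.
rewrite -expRM_natl; apply: le_trans (expR_ge1Dx _).
by rewrite le_eqVlt; apply/orP; left; apply/eqP; field; rewrite gt_eqF.
Qed.

Lemma card_last {n k : nat} : (k <= n)%N ->
  #|[pred l : 'I_n | (n - k <= l)%N]| = k /\ #|[pred l : 'I_n | ~~ (n - k <= l)%N]| = (n - k)%N.
Proof.
move=> kn.
have c1 : #|[pred l : 'I_n | ~~ (n - k <= l)%N]| = (n - k)%N.
  rewrite (eq_card (B := [pred l : 'I_n | (l < n - k)%N])); last by move=> l; rewrite !inE -ltnNge.
  by rewrite -sum1_card (big_ord_narrow (leq_subr k n)) sum1_card card_ord.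
split=> //; have := cardC [pred l : 'I_n | (n - k <= l)%N]; rewrite card_ord.
rewrite (eq_card (A := predC _) (B := [pred l : 'I_n | ~~ (n - k <= l)%N])) // c1 => E.
by apply/eqP; rewrite -(eqn_add2r (n - k)) E subnKC.
Qed.

(** * The probability bound in a fixed dimension *)

Section one_dimension.
Context d (T : measurableType d) {R : realType} (P : probability T R).
Variables (q nu gamma : R) (m n k : nat) (A : T -> 'M[R]_(m, n)).
Hypotheses (q01 : 0 <= q <= 1) (nu0 : 0 <= nu) (gamma0 : 0 < gamma) (n0 : (0 < n)%N) (kn : (k <= n)%N).
Hypothesis iidA : iid_gaussian_matrix P A.

Let z1 := zfun q nu gamma.
Let z2 := zfun q (- nu) gamma.

Lemma recovery_prob (s s' lam tau1 tau2 rho M : R) :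
  0 <= s -> 0 <= s' <= gamma / 4 -> 0 < lam -> 0 < tau1 -> tau1 ^+ 2 < rho -> lam + 3 <= tau1 - tau2 ->
  gE (fun x => expR (s' * z1 x)) <= expR (s' * gE z1 + s' ^+ 2 * M) ->
  gE (fun x => expR (s' * z2 x)) <= expR (s' * gE z2 + s' ^+ 2 * M) ->
  exists F : set T, [/\ measurable F, F `<=` [set t | recovers q k (A t)] &
  1 - expR (s * rho - m%:R * (s / (1 + 2 * s)))
    - expR (s' * (k%:R * gE z1 + (n - k)%N%:R * gE z2 + n%:R * (gamma + s' * M) - Num.sqrt n%:R * tau2))
    - gE (fun x => expR (4^-1 * x ^+ 2)) * expR (- (lam ^+ 2 / 16))
    - expR (- n%:R) <= fine (P F)].
Proof.
move=> s0 s'01 lam0 tau10 taurho tau12 mgf1 mgf2; have /andP[s'0 s'g] := s'01.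
have [J [y [y1 ynet]]] := sphere_net m tau10 taurho.
pose m2 : R := gE (fun x => x ^+ 2).
have m20 : 0 <= m2 by apply: gE_ge0 => x; exact: sqr_ge0.
(* So large that the second-moment bound for the entries falls below exp(- n); the price is only a
   finer net. *)
pose Kb : R := (m * n)%:R * m2 * expR n%:R + 1.
have Kb1 : 1 <= Kb by rewrite lerDr !mulr_ge0// expR_ge0.
have Kb0 : 0 < Kb by apply: lt_le_trans Kb1.
have mn1 : 0 < (m * n)%:R * Kb + 1 by rewrite ltr_wpDl// mulr_ge0// ltW.
(* With this mesh, m n errors of size at most Kb times the mesh add up to at most lam / 2. *)
have e0 : 0 < lam / 2 / ((m * n)%:R * Kb + 1) by rewrite !divr_gt0.
have [I [w [wS wnear]]] := net_exists e0 (@unit_cone_coord R q n k).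
have w1 i : \sum_l w i l ^+ 2 = 1 by have [] := wS i.
pose zeta (l : 'I_n) (x : R) : R := s' * ((if (n - k <= l)%N then z1 x else z2 x) + gamma).
have cnu c : c = nu \/ c = - nu -> `|c| <= nu by move=> [->|->]; rewrite ?normrN ger0_norm.
have iz1 := gint_exp_zfun q01 (cnu nu (or_introl erefl)) gamma0 s'01.
have iz2 := gint_exp_zfun q01 (cnu (- nu) (or_intror erefl)) gamma0 s'01.
have zetaE (l : 'I_n) : (fun x => expR (zeta l x)) = (fun x => expR (s' * gamma) *
    (if (n - k <= l)%N then expR (s' * z1 x) else expR (s' * z2 x))).
  by apply/funext => x; rewrite /zeta mulrDr expRD mulrC; case: ifP.
have izeta l : gint (fun x => expR (zeta l x)).
  by rewrite zetaE; case: (n - k <= l)%N; exact: gintZ.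
have zetaP i (h : 'I_n -> R) : s' * Num.sqrt n%:R * - (\sum_l w i l * h l) <= \sum_l zeta l (h l).
  have -> : \sum_l zeta l (h l) =
      s' * \sum_(l < n) ((if (n - k <= l)%N then z1 (h l) else z2 (h l)) + gamma).
    by rewrite mulr_sumr.
  rewrite -mulrA ler_wpM2l//.
  exact: (unit_cone_width q01 h nu0 gamma0 n0 (wS i)).
have s20 : 0 <= s' * Num.sqrt n%:R by rewrite mulr_ge0// sqrtr_ge0.
have [F [mF FP PF]] := escape_prob w1 y1 iidA lam0 s0 s20 Kb0 tau12 ynet izeta zetaP.
exists F; split => // [t Ft /=|].
  have [tK tg] := FP t Ft.
  apply: recovers_of_unit_cone => // sv sS; apply: contrapT => /forallNP H.
  have As j : \sum_l A t j l * sv l = 0 by apply/eqP; have /negP := H j; rewrite negbK.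
  have [i wi] := wnear _ sS; have [j] := tg i; apply/negP; rewrite -leNgt.
  (* As sv is in the kernel, w i may be replaced by w i - sv, whose entries are at most the mesh;
     this contradicts the lower bound lam / 2. *)
  have -> : \sum_k0 \sum_l y j k0 * A t k0 l * w i l = \sum_k0 \sum_l y j k0 * A t k0 l * (w i l - sv l).
    apply: eq_bigr => k' _; under [RHS]eq_bigr do rewrite mulrBr.
    rewrite sumrB [X in _ = _ - X](_ : _ = y j k' * (\sum_l A t k' l * sv l)).
      by rewrite As mulr0 subr0.
    by rewrite mulr_sumr; apply: eq_bigr => l _; rewrite mulrA.
  apply: (@le_trans _ _ (\sum_(k' < m) \sum_(l < n) Kb * (lam / 2 / ((m * n)%:R * Kb + 1)))).
    apply: ler_sum => k' _; apply: ler_sum => l _; apply: le_trans (ler_norm _) _.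
    rewrite normrM ler_pM//; last by rewrite distrC.
    rewrite normrM -[leRHS]mul1r ler_pM//.
    rewrite -(@ler_pXn2r _ 2) ?nnegrE// expr1n real_normK ?num_real//.
    by rewrite -(y1 j) (bigD1 k')//= lerDl sumr_ge0// => ? _; exact: sqr_ge0.
  rewrite !sumr_const !card_ord -mulrnA -[leLHS]mulr_natl [(n * m)%N]mulnC.
  have e (a b c : R) : a * (b * (c / (a * b + 1))) = (a * b / (a * b + 1)) * c by ring.
  rewrite e.
  by rewrite ler_piMl ?divr_ge0 ?(ltW lam0)// ler_pdivrMr// mul1r lerDl.
apply: le_trans PF.
have T1 : expR (s * rho) * gE (fun x => expR (- s * x ^+ 2)) ^+ m <=
    expR (s * rho - m%:R * (s / (1 + 2 * s))).
  rewrite expRD ler_wpM2l ?expR_ge0// -mulrN expRM_natl.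
  by rewrite lerXn2r ?nnegrE ?expR_ge0 ?gE_gauss_le ?gE_ge0// => x; exact: expR_ge0.
have T2 : expR (- (s' * Num.sqrt n%:R * tau2)) * \prod_l gE (fun x => expR (zeta l x)) <=
    expR (s' * (k%:R * gE z1 + (n - k)%N%:R * gE z2 + n%:R * (gamma + s' * M) - Num.sqrt n%:R * tau2)).
  pose b (l : 'I_n) := s' * gamma + (s' * (if (n - k <= l)%N then gE z1 else gE z2) + s' ^+ 2 * M).
  have : \prod_l gE (fun x => expR (zeta l x)) <= \prod_l expR (b l).
    apply: ler_prod => l _; apply/andP; split; first by apply: gE_ge0 => x; exact: expR_ge0.
    rewrite zetaE /b expRD; case: (n - k <= l)%N.
      rewrite (gEZ _ iz1); apply: ler_wpM2l mgf1; exact: expR_ge0.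
    rewrite (gEZ _ iz2); apply: ler_wpM2l mgf2; exact: expR_ge0.
  rewrite -expR_sum => H; apply: (le_trans (ler_wpM2l (expR_ge0 _) H)).
  rewrite -expRD ler_expR le_eqVlt; apply/orP; left; apply/eqP.
  rewrite /b !big_split /= !sumr_const card_ord -!mulr_sumr.
  have -> : \sum_(l < n) (if (n - k <= l)%N then gE z1 else gE z2) =
      k%:R * gE z1 + (n - k)%N%:R * gE z2.
    have [cl cl'] := card_last kn.
    rewrite (bigID (fun l : 'I_n => (n - k <= l)%N)) /=.
    rewrite (eq_bigr (fun=> gE z1)); last by move=> l ->.
    rewrite [X in _ + X](eq_bigr (fun=> gE z2)); last by move=> l /negbTE ->.
    by rewrite !sumr_const cl cl' !mulr_natl.
  rewrite -[_ * gamma *+ n]mulr_natl -[_ * M *+ n]mulr_natl.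
  move: (gE z1) (gE z2) => E1 E2; ring.
have T4 : (m * n)%:R * m2 / Kb ^+ 2 <= expR (- n%:R).
  rewrite ler_pdivrMr ?exprn_gt0//.
  have -> : (m * n)%:R * m2 = expR (- n%:R) * ((m * n)%:R * m2 * expR n%:R).
    by rewrite mulrCA -expRD addNr expR0 mulr1.
  rewrite ler_wpM2l ?expR_ge0//; apply: (@le_trans _ _ Kb); first by rewrite lerDl.
  by rewrite -[leLHS]expr1 ler_weXn2l.
by rewrite lerB// lerB// lerB// lerB.
Qed.

End one_dimension.

(** * The phase transition *)

(** All terms decay at the smallest rate c; halving it absorbs the total prefactor B, since B <= c n
    / 2 <= exp(c n / 2) for n large. *)
Lemma sum_expR_le {R : realType} (b1 c1 b2 c2 B3 c3 : R) :
  0 < c1 -> 0 < c2 -> 0 <= B3 -> 0 < c3 ->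
  exists2 c : R, 0 < c & exists n0 : nat, forall n : nat, (n0 <= n)%N ->
    expR (b1 - c1 * n%:R) + expR (b2 - c2 * n%:R) + B3 * expR (- (c3 * n%:R)) + expR (- n%:R)
      <= expR (- c * n%:R).
Proof.
move=> c10 c20 B30 c30.
pose c := Num.min (Num.min c1 c2) (Num.min c3 1).
have c0 : 0 < c by rewrite !lt_min c10 c20 c30 ltr01.
have cc1 : c <= c1 by rewrite /c !ge_min lexx.
have cc2 : c <= c2 by rewrite /c !ge_min lexx orbT.
have cc3 : c <= c3 by rewrite /c !ge_min lexx !orbT.
have cc4 : c <= 1 by rewrite /c !ge_min lexx !orbT.
clearbody c.
pose B := expR b1 + expR b2 + B3 + 1.
have B0 : 0 <= B by rewrite !addr_ge0 ?expR_ge0.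
exists (c / 2); first by rewrite divr_gt0.
exists (Num.truncn (2 * B / c)).+1 => n nn.
have nB : 2 * B / c <= n%:R.
  by apply: ltW; apply: lt_le_trans (truncnS_gt _) _; rewrite ler_nat.
have n0 : 0 <= n%:R :> R by [].
have e (b c' : R) : c <= c' -> expR (b - c' * n%:R) <= expR b * expR (- (c * n%:R)).
  by move=> cc'; rewrite -expRD ler_expR lerD2l lerN2 ler_wpM2r.
apply: (@le_trans _ _ (B * expR (- (c * n%:R)))).
  rewrite /B !mulrDl mul1r; apply: lerD; last by rewrite ler_expR lerN2 ler_piMl.
  apply: lerD; last by rewrite ler_wpM2l// ler_expR lerN2 ler_wpM2r.
  by apply: lerD; exact: e.
have -> : - (c / 2) * n%:R = c / 2 * n%:R + - (c * n%:R) by field.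
rewrite expRD ler_wpM2r ?expR_ge0//; apply: le_trans (expR_ge1Dx _).
move: nB; rewrite ler_pdivrMr// mulrC => nB.
by rewrite -[leLHS]add0r lerD//; lra.
Qed.

(** * Choice of the multipliers *)

Section parameters.
Context {R : realType}.

(** Monotonicity is read off from the supremum over simple functions. It serves for [zsup] at gamma
    = 0, where [measurable_zfun] does not apply. *)
Lemma ge0_le_integral_nonmeas d (T : measurableType d) (mu : {measure set T -> \bar R})
    (f g : T -> \bar R) : (forall x, 0 <= f x)%E -> (forall x, f x <= g x)%E ->
  (\int[mu]_x f x <= \int[mu]_x g x)%E.
Proof.
move=> f0 fg; have g0 x : (0 <= g x)%E by exact: le_trans (fg x).
rewrite !ge0_integralTE//; apply: le_ereal_sup => _ [h /= hf <-]; exists h => // x.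
exact: le_trans (hf x) (fg x).
Qed.

Lemma I1secE (q nu gamma : R) : I1sec q nu gamma = (\int[gam R]_h zsup q nu gamma h)%E.
Proof. by []. Qed.

Lemma I2secE (q nu gamma : R) : I2sec q nu gamma = (\int[gam R]_h zsup q (- nu) gamma h)%E.
Proof.
apply: eq_integral => h _; congr ereal_sup; apply/seteqP.
by split => _ [w _ <-]; exists w => //; rewrite /zval mulNr.
Qed.

Lemma zsup_ge0 (q c gamma h : R) : (0 <= zsup q c gamma h)%E.
Proof.
apply: ereal_sup_ubound; exists 0 => //.
by rewrite /zval normr0 absq0 expr0n/= !mulr0 addr0 subr0.
Qed.

(** Pointwise |x| + exp(- x^2) >= 1, while the expectation of exp(- x^2) is less than 1. *)
Lemma gE_normr_gt0 : 0 < gE (fun x : R => `|x|).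
Proof.
have i1 := gint_abs (@gint_id R).
have i2 : gint (fun x : R => expR (- 1 * x ^+ 2)).
  apply: (@gam_integrable_bounded _ _ 1) => [|x].
    by apply: measurableT_comp => //; apply: measurable_funM => //; exact: measurable_funX.
  by rewrite ger0_norm ?expR_ge0// -[leRHS]expR0 ler_expR mulN1r oppr_le0 sqr_ge0.
have : 1 <= gE (fun x : R => `|x|) + gE (fun x : R => expR (- 1 * x ^+ 2)).
  rewrite -gED// -[leLHS](gE_cst 1); apply: gE_le => [||x]; [exact: gint_cst|exact: gintD|].
  have e0 := expR_ge0 (- 1 * x ^+ 2).
  rewrite /=; have [x1|x1] := leP 1 `|x|; first by lra.
  have := expR_ge1Dx (- 1 * x ^+ 2); rewrite -(real_normK (num_real x)).
  have : `|x| ^+ 2 <= `|x| by rewrite expr2 ler_piMl// ltW.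
  lra.
have := @gE_gauss_le R 1 ler01.
have : expR (- (1 / (1 + 2 * 1)) : R) < 1 by rewrite -[ltRHS]expR0 ltr_expR oppr_lt0 divr_gt0//; lra.
lra.
Qed.

Variables (q beta alpha : R).
Hypotheses (q01 : 0 <= q <= 1) (beta01 : 0 < beta < 1) (alpha0 : 0 < alpha).
Hypothesis hcond : (ereal_inf [set z | exists nu gamma : R, [/\ (0 <= nu)%R, (0 <= gamma)%R &
              z = ((beta%:E * I1sec q nu gamma) + ((1 - beta)%R%:E * I2sec q nu gamma)
                   + gamma%:E)%E]]
            < (Num.sqrt alpha)%:E)%E.

(** A pair below the threshold exists by definition of the infimum. It cannot have gamma = 0: the
    objective would exceed every t beta E|h|, by taking w = t. *)
Lemma good_multipliers : exists nu gamma : R, [/\ 0 <= nu, 0 < gamma &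
  beta * gE (zfun q nu gamma) + (1 - beta) * gE (zfun q (- nu) gamma) + gamma < Num.sqrt alpha].
Proof.
have /andP[b0 b1] := beta01.
have [z [nu [gamma [nu0 g0 ->]]] zr] := ereal_inf_lt hcond.
exists nu, gamma.
have I10 : (0 <= I1sec q nu gamma)%E by rewrite I1secE; apply: integral_ge0 => h _; exact: zsup_ge0.
have I20 : (0 <= I2sec q nu gamma)%E by rewrite I2secE; apply: integral_ge0 => h _; exact: zsup_ge0.
have gamma0 : 0 < gamma.
  rewrite lt_neqAle g0 andbT; apply/eqP => ge0; move: zr; rewrite -ge0 adde0; apply/negP.
  rewrite -leNgt; pose m1 := gE (fun x : R => `|x|).
  have m10 : 0 < m1 := gE_normr_gt0.
  (* The value for which beta t E|h| is exactly sqrt alpha. *)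
  pose t := Num.sqrt alpha / (beta * m1).
  have t0 : 0 <= t by rewrite divr_ge0 ?sqrtr_ge0// mulr_ge0// ltW.
  apply: (@le_trans _ _ (beta%:E * I1sec q nu 0)%E); last first.
    by rewrite leeDl// mule_ge0 ?lee_fin ?subr_ge0 ?(ltW b1)//; move: I20; rewrite -ge0.
  apply: (@le_trans _ _ (beta%:E * (\int[gam R]_h (t * `|h|)%:E))%E).
    have it : gint (fun h : R => t * `|h|) by apply: gintZ; exact: gint_abs (@gint_id R).
    rewrite -(gE_EFin it) gEZ; last exact: gint_abs (@gint_id R).
    by rewrite -EFinM lee_fin /t -/m1 mulrCA divfK// mulf_neq0 ?gt_eqF.
  rewrite lee_pmul2l// I1secE; apply: ge0_le_integral_nonmeas => h.
    by rewrite lee_fin mulr_ge0.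
  apply: (@le_trans _ _ (zval q nu 0 h t)%:E); last by apply: ereal_sup_ubound; exists t.
  rewrite lee_fin /zval mul0r subr0 (ger0_norm t0) mulrC lerDl.
  by rewrite mulr_ge0// absq_ge0.
have n1 : `|nu| <= nu by rewrite ger0_norm.
have n2 : `|- nu| <= nu by rewrite normrN.
split => //; rewrite -lte_fin; apply: le_lt_trans zr.
rewrite I1secE I2secE (integral_zsup q01 n1 gamma0) (integral_zsup q01 n2 gamma0).
by rewrite -!EFinM -!EFinD.
Qed.

End parameters.

(** Chernoff exponent for |a|^2 <= (r - eta)^2 N. Since 1 / (1 + 2 s) >= 1 - 2 s and 2 s r^2 = kap /
    2, half of the gain kap survives; rounding m down costs the additive s. *)
Lemma exponent1 {R : realType} (r eta N mR : R) : 0 < r -> 0 < N -> 0 <= mR ->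
  let kap := r ^+ 2 - (r - eta) ^+ 2 in let s := kap / (4 * r ^+ 2) in 0 < s ->
  r ^+ 2 * N - 1 <= mR ->
  s * ((r - eta) ^+ 2 * N) - mR * (s / (1 + 2 * s)) <= s - s * (kap / 2) * N.
Proof.
move=> r0 N0 m0 kap s s0 mN.
have u0 : 0 < 1 + 2 * s by rewrite ltr_wpDr// mulr_ge0// ltW.
set u := (1 + 2 * s)^-1.
have u1 : u <= 1 by rewrite invf_le1// lerDl mulr_ge0// ltW.
have up : 0 < u by rewrite invr_gt0.
have u2 : 1 - 2 * s <= u.
  rewrite /u -[leRHS]mul1r ler_pdivlMr//; have := sqr_ge0 s; lra.
have rs : r ^+ 2 * (2 * s) = kap / 2 by rewrite /s; field; rewrite gt_eqF.
have h1 : r ^+ 2 * N * (1 - 2 * s) <= r ^+ 2 * N * u.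
  by rewrite ler_wpM2l// mulr_ge0 ?sqr_ge0// ltW.
have h2 : (r ^+ 2 * N - 1) * u <= mR * u by rewrite ler_wpM2r// ltW.
have h3 : r ^+ 2 * N * (1 - 2 * s) = r ^+ 2 * N - kap / 2 * N by rewrite -rs; ring.
have -> : s * ((r - eta) ^+ 2 * N) - mR * (s / (1 + 2 * s)) =
  s * ((r - eta) ^+ 2 * N - mR * u) by rewrite /u; ring.
have -> : s - s * (kap / 2) * N = s * (1 - kap / 2 * N) by ring.
rewrite ler_pM2l//.
have -> : (r - eta) ^+ 2 * N = r ^+ 2 * N - kap * N by rewrite /kap; ring.
have h4 : (r ^+ 2 * N - 1) * u = r ^+ 2 * N * u - u by ring.
move: h1 h2; rewrite h3 h4; move: (r ^+ 2 * N * u) (r ^+ 2 * N) (mR * u) => W X Z h1 h2.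
have -> : kap * N = 2 * (kap / 2 * N) by field.
by move: (kap / 2 * N) h1 => Y h1; lra.
Qed.

(** Of the gap 5 eta, 4 eta is given up in the level r - 4 eta and eta / 2 to the second-order term,
    which leaves the rate eta / 2. Rounding k down costs at most one extra I2. *)
Lemma exponent2 {R : realType} (beta I1 I2 gamma r eta sM kR N : R) :
  0 <= I1 -> 0 <= I2 -> 0 <= N -> 5 * eta = r - (beta * I1 + (1 - beta) * I2 + gamma) ->
  sM <= eta / 2 -> kR <= beta * N -> beta * N <= kR + 1 ->
  kR * I1 + (N - kR) * I2 + N * (gamma + sM) - N * (r - 4 * eta) <= I2 - eta / 2 * N.
Proof.
move=> I10 I20 N0 er sM0 k1 k2.
have h1 : kR * I1 <= beta * N * I1 by rewrite ler_wpM2r.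
have h2 : (N - kR) * I2 <= (N - beta * N + 1) * I2 by rewrite ler_wpM2r//; lra.
have h3 : N * sM <= N * (eta / 2) by rewrite ler_wpM2l.
have h4 : N * (5 * eta) = N * (r - (beta * I1 + (1 - beta) * I2 + gamma)) by rewrite er.
lra.
Qed.

Theorem theorem3 (R : realType) (d : measure_display) (T : measurableType d)
  (P : probability T R) (q alpha beta : R)
  (hq : 0 <= q <= 1) (halpha : 0 < alpha <= 1) (hbeta : 0 < beta < 1)
  (A : forall n : nat, T -> 'M[R]_(Num.truncn (alpha * n%:R), n))
  (hA : forall n, iid_gaussian_matrix P (A n))
  (hcond : (ereal_inf [set z | exists nu gamma : R, [/\ (0 <= nu)%R, (0 <= gamma)%R &
              z = ((beta%:E * I1sec q nu gamma) + ((1 - beta)%R%:E * I2sec q nu gamma)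
                   + gamma%:E)%E]]
            < (Num.sqrt alpha)%:E)%E) :
  exists c : R, 0 < c /\
    \forall n \near \oo, exists F : set T, [/\ measurable F,
       F `<=` [set t | recovers q (Num.truncn (beta * n%:R)) (A n t)]
     & ((1 - expR (- c * n%:R))%:E <= P F)%E].
Proof.
have /andP[a0 a1] := halpha; have /andP[b0 b1] := hbeta.
have [nu [gamma [nu0 g0 hlt]]] := good_multipliers hq hbeta hcond.
set r := Num.sqrt alpha in hlt.
have r0 : 0 < r by rewrite sqrtr_gt0.
have r2 : r ^+ 2 = alpha by rewrite sqr_sqrtr// ltW.
have n1 : `|nu| <= nu by rewrite ger0_norm.
have n2 : `|- nu| <= nu by rewrite normrN.
have [M1 M10 mgf1] := mgf_zfun hq n1 g0.
have [M2 M20 mgf2] := mgf_zfun hq n2 g0.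
pose I1 := gE (zfun q nu gamma); pose I2 := gE (zfun q (- nu) gamma).
have I10 : 0 <= I1 by apply: gE_ge0 => x; exact: (zfun_ge0 hq n1 g0).
have I20 : 0 <= I2 by apply: gE_ge0 => x; exact: (zfun_ge0 hq n2 g0).
rewrite -/I1 -/I2 in hlt.
pose v0 := beta * I1 + (1 - beta) * I2 + gamma.
have v00 : 0 < v0 by rewrite ltr_wpDl// addr_ge0// mulr_ge0 ?(ltW b0)// subr_ge0 ltW.
(* The levels, in units of sqrt n, are r - eta for |a|, r - 2 eta on the sphere net and r - 4 eta
   for the width; the last two differ by lam + 3. *)
pose eta := (r - v0) / 5.
have eta0 : 0 < eta by rewrite divr_gt0// subr_gt0.
have etar : 5 * eta = r - v0 by rewrite /eta mulrC divfK.
have er : 5 * eta < r by rewrite etar ltrBlDr ltrDl.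
pose M := M1 + M2; have M0 : 0 <= M by rewrite addr_ge0.
(* The first bound is the range of [mgf_zfun]; the second keeps s' M below eta / 2. *)
pose s' := Num.min (gamma / 4) (eta / (2 * (M + 1))).
have M1' : 0 < 2 * (M + 1) by rewrite mulr_gt0// ltr_wpDl.
have s'0 : 0 < s' by rewrite lt_min (divr_gt0 eta0 M1') andbT divr_gt0.
have s'g : s' <= gamma / 4 by rewrite ge_min lexx.
have s'M : s' * M <= eta / 2.
  have : s' <= eta / (2 * (M + 1)) by rewrite ge_min lexx orbT.
  rewrite ler_pdivlMr//; clear -M0 s'0; nra.
have mgfM (f : R -> R) Mf : Mf <= M ->
    gE (fun x => expR (s' * f x)) <= expR (s' * gE f + s' ^+ 2 * Mf) ->
    gE (fun x => expR (s' * f x)) <= expR (s' * gE f + s' ^+ 2 * M).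
  by move=> Mf1 /le_trans; apply; rewrite ler_expR lerD2l ler_wpM2l// sqr_ge0.
have s'01 : 0 <= s' <= gamma / 4 by rewrite (ltW s'0).
have M1M : M1 <= M by rewrite lerDl.
have M2M : M2 <= M by rewrite lerDr.
have {}mgf1 := mgfM _ _ M1M (mgf1 _ s'01).
have {}mgf2 := mgfM _ _ M2M (mgf2 _ s'01).
pose kap := r ^+ 2 - (r - eta) ^+ 2.
have kap0 : 0 < kap by rewrite /kap; clear -eta0 er; nra.
pose s := kap / (4 * r ^+ 2).
have s0 : 0 < s by rewrite divr_gt0// mulr_gt0// exprn_gt0.
pose c4 : R := gE (fun x => expR (4^-1 * x ^+ 2)).
have c40 : 0 <= c4 by apply: gE_ge0 => x; exact: expR_ge0.
have [c c0 [n0 Hn]] := @sum_expR_le R s (s * (kap / 2)) (s' * I2) (s' * (eta / 2)) c4 (eta ^+ 2 / 16)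
  (mulr_gt0 s0 (divr_gt0 kap0 (ltr0Sn _ _))) (mulr_gt0 s'0 (divr_gt0 eta0 (ltr0Sn _ _))) c40
  (divr_gt0 (exprn_gt0 2 eta0) (ltr0Sn _ _)).
exists c; split => //.
(* From here on eta sqrt n >= 4, so lam = 2 eta sqrt n - 3 is at least eta sqrt n and the tail of g
   decays exponentially in n. *)
pose n3 := (Num.truncn ((4 / eta) ^+ 2)).+1.
exists (maxn n0 n3) => // n /=; rewrite geq_max => /andP[nn0 nn3].
have e4 : 0 < 4 / eta by rewrite divr_gt0.
have N34 : (4 / eta) ^+ 2 <= n%:R.
  by apply: ltW; apply: lt_le_trans (truncnS_gt _) _; rewrite ler_nat.
have N0 : 0 < n%:R :> R by apply: lt_le_trans N34; rewrite exprn_gt0.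
have npos : (0 < n)%N by rewrite -(ltr_nat R).
pose sq : R := Num.sqrt n%:R.
have sq0 : 0 < sq by rewrite sqrtr_gt0.
have sq2 : sq ^+ 2 = n%:R by rewrite sqr_sqrtr// ltW.
have esq : 4 <= eta * sq.
  rewrite mulrC -ler_pdivrMr// -(@ler_pXn2r _ 2) ?nnegrE ?(ltW e4) ?(ltW sq0)//.
  by rewrite sq2.
pose lam := 2 * (eta * sq) - 3.
pose tau1 := sq * (r - 2 * eta); pose tau2 := sq * (r - 4 * eta); pose rho := (r - eta) ^+ 2 * n%:R.
have lam_ge : eta * sq <= lam by rewrite /lam; clear -esq; lra.
have lam0 : 0 < lam by apply: lt_le_trans lam_ge; rewrite mulr_gt0.
have r2e : 0 < r - 2 * eta by clear -er eta0; lra.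
have tau10 : 0 < tau1 by rewrite mulr_gt0.
have taurho : tau1 ^+ 2 < rho.
  rewrite /tau1 /rho exprMn sq2 mulrC ltr_pM2r// ltrXn2r// ?nnegrE; clear -r2e eta0; lra.
have tau12 : lam + 3 <= tau1 - tau2.
  by rewrite le_eqVlt; apply/orP; left; apply/eqP; rewrite /lam /tau1 /tau2; ring.
set k := Num.truncn (beta * n%:R); set m := Num.truncn (alpha * n%:R) in A hA *.
have bn0 : 0 <= beta * n%:R by rewrite mulr_ge0// ltW.
have /andP[kb bk] := truncn_itv bn0; rewrite -/k in kb bk.
have an0 : 0 <= alpha * n%:R by rewrite mulr_ge0// ltW.
have /andP[_ am] := truncn_itv an0.
have kn : (k <= n)%N.
  by rewrite -(ler_nat R) (le_trans kb)// ler_piMl ?(ltW N0)// ltW.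
have [F [mF FR PF]] := recovery_prob hq nu0 g0 npos kn (hA n) (ltW s0) s'01 lam0 tau10 taurho tau12 mgf1 mgf2.
exists F; split => //.
have Pfin : P F \is a fin_num by exact: fin_num_measure.
rewrite -(fineK Pfin) lee_fin; apply: le_trans PF.
have E1 : s * rho - m%:R * (s / (1 + 2 * s)) <= s - s * (kap / 2) * n%:R.
  apply: exponent1 => //.
  by rewrite r2 lerBlDr natr1; exact: ltW am.
have E2 : s' * (k%:R * I1 + (n - k)%N%:R * I2 + n%:R * (gamma + s' * M) - sq * tau2)
    <= s' * I2 - s' * (eta / 2) * n%:R.
  rewrite -mulrA -mulrBr ler_pM2l// natrB//.
  have -> : sq * tau2 = n%:R * (r - 4 * eta) by rewrite /tau2 mulrA -expr2 sq2.
  apply: (@exponent2 _ beta) => //; rewrite natr1; exact: ltW.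
have E3 : - (lam ^+ 2 / 16) <= - (eta ^+ 2 / 16 * n%:R).
  rewrite lerN2 mulrAC ler_pM2r ?invr_gt0// -sq2 -exprMn lerXn2r// ?nnegrE; last exact: ltW.
  by rewrite mulr_ge0 ?(ltW eta0) ?(ltW sq0).
have := Hn n nn0; rewrite -lerN2 => H.
apply: (@le_trans _ _ (1 - (expR (s - s * (kap / 2) * n%:R) + expR (s' * I2 - s' * (eta / 2) * n%:R) +
  c4 * expR (- (eta ^+ 2 / 16 * n%:R)) + expR (- n%:R)))); first by rewrite lerD2l.
rewrite !opprD !addrA lerD2r lerB// ?ler_wpM2l ?ler_expR// lerB ?ler_expR// lerB ?ler_expR//.
Qed.
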